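(* Let $\mathcal{T}_h$ be a triangulation of a connected two-dimensional polygonal domain $\Omega\subset\mathbb{R}^2$ with no holes, and let $K$ be its associated simplicial complex (all triangles of $\mathcal{T}_h$ together with their edges and vertices). Suppose that: 1) $K$ is strongly collapsible, via vertices $x_0,x_1,\dots,x_N$ and simplicial complexes $K=K_0\supseteq K_1\supseteq\cdots\supseteq K_N$ as in the definition of strong collapsibility; 2) (non-collinear condition) for each $x_i$ that is a vertex of two triangles $T_1,T_2\in K_i$, the edge of $T_1$ opposite to $x_i$ and the edge of $T_2$ opposite to $x_i$ do not lie on the same line. Then Strang's conjecture holds on $\mathcal{T}_h$ in the case $k=2$, i.e. $$\dim S_h^2(\mathcal{T}_h)=\mathcal{S}_h^2 = 6N_T-5\mathring{N}_e+3\mathring{N}_v .$$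
   Context: **Splines.** A triangulation is a finite conforming triangulation (any two triangles meet in a common edge, a common vertex, or not at all). ''Polygonal region with no holes'' means a connected polygonal region bounded by a single simple closed polygon (its closure is homeomorphic to a closed disk). $P^k(T)$ is the space of bivariate polynomials of degree at most $k$ on a triangle $T$, and $$S_h^k(\mathcal{T}_h)=\{v\in C^1(\Omega): v|_T\in P^k(T)\ \forall T\in\mathcal{T}_h\}.$$ Strang's number is $\mathcal{S}_h^k=\binom{k+2}{2}N_T-(2k+1)\mathring{N}_e+3\mathring{N}_v$, where $N_T$, $\mathring{N}_e$, $\mathring{N}_v$ are the numbers of triangles, interior edges and interior vertices of $\mathcal{T}_h$. **Simplicial complexes.** All simplicial complexes are finite, in the plane. $\Delta(K)$ is the set of all simplices of $K$ and $\Delta_j(K)$ the set of its $j$-dimensional simplices; for a simplex $\sigma$, $\Delta(\sigma)$ and $\Delta_j(\sigma)$ denote the sets of its sub-simplices (including $\sigma$ itself) and its $j$-dimensional sub-simplices. - $K$ *forms a triangulation* if every edge or vertex of $K$ is an edge or vertex of at least one triangle of $K$. - An edge of $K$ is a *boundary edge* of $K$ if it is an edge of at most one triangle of $K$. A vertex $v$ is a *boundary vertex* of $K$ if $v\in\Delta_0(e)$ for some boundary edge $e$ of $K$. - For a vertex $x$ of $K$: $$\mathfrak{Z}(x,K)=\{\sigma\in\Delta(K): x\in\Delta_0(\sigma)\},$$ $$\overline{\mathfrak{Z}}(x,K)=\{\sigma\in\Delta(K): \sigma\in\Delta(T)\text{ for some }T\in\mathfrak{Z}(x,K)\},$$ $$\beta(x,K)=\mathfrak{Z}(x,K)\cup\{\sigma\in\overline{\mathfrak{Z}}(x,K)\setminus\mathfrak{Z}(x,K):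 \sigma\notin\Delta(T)\ \ \forall T\in\Delta_2(K\setminus\mathfrak{Z}(x,K))\},$$ where $\Delta_2(K\setminus\mathfrak{Z}(x,K))$ is the set of triangles of $K$ not having $x$ as a vertex. **Strong collapsibility.** A simplicial complex $K$ of the plane that forms a triangulation is *strongly collapsible* if there exist $x_0,x_1,\dots,x_N\in\Delta_0(K)$ and simplicial complexes $K=K_0\supseteq K_1\supseteq\cdots\supseteq K_N$ such that: 1. each $K_i$ forms a triangulation; 2. $x_i$ is a boundary vertex of $K_i$ and is contained in at most two triangles of $K_i$; if it is contained in two triangles $T_1$ and $T_2$, they share a common edge; 3. $K_{i+1}=\{\sigma\in K_i:\sigma\notin\beta(x_i,K_i)\}$ for $0\le i<N$; 4. $K_N$ is composed of one triangle and its sub-simplices. *)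

(* Defs.v *)
From HB Require Import structures.
From mathcomp Require Import all_boot all_order all_algebra.
From mathcomp Require Import finmap.
From mathcomp Require Import all_classical all_reals all_analysis.
Set Implicit Arguments.
Unset Strict Implicit.
Unset Printing Implicit Defensive.
Import Order.TTheory GRing.Theory Num.Theory.
Import numFieldNormedType.Exports.
Local Open Scope classical_set_scope.
Local Open Scope ring_scope.

Notation plane R := 'rV[R]_2.

(* A simplex is encoded by the finite set of its vertices; its sub-simplices
   are then the nonempty subsets, and [hull s] is the closed simplex as a
   subset of the plane ([hull fset0] is empty). *)
Notation simplex R := {fset plane R}.
Notation complex R := {fset {fset plane R}}.

Definition hull (R : realType) (s : simplex R) : set (plane R) :=
  [set x | exists w : plane R -> R,
     [/\ forall p, p \in s -> 0 <= w p,
         \sum_(p <- s) w p = 1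
       & x = \sum_(p <- s) w p *: p]].

Definition affinely_independent (R : realType) (s : simplex R) : Prop :=
  forall w : plane R -> R,
    \sum_(p <- s) w p = 0 -> \sum_(p <- s) w p *: p = 0 ->
    forall p, p \in s -> w p = 0.

(* The common face [f] may be [fset0]: the two simplices are then disjoint. *)
Definition meet_in_common_face (R : realType) (s t : simplex R) : Prop :=
  exists f : simplex R,
    [/\ (f `<=` s)%fset, (f `<=` t)%fset & hull s `&` hull t = hull f].

Definition simplicial_complex (R : realType) (K : complex R) : Prop :=
  [/\ forall s, s \in K -> s != fset0 /\ affinely_independent s,
      forall s t, s \in K -> (t `<=` s)%fset -> t != fset0 -> t \in K
    & forall s t, s \in K -> t \in K -> meet_in_common_face s t].

Section Complexes.
Variable R : realType.
Implicit Types (K : complex R) (s e T : simplex R) (x : plane R).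

Definition simplices (j : nat) K : complex R :=
  [fset s in K | #|` s| == j.+1]%fset.

Definition triangles_around K s : complex R :=
  [fset T in simplices 2 K | (s `<=` T)%fset]%fset.

Definition forms_triangulation K : Prop :=
  forall s, s \in simplices 0 K \/ s \in simplices 1 K ->
    exists2 T, T \in simplices 2 K & (s `<=` T)%fset.

Definition boundary_edges K : complex R :=
  [fset e in simplices 1 K | (#|` triangles_around K e| <= 1)%N]%fset.

Definition boundary_vertex K (v : plane R) : bool :=
  has (fun e : simplex R => v \in e) (boundary_edges K).

Definition interior_edges K : complex R :=
  (simplices 1 K `\` boundary_edges K)%fset.

Definition interior_vertices K : complex R :=
  [fset s in simplices 0 K | ~~ has (boundary_vertex K) s]%fset.

Definition star x K : complex R := [fset s in K | x \in s]%fset.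

Definition closed_star x K : complex R :=
  [fset s in K | has (fun T : simplex R => (s `<=` T)%fset) (star x K)]%fset.

Definition beta x K : complex R :=
  (star x K `|`
   [fset s in closed_star x K `\` star x K |
     all (fun T : simplex R => ~~ (s `<=` T)%fset)
         (simplices 2 (K `\` star x K))])%fset.

(* Only the values [x i] and [Ks i] for [i <= N] are meaningful. *)
Definition strong_collapse K (N : nat) (x : nat -> plane R)
    (Ks : nat -> complex R) : Prop :=
  [/\ Ks 0%N = K,
      forall i, (i <= N)%N ->
        [/\ simplicial_complex (Ks i), forms_triangulation (Ks i)
          & [fset x i]%fset \in simplices 0 K],
      forall i, (i <= N)%N ->
        [/\ boundary_vertex (Ks i) (x i),
            (#|` triangles_around (Ks i) [fset x i]%fset| <= 2)%N
          & forall T1 T2,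
              T1 \in triangles_around (Ks i) [fset x i]%fset ->
              T2 \in triangles_around (Ks i) [fset x i]%fset -> T1 != T2 ->
              exists2 e, e \in simplices 1 (Ks i) &
                         (e `<=` T1)%fset && (e `<=` T2)%fset],
      forall i, (i < N)%N ->
        (Ks i.+1 `<=` Ks i)%fset /\
        Ks i.+1 = [fset s in Ks i | s \notin beta (x i) (Ks i)]%fset
    & exists2 T, #|` T| = 3%N &
        forall s, s \in Ks N <-> (s `<=` T)%fset /\ s != fset0].

Definition is_line (L : set (plane R)) : Prop :=
  exists a u : plane R, u != 0 /\ L = [set a + t *: u | t in [set: R]].

Definition noncollinear_condition (N : nat) (x : nat -> plane R)
    (Ks : nat -> complex R) : Prop :=
  forall i T1 T2, (i <= N)%N ->
    T1 \in triangles_around (Ks i) [fset x i]%fset ->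
    T2 \in triangles_around (Ks i) [fset x i]%fset -> T1 != T2 ->
    ~ exists L, [/\ is_line L, hull (T1 `\ x i)%fset `<=` L
                  & hull (T2 `\ x i)%fset `<=` L].

Definition complex_of (Th : complex R) : complex R :=
  (\bigcup_(T <- Th) [fset s in fpowerset T | s != fset0])%fset.

(* Vertices [p i] in cyclic order.  Injectivity of the parametrization of the
   half-open sides says that the closed polygon is simple. *)
Definition side_point (m : nat) (p : 'I_m -> plane R) (i : 'I_m) (t : R) :=
  (1 - t) *: p i + t *: p (ordS i).

Definition simple_closed_polygon (m : nat) (p : 'I_m -> plane R) : Prop :=
  (3 <= m)%N /\
  forall (i j : 'I_m) (a b : R), 0 <= a < 1 -> 0 <= b < 1 ->
    side_point p i a = side_point p j b -> i = j /\ a = b.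

Definition polygon_trace (m : nat) (p : 'I_m -> plane R) : set (plane R) :=
  [set y | exists i t, 0 <= t <= 1 /\ y = side_point p i t].

Definition polygonal_domain_no_holes (Omega : set (plane R)) : Prop :=
  [/\ open Omega, connected Omega, bounded_set Omega
    & exists (m : nat) (p : 'I_m -> plane R),
        simple_closed_polygon p /\ closure Omega `\` Omega = polygon_trace p].

Definition triangulation_of (Omega : set (plane R)) (Th : complex R) : Prop :=
  [/\ forall T, T \in Th -> #|` T| = 3%N /\ affinely_independent T,
      forall T1 T2, T1 \in Th -> T2 \in Th -> T1 != T2 ->
        meet_in_common_face T1 T2
    & closure Omega = [set y | exists2 T, T \in Th & hull T y]].

(* Splines are total functions on the plane, identified when they
   agree on [Omega]. *)

Definition C1_on (Omega : set (plane R)) (f : plane R -> R) : Prop :=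
  forall y, Omega y ->
    differentiable f y /\
    forall u : plane R, {for y, continuous (fun z => 'd f z u)}.

Definition polynomial_on (k : nat) (A : set (plane R)) (f : plane R -> R) :=
  exists c : nat -> nat -> R, forall y, A y ->
    f y = \sum_(i < k.+1) \sum_(j < k.+1 | (i + j <= k)%N)
            c i j * y 0 0 ^+ i * y 0 1 ^+ j.

Definition spline_space (k : nat) (Omega : set (plane R)) (Th : complex R)
    : set (plane R -> R) :=
  [set v | C1_on Omega v /\ forall T, T \in Th -> polynomial_on k (hull T) v].

Definition has_dimension (Omega : set (plane R)) (S : set (plane R -> R))
    (d : nat) : Prop :=
  exists b : 'I_d -> plane R -> R,
    [/\ forall i, S (b i),
        forall c : 'I_d -> R,
          (forall y, Omega y -> \sum_i c i * b i y = 0) -> forall i, c i = 0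
      & forall v, S v -> exists c : 'I_d -> R,
          forall y, Omega y -> v y = \sum_i c i * b i y].

Definition strang_number (k : nat) (Th : complex R) : int :=
  ('C(k.+2, 2))%:Z * (#|` Th|)%:Z
  - (k.*2.+1)%:Z * (#|` interior_edges (complex_of Th)|)%:Z
  + 3%:Z * (#|` interior_vertices (complex_of Th)|)%:Z.

End Complexes.

(* Main.v *)
(** Read backwards, a strong collapse attaches triangles one at a time.  Encode
    a spline by its quadratic pieces, two pieces being glued along an edge when
    the 1-jet of their difference vanishes at both ends.  Attaching a triangle
    without (resp. with one) common edge adds 6 (resp. 1) to the dimension, as
    in Strang's number.  When it is glued along two edges [yx] and [yw], the
    jump between the two neighbouring pieces must lie in the plane spanned by
    the squares of the equations of the two edges, and the dimension drops by
    the number of conditions that this really imposes on the old splines: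

    - if [y] becomes an interior vertex, the 1-jets of all the pieces around [y]
      agree, a single condition is left, and it is not void because of the
      non-collinear condition;
    - if [y] is still a boundary vertex, the jump is an arbitrary quadratic
      polynomial and there are 4 conditions.  Indeed some function constant on
      the triangles takes different values on the two neighbours and jumps at
      no interior edge but [yx]: it is the parity of the number of crossings of
      a vertical ray with a closed walk made of [xy] and of edges that are not
      interior.  Such a walk exists because the boundary vertices stay
      connected by these edges: for the whole mesh, its boundary edges form the
      polygon bounding the domain, and at each step a new boundary vertex is
      adjacent to the removed one.

    That the boundary edges cover the polygon follows from a parity argument: an
    even number of them leave each vertex, the polygon is locally made of two
    rays, so the boundary edges form an open and closed part of it. *)

(* Quadratics make each attachment computable because the difference of two pieces glued along an
   edge has an affine gradient vanishing at both ends: it is a multiple of the square of the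
   equation of the edge ([jet0_line]). Gluing along one edge therefore leaves one parameter. Gluing
   along two edges leaves none, since only 0 has a zero 1-jet at the three vertices of a triangle.

   The obstacle is that the intermediate complexes may be pinched at a vertex or disconnected, so
   they need not be meshes of polygonal domains. The induction therefore runs over sets [TT] of
   triangles of one fixed mesh [Th], with conditions across edges only, and speaks of coefficients,
   not of functions. The domain is needed for the connectedness of the boundary vertices of the
   whole mesh, and for the passage from coefficients to functions at the end: a boundary vertex has
   only two boundary edges, so the triangles around it are linked through edges and their pieces
   have a common value there. *)
Require Import Defs.
From HB Require Import structures.
From mathcomp Require Import all_boot all_order all_algebra.
From mathcomp Require Import finmap.
From mathcomp Require Import all_classical all_reals all_analysis.
From mathcomp Require Import ring lra zify.
Set Implicit Arguments.
Unset Strict Implicit.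
Unset Printing Implicit Defensive.
Import Order.TTheory GRing.Theory Num.Theory.
Import numFieldNormedType.Exports.
Local Open Scope classical_set_scope.
Local Open Scope ring_scope.

(** * Barycentric weights *)

Section Weights.
Variable R : realType.
Implicit Types (s f T : simplex R) (x y z a b c : plane R).

Lemma planeP x y : x 0 0 = y 0 0 -> x 0 1 = y 0 1 -> x = y.
Proof.
move=> e0 e1; apply/rowP => i; case: i => [[|[|//]] hi].
- by rewrite (_ : Ordinal hi = 0) //; apply: val_inj.
- by rewrite (_ : Ordinal hi = 1) //; apply: val_inj.
Qed.

Lemma big_fset_sub (V : nmodType) s f (F : plane R -> V) : (f `<=` s)%fset ->
  \sum_(p <- f) F p = \sum_(p <- s) (if p \in f then F p else 0).
Proof.
move=> fs; rewrite -big_mkcond /= -[RHS]big_filter; apply: perm_big.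
apply: uniq_perm; [exact: fset_uniq|exact/filter_uniq/fset_uniq|].
move=> p; rewrite mem_filter; case: (boolP (p \in f)) => //= pf.
by rewrite (fsubsetP fs).
Qed.

Lemma affine_weights_unique s (w w' : plane R -> R) : affinely_independent s ->
  \sum_(p <- s) w p = \sum_(p <- s) w' p ->
  \sum_(p <- s) w p *: p = \sum_(p <- s) w' p *: p ->
  forall p, p \in s -> w p = w' p.
Proof.
move=> si e1 e2 p ps; apply/eqP; rewrite -subr_eq0; apply/eqP.
apply: (si (fun p => w p - w' p)) => //.
- by rewrite sumrB e1 subrr.
- under eq_bigr do rewrite scalerBl.
  by rewrite sumrB e2 subrr.
Qed.

(** Barycentric weights are unique, and weights on [f] extended by 0 are weights on [s]. *)
Lemma hull_face_weights s f (w : plane R -> R) : affinely_independent s ->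
  (f `<=` s)%fset -> \sum_(p <- s) w p = 1 ->
  hull f (\sum_(p <- s) w p *: p) -> forall p, p \in s -> p \notin f -> w p = 0.
Proof.
move=> si fs w1 [w' [w'0 w'1 e]] p ps pf.
pose w2 q := if q \in f then w' q else 0.
suff -> : w p = w2 p by rewrite /w2 (negbTE pf).
apply: (affine_weights_unique si _ _ ps).
- by rewrite w1 -w'1 (big_fset_sub _ fs).
- rewrite e (big_fset_sub _ fs); apply: eq_bigr => q _.
  by rewrite /w2; case: ifP => //; rewrite scale0r.
Qed.

Lemma hull_sub s f : (f `<=` s)%fset -> hull f `<=` hull s.
Proof.
move=> fs y [w [w0 w1 ->]]; exists (fun p => if p \in f then w p else 0); split.
- by move=> p ps; case: ifP => // /w0.
- by rewrite -w1 (big_fset_sub _ fs).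
- rewrite (big_fset_sub _ fs); apply: eq_bigr => p _; case: ifP => // _.
  by rewrite scale0r.
Qed.

Lemma fset3P (T : simplex R) : #|` T| = 3%N ->
  exists a b c, [/\ T = [fset a; b; c]%fset, a != b, a != c & b != c].
Proof.
have mT x : (x \in T) = (x \in enum_fset T) by [].
have uT := fset_uniq T; move: mT uT.
case: (enum_fset T) => [//|a [//|b [//|c []//]]] mT /= uT _.
move: uT; rewrite !inE negb_or andbT => /andP[/andP[ab ac] bc].
exists a, b, c; split => //; apply/fsetP => x.
by rewrite mT !inE orbA.
Qed.

Lemma big_fset3 (V : nmodType) a b c (F : plane R -> V) :
  a != b -> a != c -> b != c ->
  \sum_(p <- [fset a; b; c]%fset) F p = F a + F b + F c.
Proof.
move=> ab ac bc.
rewrite (perm_big [:: a; b; c]) /= ?(big_cons, big_nil) ?addr0 ?addrA //.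
apply: uniq_perm; [exact: fset_uniq|by rewrite /= !inE negb_or ab ac bc|].
by move=> x; rewrite !inE orbA.
Qed.

Lemma big_fset2 (V : nmodType) a b (F : plane R -> V) : a != b ->
  \sum_(p <- [fset a; b]%fset) F p = F a + F b.
Proof.
move=> ab; rewrite (perm_big [:: a; b]) /= ?(big_cons, big_nil) ?addr0 //.
apply: uniq_perm; [exact: fset_uniq|by rewrite /= !inE ab|].
by move=> x; rewrite !inE.
Qed.

(** Twice the signed area of the triangle [abc]; as a function of [c], an affine equation of the
    line [ab]. *)
Definition det3 a b c : R :=
  (b 0 0 - a 0 0) * (c 0 1 - a 0 1) - (b 0 1 - a 0 1) * (c 0 0 - a 0 0).

Lemma affinely_independent_det a b c : a != b -> a != c -> b != c ->
  affinely_independent [fset a; b; c]%fset -> det3 a b c != 0.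
Proof.
move=> ab ac bc ai; apply/negP => /eqP d0.
have key u v w : u + v + w = 0 -> u *: a + v *: b + w *: c = 0 ->
    u = 0 /\ v = 0.
  move=> s0 l0.
  have := ai (fun p => if p == a then u else if p == b then v else w).
  have [ba ca cb] : [/\ b != a, c != a & c != b] by split; rewrite eq_sym.
  rewrite !big_fset3 // !eqxx (negbTE ba) (negbTE ca) (negbTE cb) => /(_ s0 l0) h.
  split; first by have := h a; rewrite !inE !eqxx => ->.
  by have := h b; rewrite !inE eqxx (negbTE ba) orbT => ->.
rewrite /det3 in d0.
(* If the determinant vanishes, the differences of one coordinate along the sides are the
   coefficients of an affine relation between the vertices. *)
have [_ h0] := key (c 0 0 - b 0 0) (a 0 0 - c 0 0) (b 0 0 - a 0 0) ltac:(ring)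
    ltac:(apply: planeP; rewrite !mxE; [ring | nra]).
have [_ h1] := key (c 0 1 - b 0 1) (a 0 1 - c 0 1) (b 0 1 - a 0 1) ltac:(ring)
    ltac:(apply: planeP; rewrite !mxE; [nra | ring]).
by case/negP: ac; apply/eqP/planeP; lra.
Qed.
End Weights.

(** * Triangles of a mesh *)

Section Mesh.
Variable R : realType.
Implicit Types (s f T : simplex R) (x y z a b c : plane R) (Th : complex R).

Lemma fset3_rot a b c : [fset a; b; c]%fset = [fset b; c; a]%fset.
Proof. by apply/fsetP => x; rewrite !inE -orbA orbC. Qed.

Lemma fset3_swap a b c : [fset a; b; c]%fset = [fset a; c; b]%fset.
Proof. by apply/fsetP => x; rewrite !inE orbAC. Qed.

Lemma fset3_mem1 T y : #|` T| = 3%N -> y \in T ->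
  exists a b, [/\ T = [fset y; a; b]%fset, y != a, y != b & a != b].
Proof.
move=> /fset3P[a [b [c [-> ab ac bc]]]]; rewrite !inE -orbA => /or3P[] /eqP ->.
- by exists b, c.
- by exists c, a; split => //; [rewrite fset3_rot|rewrite eq_sym|rewrite eq_sym].
- by exists a, b; split; rewrite // 1?eq_sym //; rewrite -fset3_rot.
Qed.

Lemma fset3_mem2 T y a : #|` T| = 3%N -> y \in T -> a \in T -> y != a ->
  exists b, [/\ T = [fset y; a; b]%fset, y != b & a != b].
Proof.
move=> T3 yT aT ya; have [b [c [e yb yc bc]]] := fset3_mem1 T3 yT.
move: aT; rewrite e !inE eq_sym (negbTE ya) /= => /orP[] /eqP ->.
- by exists c.
- by exists b; split; rewrite // 1?eq_sym // fset3_swap.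
Qed.

Lemma hull3P a b c y : a != b -> a != c -> b != c ->
  hull [fset a; b; c]%fset y <-> exists u v w,
    [/\ 0 <= u, 0 <= v, 0 <= w, u + v + w = 1 & y = u *: a + v *: b + w *: c].
Proof.
move=> ab ac bc; split.
  move=> [w [w0]]; rewrite !big_fset3 // => w1 ->.
  by exists (w a), (w b), (w c); split; rewrite ?w0 // !inE eqxx ?orbT.
move=> [u [v [w [u0 v0 w0 s1 ->]]]].
exists (fun p => if p == a then u else if p == b then v else w).
have [ba ca cb] : [/\ b != a, c != a & c != b] by split; rewrite eq_sym.
split; last 2 first.
- by rewrite big_fset3 // !eqxx (negbTE ba) (negbTE ca) (negbTE cb).
- by rewrite big_fset3 // !eqxx (negbTE ba) (negbTE ca) (negbTE cb).
- by move=> p _; case: ifP => // _; case: ifP.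
Qed.

Lemma hull2P a b y : a != b ->
  hull [fset a; b]%fset y <-> exists2 t, 0 <= t <= 1 & y = (1 - t) *: a + t *: b.
Proof.
move=> ab; have ba : b != a by rewrite eq_sym.
split.
  move=> [w [w0]]; rewrite !big_fset2 // => w1 ->.
  exists (w b); last by rewrite -w1 addrK.
  have := w0 a; have := w0 b; rewrite !inE !eqxx orbT => /(_ isT) h1 /(_ isT) h2.
  by rewrite h1 -w1 lerDr.
move=> [t /andP[t0 t1] ->].
exists (fun p => if p == a then 1 - t else t); split.
- by move=> p _; case: ifP => // _; rewrite subr_ge0.
- by rewrite big_fset2 // eqxx (negbTE ba) subrK.
- by rewrite big_fset2 // eqxx (negbTE ba).
Qed.

Lemma hull1E a : hull [fset a]%fset = [set a].
Proof.
apply/seteqP; split => y /=.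
  by move=> [w [_]]; rewrite !big_seq_fset1 => -> ->; rewrite scale1r.
by move=> ->; exists (fun=> 1); split; rewrite ?big_seq_fset1 ?scale1r.
Qed.

Lemma barycentric a b c y : det3 a b c != 0 ->
  y = (det3 b c y / det3 a b c) *: a + (det3 c a y / det3 a b c) *: b +
      (det3 a b y / det3 a b c) *: c.
Proof. by move=> D0; apply: planeP; rewrite !mxE; rewrite /det3 in D0 *; field. Qed.

Lemma barycentric_sum a b c y : det3 a b c != 0 ->
  det3 b c y / det3 a b c + det3 c a y / det3 a b c + det3 a b y / det3 a b c = 1.
Proof. by move=> D0; rewrite /det3 in D0 *; field. Qed.

Lemma hull3_det a b c y : a != b -> a != c -> b != c -> det3 a b c != 0 ->
  hull [fset a; b; c]%fset y <->
  [/\ 0 <= det3 b c y / det3 a b c, 0 <= det3 c a y / det3 a b c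
    & 0 <= det3 a b y / det3 a b c].
Proof.
move=> ab ac bc D0; rewrite hull3P //; split.
  move=> [u [v [w [u0 v0 w0 s1 ->]]]].
  have eu : u = 1 - v - w by rewrite -s1; ring.
  have D0' := D0; rewrite /det3 in D0'; split.
  - by rewrite (_ : _ / _ = u) // /det3 !mxE eu; field.
  - by rewrite (_ : _ / _ = v) // /det3 !mxE eu; field.
  - by rewrite (_ : _ / _ = w) // /det3 !mxE eu; field.
move=> [h1 h2 h3]; do 3 eexists; split; [exact: h1|exact: h2|exact: h3|..].
  exact: barycentric_sum.
exact: barycentric.
Qed.

Definition triangle_mesh Th : Prop :=
  (forall T, T \in Th -> #|` T| = 3%N /\ affinely_independent T) /\
  (forall T T', T \in Th -> T' \in Th -> meet_in_common_face T T').

(** The point lies in the common face of the two triangles, which carries all its nonzero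
    weights. *)
Lemma mesh_weights Th T T' (w : plane R -> R) : triangle_mesh Th ->
  T \in Th -> T' \in Th ->
  (forall p, p \in T -> 0 <= w p) -> \sum_(p <- T) w p = 1 ->
  hull T' (\sum_(p <- T) w p *: p) -> forall p, p \in T -> w p != 0 -> p \in T'.
Proof.
move=> [mT mM] TT TT' w0 w1 hT' p pT; apply: contra_neqT => pT'.
have [f [fT fT' e]] := mM _ _ TT TT'.
have [_ ai] := mT _ TT.
apply: (@hull_face_weights _ T f) => //.
  by rewrite -e; split => //; exists w.
by apply: contra pT' => /(fsubsetP fT').
Qed.

Lemma mesh_bary Th a b c T' u v w : triangle_mesh Th ->
  a != b -> a != c -> b != c ->
  [fset a; b; c]%fset \in Th -> T' \in Th ->
  0 <= u -> 0 <= v -> 0 <= w -> u + v + w = 1 ->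
  hull T' (u *: a + v *: b + w *: c) ->
  [/\ u != 0 -> a \in T', v != 0 -> b \in T' & w != 0 -> c \in T'].
Proof.
move=> mesh ab ac bc TT TT' u0 v0 w0 s1 hT'.
pose wt p : R := if p == a then u else if p == b then v else w.
have [ba ca cb] : [/\ b != a, c != a & c != b] by split; rewrite eq_sym.
have [ea eb ec] : [/\ wt a = u, wt b = v & wt c = w].
  by rewrite /wt !eqxx (negbTE ba) (negbTE ca) (negbTE cb).
have H := @mesh_weights Th _ T' wt mesh TT TT'.
have {}H p : p \in [fset a; b; c]%fset -> wt p != 0 -> p \in T'.
  apply: H; rewrite ?big_fset3 ?ea ?eb ?ec //.
  by move=> q _; rewrite /wt; case: ifP => // _; case: ifP.
by split; [rewrite -ea|rewrite -eb|rewrite -ec]; apply: H; rewrite !inE eqxx ?orbT.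
Qed.

Lemma mesh_det Th a b c : triangle_mesh Th -> [fset a; b; c]%fset \in Th ->
  a != b -> a != c -> b != c -> det3 a b c != 0.
Proof. by move=> [h _] /h[_ ?] *; exact: affinely_independent_det. Qed.

Lemma mesh_sub Th T T' : triangle_mesh Th -> T \in Th -> T' \in Th ->
  (T `<=` T')%fset -> T = T'.
Proof.
move=> [h _] /h[T3 _] /h[T3' _] s; apply/eqP.
by rewrite eqEfcard s T3 T3'.
Qed.

(** Were [b] and [b'] on the same side of [ya], a point of the first triangle close to the midpoint
    of [ya] would lie in the second one, and its positive weight at [b] would make [b] a vertex of
    it. *)
Lemma mesh_opposite Th y a b b' : triangle_mesh Th ->
  y != a -> y != b -> a != b -> y != b' -> a != b' -> b != b' ->
  [fset y; a; b]%fset \in Th -> [fset y; a; b']%fset \in Th ->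
  det3 y a b * det3 y a b' < 0.
Proof.
move=> mesh ya yb ab yb' ab' bb' TT TT'.
have D0 := mesh_det mesh TT ya yb ab; have D0' := mesh_det mesh TT' ya yb' ab'.
rewrite ltNge; apply/negP => Dge.
have Dp : 0 < det3 y a b / det3 y a b'.
  rewrite (_ : _ / _ = (det3 y a b * det3 y a b') * (det3 y a b')^-1 ^+ 2).
    apply: mulr_gt0; first by rewrite lt_def mulf_neq0.
    by rewrite exprn_even_gt0 //= invr_neq0.
  by field.
set g := det3 y a b / det3 y a b' in Dp.
pose al := det3 a b' b / det3 y a b'; pose be := det3 b' y b / det3 y a b'.
have s1 : al + be + g = 1 by apply: barycentric_sum.
have eb : b = al *: y + be *: a + g *: b' by apply: barycentric.
(* Small enough for the midpoint of [ya], moved towards [b] by the weight [e], to keep nonnegative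
   weights in the second triangle. *)
pose e := (2 + 2 * (`|al| + `|be|))^-1.
have n0 := normr_ge0 al; have n1 := normr_ge0 be.
have e0 : 0 < e by rewrite invr_gt0; lra.
have ee : e * (2 + 2 * (`|al| + `|be|)) = 1 by rewrite mulVf //; lra.
have eal : - (e * `|al|) <= e * al by rewrite -mulrN ler_pM2l // lerNl ler_normr lexx orbT.
have ebe : - (e * `|be|) <= e * be by rewrite -mulrN ler_pM2l // lerNl ler_normr lexx orbT.
have q0 : 0 <= e * `|al| by rewrite mulr_ge0 // ltW.
have q1 : 0 <= e * `|be| by rewrite mulr_ge0 // ltW.
have hq : hull [fset y; a; b']%fset
    (((1 - e) / 2) *: y + ((1 - e) / 2) *: a + e *: b).
  apply/hull3P => //.
  exists ((1 - e) / 2 + e * al), ((1 - e) / 2 + e * be), (e * g).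
  split; [lra|lra|by rewrite mulr_ge0 // ltW| |].
    by rewrite (_ : g = 1 - al - be); [field|rewrite -s1; ring].
  by rewrite {1}eb; apply: planeP; rewrite !mxE; field.

have e1 : e <= 1 by rewrite /e invf_le1; lra.
have h1 : 0 <= (1 - e) / 2 by lra.
have h2 : (1 - e) / 2 + (1 - e) / 2 + e = 1 by field.
have [_ _ h] := mesh_bary mesh ya yb ab TT TT' h1 h1 (ltW e0) h2 hq.
have := h (lt0r_neq0 e0).
by rewrite !inE (eq_sym b y) (eq_sym b a) (negbTE yb) (negbTE ab) (negbTE bb').
Qed.

End Mesh.

(** * Crossing parity of polygonal walks *)

Section Parity.
Variable R : realType.
Implicit Types (x y z a b c d q r : plane R).

(* [slab q r a]: [a] lies above the segment [qr]; [crossing q a b]: the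
   upward vertical ray from [q] crosses the segment [ab].  Half-open intervals
   of abscissas make vertices above [q] count once. *)
Definition slab q r a : bool :=
  ((q 0 0 < a 0 0 <= r 0 0) && (0 < det3 q r a)) (+)
  ((r 0 0 < a 0 0 <= q 0 0) && (0 < det3 r q a)).

Definition crossing q a b : bool :=
  ((a 0 0 <= q 0 0 < b 0 0) && (det3 a b q < 0)) (+)
  ((b 0 0 <= q 0 0 < a 0 0) && (det3 b a q < 0)).

(** The region above [qr] is bounded by [qr] and by the vertical rays from [q] and [r]. The segment
    [ab] crosses this boundary an even number of times when its ends are both inside or both
    outside, so [defect] is the parity of its crossings with [qr] itself. *)
Definition defect q r a b : bool :=
  slab q r a (+) slab q r b (+) (crossing q a b (+) crossing r a b).

Definition segments_meet q r a b : Prop := exists s t : R,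
  [/\ 0 <= s <= 1, 0 <= t <= 1 & (1 - s) *: q + s *: r = (1 - t) *: a + t *: b].

Lemma slabC q r a : slab q r a = slab r q a.
Proof. exact: addbC. Qed.

Lemma crossingC q a b : crossing q a b = crossing q b a.
Proof. exact: addbC. Qed.

Lemma defectCl q r a b : defect q r a b = defect r q a b.
Proof.
by rewrite /defect !(slabC q r); congr (_ (+) _); exact: addbC.
Qed.

Lemma defectCr q r a b : defect q r a b = defect q r b a.
Proof.
rewrite /defect !(crossingC _ a b); congr (_ (+) _); exact: addbC.
Qed.

Lemma segments_meetCl q r a b : segments_meet q r a b -> segments_meet r q a b.
Proof.
move=> [s [t [s01 t01 e]]]; exists (1 - s), t; split => //; first by lra.
by rewrite -e subKr addrC.
Qed.

Lemma segments_meetCr q r a b : segments_meet q r a b -> segments_meet q r b a.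
Proof.
move=> [s [t [s01 t01 e]]]; exists s, (1 - t); split => //; first by lra.
by rewrite e subKr addrC.
Qed.

(** The form of [defect] for ordered abscissas, with [A], [B], [P], [Q] standing for the four
    determinants. Treating them as reals tied only by [det3_identities] leaves a case analysis on
    signs that arithmetic closes. *)
Definition sign_defect (ax bx qx rx A B P Q : R) : bool :=
  ((qx < ax <= rx) && (0 < A)) (+) ((qx < bx <= rx) && (0 < B)) (+)
  (((ax <= qx < bx) && (P < 0)) (+) ((ax <= rx < bx) && (Q < 0))).

(** The weak inequalities say that each segment meets the line of the other; the strict one keeps
    the two lines from being parallel. *)
Lemma sign_defect_opposite (ax bx qx rx A B P Q : R) : ax <= bx -> qx <= rx ->
  P - Q = B - A ->
  A * (bx - qx) + B * (qx - ax) = - (P * (rx - qx)) ->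
  A * (bx - rx) + B * (rx - ax) = - (Q * (rx - qx)) ->
  P * (rx - ax) + Q * (ax - qx) = - (A * (bx - ax)) ->
  P * (rx - bx) + Q * (bx - qx) = - (B * (bx - ax)) ->
  sign_defect ax bx qx rx A B P Q ->
  [/\ A <= 0, 0 <= B, Q <= 0, 0 <= P & A < B] \/
  [/\ B <= 0, 0 <= A, P <= 0, 0 <= Q & B < A].
Proof.
move=> ab qr e i1 i2 i3 i4; rewrite /sign_defect.
case: (ltP qx ax) => h1; case: (ltP qx bx) => h2;
case: (ltP rx ax) => h3; case: (ltP rx bx) => h4; rewrite ?andbF ?andbT //=; try lra;
rewrite ?addbF ?addFb;
case: ltP => k1; case: ltP => k2 //= _;
first [ left; split; nra | right; split; nra | exfalso; nra].
Qed.

Lemma sign_defect_true (ax bx qx rx A B P Q : R) : ax <= bx -> qx <= rx ->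
  P - Q = B - A ->
  A * (bx - qx) + B * (qx - ax) = - (P * (rx - qx)) ->
  A * (bx - rx) + B * (rx - ax) = - (Q * (rx - qx)) ->
  P * (rx - ax) + Q * (ax - qx) = - (A * (bx - ax)) ->
  P * (rx - bx) + Q * (bx - qx) = - (B * (bx - ax)) ->
  ~ (ax = qx /\ rx = qx) ->
  [/\ A < 0, 0 < B, Q < 0 & 0 < P] \/ [/\ B < 0, 0 < A, P < 0 & 0 < Q] ->
  sign_defect ax bx qx rx A B P Q.
Proof.
move=> ab qr e i1 i2 i3 i4 ne H; rewrite /sign_defect.
case: H => -[h1 h2 h3 h4]; rewrite h2 h3 (lt_gtF h1) (lt_gtF h4) !andbF !andbT /=.
- case: (ltP qx ax) => h5; case: (ltP qx bx) => h6;
  case: (ltP rx ax) => h7; case: (ltP rx bx) => h8 //=; exfalso; try lra; try nra.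
- case: (ltP qx ax) => h5; case: (ltP qx bx) => h6;
  case: (ltP rx ax) => h7; case: (ltP rx bx) => h8 //=; exfalso; try lra; try nra.
Qed.

Lemma det3_identities q r a b (A := det3 q r a) (B := det3 q r b)
    (P := det3 a b q) (Q := det3 a b r) :
  [/\ P - Q = B - A,
   A * (b 0 0 - q 0 0) + B * (q 0 0 - a 0 0) = - (P * (r 0 0 - q 0 0)),
   A * (b 0 0 - r 0 0) + B * (r 0 0 - a 0 0) = - (Q * (r 0 0 - q 0 0)),
   P * (r 0 0 - a 0 0) + Q * (a 0 0 - q 0 0) = - (A * (b 0 0 - a 0 0)) &
   P * (r 0 0 - b 0 0) + Q * (b 0 0 - q 0 0) = - (B * (b 0 0 - a 0 0))].
Proof. by rewrite /A /B /P /Q /det3; split; ring. Qed.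

Lemma defectE q r a b : a 0 0 <= b 0 0 -> q 0 0 <= r 0 0 ->
  defect q r a b = sign_defect (a 0 0) (b 0 0) (q 0 0) (r 0 0)
    (det3 q r a) (det3 q r b) (det3 a b q) (det3 a b r).
Proof.
move=> ab qr; rewrite /defect /slab /crossing /sign_defect.
have F (u v w : R) : v <= w -> (w <= u < v) = false :> bool.
  by move=> vw; apply/negbTE/negP => /andP[h1 h2]; lra.
have F' (u v w : R) : v <= w -> (w < u <= v) = false :> bool.
  by move=> vw; apply/negbTE/negP => /andP[h1 h2]; lra.
by rewrite !(F _ _ _ ab) !(F' _ _ _ qr) /= !addbF.
Qed.

Lemma defect_wlog (Pr : plane R -> plane R -> plane R -> plane R -> Prop) :
  (forall q r a b, Pr q r a b -> Pr r q a b) ->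
  (forall q r a b, Pr q r a b -> Pr q r b a) ->
  (forall q r a b, a 0 0 <= b 0 0 -> q 0 0 <= r 0 0 -> Pr q r a b) ->
  forall q r a b, Pr q r a b.
Proof.
move=> h1 h2 h q r a b.
wlog qr : q r / q 0 0 <= r 0 0.
  by move=> H; case: (leP (q 0 0) (r 0 0)) => [/H //|/ltW /H /h1].
by case: (leP (a 0 0) (b 0 0)) => ab; [exact: h|apply: h2; apply: h => //; exact: ltW].
Qed.

Lemma defect_meet q r a b : defect q r a b -> segments_meet q r a b.
Proof.
move: q r a b; apply: defect_wlog.
- by move=> q r a b h d; apply: segments_meetCl; apply: h; rewrite defectCl.
- by move=> q r a b h d; apply: segments_meetCr; apply: h; rewrite defectCr.
move=> q r a b ab qr; rewrite defectE // => d.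
have [e i1 i2 i3 i4] := det3_identities q r a b.
have H := sign_defect_opposite ab qr e i1 i2 i3 i4 d.
set A := det3 q r a in e H; set B := det3 q r b in e H.
set P := det3 a b q in e H; set Q := det3 a b r in e H.
have AB : A - B != 0 by rewrite subr_eq0; apply/eqP; case: H => -[] *; lra.
(* Parameters of the intersection of the two lines; [A - B = Q - P], so the signs put both in the
   unit interval. *)
exists (- P / (A - B)), (A / (A - B)).
have [k0|k0] : A - B < 0 \/ 0 < A - B by case: H => -[] *; [left|right]; lra.
- have [hA hB hQ hP] : [/\ A <= 0, 0 <= B, Q <= 0 & 0 <= P] by case: H => -[] *; split; lra.
  rewrite !ler_ndivrMr // !ler_ndivlMr //; split; [lra|lra|].
  by apply: planeP; rewrite !mxE; rewrite /A /B /P /det3 in AB *; field.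
- have [hA hB hQ hP] : [/\ B <= 0, 0 <= A, P <= 0 & 0 <= Q] by case: H => -[] *; split; lra.
  rewrite !ler_pdivrMr // !ler_pdivlMr //; split; [lra|lra|].
  by apply: planeP; rewrite !mxE; rewrite /A /B /P /det3 in AB *; field.
Qed.

Lemma defect_cross q r a b :
  det3 q r a * det3 q r b < 0 -> det3 a b q * det3 a b r < 0 -> defect q r a b.
Proof.
move: q r a b; apply: defect_wlog.
- move=> q r a b h h1 h2; rewrite defectCl; apply: h; last by rewrite mulrC.
  by move: h1; rewrite /det3 => h1; lra.
- move=> q r a b h h1 h2; rewrite defectCr; apply: h; first by rewrite mulrC.
  by move: h2; rewrite /det3 => h2; lra.
move=> q r a b ab qr; rewrite defectE // => h1 h2.
have [e i1 i2 i3 i4] := det3_identities q r a b.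
apply: sign_defect_true => //.
  move=> [e1 e2]; move: h1; rewrite [det3 q r a]/det3 e1 e2 !subrr.
  by rewrite mul0r mulr0 subrr mul0r ltxx.
have := h1; rewrite mulr_lt0 => /and3P[A0 B0 sAB].
have := h2; rewrite mulr_lt0 => /and3P[P0 Q0 sPQ].
have [hA|hA|hA] := ltgtP (det3 q r a) 0; last by rewrite hA eqxx in A0.
- left; have hB : 0 < det3 q r b by nra.
  have [hP|hP|hP] := ltgtP (det3 a b q) 0; last by rewrite hP eqxx in P0.
    have hQ : 0 < det3 a b r by nra.
    by exfalso; lra.
  by split => //; nra.
- right; have hB : det3 q r b < 0 by nra.
  have [hP|hP|hP] := ltgtP (det3 a b q) 0; last by rewrite hP eqxx in P0.
    by split => //; nra.
  have hQ : det3 a b r < 0 by nra.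
  by exfalso; lra.
Qed.

Inductive connected_by (G : plane R -> plane R -> Prop) a : plane R -> Prop :=
| connected_by_refl : connected_by G a a
| connected_by_step b c : connected_by G a b -> G b c -> connected_by G a c.

(* [th q] is the parity of the number of steps of a walk from [a] to [b]
   crossed by the upward ray from [q]. *)
Lemma walk_parity G a b : connected_by G a b ->
  exists th : plane R -> bool, forall q r,
    (forall c d, G c d -> ~ segments_meet q r c d) ->
    th q (+) th r = slab q r a (+) slab q r b.
Proof.
elim=> [|c d _ [th IH] Gcd].
  by exists (fun=> false) => q r _; rewrite !addbb.
exists (fun q => th q (+) crossing q c d) => q r h.
have /negbTE : ~~ defect q r c d by apply/negP => /defect_meet; exact: h.
rewrite addbACA IH // /defect.
by case: (slab q r a); case: (slab q r c); case: (slab q r d);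
  case: (crossing q c d); case: (crossing r c d).
Qed.

End Parity.

(** * Neighbourhoods *)

Section Near.
Variable R : realType.
Implicit Types (x y z a b c d : plane R) (Th : complex R).

Lemma near_seq (I : eqType) (T : topologicalType) (s : seq I) (z : T)
    (P : I -> T -> Prop) :
  (forall i, i \in s -> \forall y \near z, P i y) ->
  \forall y \near z, forall i, i \in s -> P i y.
Proof.
elim: s => [|i s IH] h; first by near=> y => j; rewrite in_nil.
have h1 := h i (mem_head _ _).
have h2 : \forall y \near z, forall i, i \in s -> P i y.
  by apply: IH => j js; apply: h; rewrite inE js orbT.
near=> y => j; rewrite inE => /orP[/eqP ->|js]; first by near: y.
by move: j js; near: y.
Unshelve. all: by end_near. Qed.

(** Closedness read at [z]; in this form it combines over finitely many sets by [near_seq]. *)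
Lemma near_closed (T : topologicalType) (A : set T) (z : T) : closed A ->
  \forall y \near z, A y -> A z.
Proof.
move=> cA; have [Az|nAz] := pselect (A z); first by near=> y.
have : nbhs z (~` A) by apply: open_nbhs_nbhs; split => //; exact: closed_openC.
by apply: filterS => y /= nAy /nAy.
Unshelve. all: by end_near. Qed.

Lemma near_line z d (P : plane R -> Prop) : (\forall y \near z, P y) ->
  exists2 e : R, 0 < e & forall t, `|t| <= e -> P (z + t *: d).
Proof.
move=> h.
have c : (fun t : R => z + t *: d) @ 0 --> z.
  rewrite -[X in _ --> X]addr0 -(scale0r d).
  by apply: cvgD; [exact: cvg_cst|apply: cvgZ; [exact: cvg_id|exact: cvg_cst]].
have /nbhs_ballP[e /= e0 he] := c _ h.
exists (e / 2); first by rewrite divr_gt0.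
move=> t te; apply: (he t); rewrite /ball /= sub0r normrN.
by apply: le_lt_trans te _; rewrite ltr_pdivrMr // ltr_pMr // ltr1n.
Qed.

Lemma continuous_coord (i : 'I_2) : continuous (fun y : plane R => y 0 i).
Proof. by move=> y; exact: coord_continuous. Qed.

Lemma continuous_det3 a b : continuous (fun y => det3 a b y).
Proof.
move=> y; rewrite /det3; apply: (@cvgB _ _ _ (nbhs y));
  (apply: cvgM; first exact: cvg_cst);
  (apply: cvgB; last exact: cvg_cst); exact: continuous_coord.
Qed.

Lemma continuous_det3_div a b k : continuous (fun y => det3 a b y / k).
Proof.
by move=> y; apply: (@cvgM _ _ (nbhs y)); [exact: continuous_det3|exact: cvg_cst].
Qed.

Lemma closed_det3_ge0 a b k : closed [set y | 0 <= det3 a b y / k].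
Proof.
apply: (@closed_comp _ _ (fun y => det3 a b y / k) [set t : R | 0 <= t]).
  by move=> y _; exact: continuous_det3_div.
exact: closed_ge.
Qed.

Lemma closed_hull3 a b c : a != b -> a != c -> b != c -> det3 a b c != 0 ->
  closed (hull [fset a; b; c]%fset).
Proof.
move=> ab ac bc D0.
rewrite (_ : hull _ = [set y | 0 <= det3 b c y / det3 a b c] `&`
  ([set y | 0 <= det3 c a y / det3 a b c] `&` [set y | 0 <= det3 a b y / det3 a b c])).
  by do 2?apply: closedI; exact: closed_det3_ge0.
apply/seteqP; split => y /=; rewrite hull3_det //.
  by case.
by case=> ? [].
Qed.

Lemma closed_segment a b :
  closed [set (1 - t) *: a + t *: b | t in [set t : R | 0 <= t <= 1]].
Proof.
apply: compact_closed; first exact: norm_hausdorff.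
apply: continuous_compact.
  apply: continuous_subspaceT => t; apply: cvgD; apply: cvgZ;
    do ?[exact: cvg_cst | exact: cvg_id].
  by apply: cvgB; [exact: cvg_cst|exact: cvg_id].
rewrite (_ : [set t : R | 0 <= t <= 1] = `[0, 1]%classic); first exact: segment_compact.
by apply/seteqP; split => t /=; rewrite in_itv.
Qed.

Lemma mesh_closed Th T : triangle_mesh Th -> T \in Th -> closed (hull T).
Proof.
move=> mesh TT; have [T3 ai] := mesh.1 _ TT.
have [a [b [c [e ab ac bc]]]] := fset3P T3; rewrite e in TT ai *.
by apply: closed_hull3 => //; exact: affinely_independent_det.
Qed.

Lemma mesh_near_star Th z : triangle_mesh Th ->
  \forall y \near z, forall T, T \in Th -> hull T y -> hull T z.
Proof.
by move=> mesh; apply: near_seq => T TT; apply: near_closed; exact: mesh_closed TT.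
Qed.

Lemma clopen_unit_interval (P : R -> Prop) (t0 : R) : 0 <= t0 <= 1 -> P t0 ->
  closed [set t | 0 <= t <= 1 /\ P t] ->
  (forall t, 0 <= t <= 1 -> P t -> \forall s \near t, 0 <= s <= 1 -> P s) ->
  forall t, 0 <= t <= 1 -> P t.
Proof.
move=> h0 P0 cP oP t h.
have : [set t | 0 <= t <= 1 /\ P t] = `[0, 1]%classic.
  have E (s : R) : `[0, 1]%classic s = (0 <= s <= 1) :> Prop by rewrite /= in_itv.
  apply: (@segment_connected R 0 1).
  - by exists t0.
  - exists [set s | 0 <= s <= 1 -> P s]°; first exact: open_interior.
    apply/seteqP; split => s /=; rewrite in_itv /=.
      by move=> [s01 Ps]; split => //; exact: oP.
    by move=> [s01 /interior_subset] /= H; split => //; exact: H.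
  - exists [set t | 0 <= t <= 1 /\ P t] => //.
    by rewrite setIidr // => s [] /=; rewrite in_itv.
move=> /seteqP[_ /(_ t)] /=; rewrite in_itv /= => /(_ h)[].
by [].
Qed.

End Near.

(** * Fans of triangles around a vertex *)

Section Cover.
Variable R : realType.
Implicit Types (x y z a b c d : plane R) (T : simplex R) (C Th : complex R).

(** For a vertex [y] of [T], the cone of apex [y] spanned by [T]. *)
Definition wedge y T z : Prop := exists2 e : R, 0 < e & hull T (y + e *: (z - y)).

Lemma det3_line a y z (e : R) : det3 a y (y + e *: (z - y)) = e * det3 a y z.
Proof. by rewrite /det3 !mxE; ring. Qed.

Lemma det3_line' a y z (e : R) : det3 y a (y + e *: (z - y)) = e * det3 y a z.
Proof. by rewrite /det3 !mxE; ring. Qed.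

Lemma wedgeP y a b z : y != a -> y != b -> a != b -> det3 y a b != 0 ->
  wedge y [fset y; a; b]%fset z <->
  0 <= det3 b y z / det3 y a b /\ 0 <= det3 y a z / det3 y a b.
Proof.
move=> ya yb ab D0; split.
  move=> [e e0 /(hull3_det _ ya yb ab D0)[_]].
  by rewrite det3_line // det3_line' // -!mulrA !(pmulr_rge0 _ e0) => h1 h2; split.
move=> [h1 h2].
set s := _ / _ in h1; set t := _ / _ in h2.
(* [s] and [t] are the coordinates of [z - y] along [a - y] and [b - y]; dividing by [1 + s + t]
   brings the point into the triangle. *)
exists (1 + s + t)^-1; first by rewrite invr_gt0; lra.
have e0 : 0 < 1 + s + t by lra.
apply/(hull3_det _ ya yb ab D0).
rewrite det3_line // det3_line' // -!mulrA -/s -/t.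
split; [|by rewrite mulr_ge0 // invr_ge0 ltW|by rewrite mulr_ge0 // invr_ge0 ltW].
have -> : det3 a b (y + (1 + s + t)^-1 *: (z - y)) / det3 y a b =
   1 - (1 + s + t)^-1 * (s + t).
  have := D0; rewrite /s /t /det3 !mxE => D0'.
  set w := (_)^-1; field; exact: D0'.
rewrite subr_ge0 mulrC ler_pdivrMr // mul1r; lra.
Qed.

Lemma mesh_triangle Th T y : triangle_mesh Th -> T \in Th -> y \in T ->
  exists a b, [/\ T = [fset y; a; b]%fset, y != a, y != b, a != b & det3 y a b != 0].
Proof.
move=> mesh TT yT; have [T3 ai] := mesh.1 _ TT.
have [a [b [e ya yb ab]]] := fset3_mem1 T3 yT; exists a, b; split => //.
by apply: affinely_independent_det => //; rewrite -e.
Qed.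

Lemma mesh_triangle2 Th T y a : triangle_mesh Th -> T \in Th -> y \in T ->
  a \in T -> y != a ->
  exists b, [/\ T = [fset y; a; b]%fset, y != b, a != b & det3 y a b != 0].
Proof.
move=> mesh TT yT aT ya; have [T3 ai] := mesh.1 _ TT.
have [b [e yb ab]] := fset3_mem2 T3 yT aT ya; exists b; split => //.
by apply: affinely_independent_det => //; rewrite -e.
Qed.

Lemma mesh_opposite2 Th T T' y a b b' : triangle_mesh Th -> T \in Th -> T' \in Th ->
  T != T' -> y != a ->
  T = [fset y; a; b]%fset -> T' = [fset y; a; b']%fset ->
  y != b -> a != b -> y != b' -> a != b' -> det3 y a b * det3 y a b' < 0.
Proof.
move=> mesh TT TT' n ya e e' yb ab yb' ab'; rewrite e in TT n; rewrite e' in TT' n.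
apply: (mesh_opposite mesh) => //; apply: contraNneq n => ->; exact: eqxx.
Qed.

(** The three opposite vertices would lie pairwise on opposite sides of one line. *)
Lemma mesh_edge_le2 Th T1 T2 T3 y a : triangle_mesh Th ->
  T1 \in Th -> T2 \in Th -> T3 \in Th -> y != a ->
  y \in T1 -> a \in T1 -> y \in T2 -> a \in T2 -> y \in T3 -> a \in T3 ->
  T1 != T2 -> T1 != T3 -> T2 != T3 -> False.
Proof.
move=> mesh h1 h2 h3 ya y1 a1 y2 a2 y3 a3 n12 n13 n23.
have [b1 [e1 yb1 ab1 _]] := mesh_triangle2 mesh h1 y1 a1 ya.
have [b2 [e2 yb2 ab2 _]] := mesh_triangle2 mesh h2 y2 a2 ya.
have [b3 [e3 yb3 ab3 _]] := mesh_triangle2 mesh h3 y3 a3 ya.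
have := mesh_opposite2 mesh h1 h2 n12 ya e1 e2 yb1 ab1 yb2 ab2.
have := mesh_opposite2 mesh h1 h3 n13 ya e1 e3 yb1 ab1 yb3 ab3.
have := mesh_opposite2 mesh h2 h3 n23 ya e2 e3 yb2 ab2 yb3 ab3.
set A := det3 y a b1; set B := det3 y a b2; set D := det3 y a b3.
rewrite !mulr_lt0 => /and3P[B0 D0] /eqP s1 /and3P[A0 _] /eqP s2 /and3P[_ _] /eqP s3.
by move: s1 s2 s3; case: (A < 0); case: (B < 0); case: (D < 0).
Qed.

Lemma near_gt0_continuous (f : plane R -> R) z : continuous f -> 0 < f z ->
  \forall z' \near z, 0 < f z'.
Proof. by move=> fc fz; exact: (cvgr_gt (f z) (fc z)). Qed.

(** Every edge leaving [y] is continued by another triangle of [C], so nothing can stop the fan from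
    turning all the way around [y]. *)
Definition fan Th C y : Prop :=
  [/\ forall T, T \in C -> T \in Th /\ y \in T,
      C != fset0
    & forall T a, T \in C -> a \in T -> a != y ->
        exists2 T', T' \in C & T' != T /\ a \in T'].

(** Inside the cone of [T] there is no difficulty. If [z] is on the ray from [y] through [a], the
    other triangle of [C] on the edge [ya] lies across that edge and covers the missing side. *)
Lemma fan_near_edge Th C y T a b z : triangle_mesh Th -> fan Th C y ->
  T \in C -> T = [fset y; a; b]%fset -> y != a -> y != b -> a != b ->
  0 < det3 b y z / det3 y a b -> 0 <= det3 y a z / det3 y a b ->
  \forall z' \near z, exists2 T, T \in C & wedge y T z'.
Proof.
move=> mesh [CTh _ other] TC e ya yb ab s0 t0.
have [TT yT] := CTh _ TC.
have aT : a \in T by rewrite e !inE eqxx orbT.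
have D0 : det3 y a b != 0 by apply: (mesh_det mesh) => //; rewrite -e.
have n1 := near_gt0_continuous (@continuous_det3_div R b y (det3 y a b)) s0.
move: t0; rewrite le_eqVlt => /orP[/eqP t0|t0]; last first.
  have n2 := near_gt0_continuous (@continuous_det3_div R y a (det3 y a b)) t0.
  near=> z'; exists T => //; rewrite e; apply/wedgeP => //.
  by split; apply: ltW; near: z'.
have ay : a != y by rewrite eq_sym.
have [T' T'C [nT aT']] := other _ _ TC aT ay.
have [TT' yT'] := CTh _ T'C.
have [b' [e' yb' ab' D0']] := mesh_triangle2 mesh TT' yT' aT' ya.
have nT' : T != T' by rewrite eq_sym.
have opp := mesh_opposite2 mesh TT TT' nT' ya e e' yb ab yb' ab'.
have s0' : 0 < det3 b' y z / det3 y a b'.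
  rewrite (_ : _ / _ = det3 b y z / det3 y a b) //.
  have d0 : det3 y a z = 0.
    by apply/eqP; move/esym/eqP: t0; rewrite mulf_eq0 invr_eq0 (negbTE D0) orbF.
  have ez := barycentric z D0.
  rewrite d0 mul0r scale0r addr0 in ez.
  set s := det3 b y z / det3 y a b in ez s0 *.
  have s1 := barycentric_sum z D0; rewrite d0 mul0r addr0 -/s in s1.
  have -> : z = (1 - s) *: y + s *: a by rewrite ez -s1 addrK.
  by have := D0'; rewrite /det3 !mxE => D0''; field; exact: D0''.
have n2 := near_gt0_continuous (@continuous_det3_div R b' y (det3 y a b')) s0'.
near=> z'.
have [h|h] := leP 0 (det3 y a z' / det3 y a b).
  exists T => //; rewrite e; apply/wedgeP => //.
  by split => //; apply: ltW; near: z'.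
exists T' => //; rewrite e'; apply/wedgeP => //.
split; first by apply: ltW; near: z'.
rewrite ltW // (_ : _ / _ = (det3 y a z' / det3 y a b) * (det3 y a b * det3 y a b')
   * (det3 y a b')^-1 ^+ 2); last by field; rewrite D0 D0'.
by apply: mulr_gt0; [rewrite nmulr_lgt0|rewrite exprn_even_gt0 //= invr_neq0].
Unshelve. all: by end_near. Qed.

Lemma fan_closed Th C y : triangle_mesh Th -> fan Th C y ->
  closed [set z | exists2 T, T \in C & wedge y T z].
Proof.
move=> mesh [CTh _ _].
have H z : \forall z' \near z, forall T, T \in C -> wedge y T z' -> wedge y T z.
  apply: near_seq => T TC; have [TT yT] := CTh _ TC.
  have [a [b [e ya yb ab D0]]] := mesh_triangle mesh TT yT.
  apply: near_closed.
  rewrite (_ : wedge y T = [set z | 0 <= det3 b y z / det3 y a b] `&`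
    [set z | 0 <= det3 y a z / det3 y a b]); last first.
    by apply/seteqP; split => u /=; rewrite e wedgeP.
  by apply: closedI; exact: closed_det3_ge0.
move=> z cz; have [z' [[T TC Wz'] h]] := cz _ (H z).
by exists T => //; exact: h.
Qed.

(* The directions covered by a fan form a set that is both closed and open. *)
Lemma fan_wedge Th C y z : triangle_mesh Th -> fan Th C y -> z != y ->
  exists2 T, T \in C & wedge y T z.
Proof.
move=> mesh fn zy; have [CTh C0 other] := fn.
have [T0 T0C] := fset0Pn _ C0.
have [TT0 yT0] := CTh _ T0C.
have [a [b [e ya yb ab D0]]] := mesh_triangle mesh TT0 yT0.
(* A starting point in the cone of [T0], not aligned with [y] and [z], so that the segment from [z1]
   to [z] avoids [y]. Two independent directions are tried, which cannot both be parallel to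
   [z - y]. *)
have [z1 W1 nz1] : exists2 z1, wedge y T0 z1 & det3 y z1 z != 0.
  have W (k : R) : 0 <= k -> wedge y T0 (y + (a - y) + k *: (b - y)).
    move=> k0; rewrite e; apply/wedgeP => //.
    rewrite (_ : _ / _ = 1); last first.
      by have := D0; rewrite /det3 !mxE => D0'; field; exact: D0'.
    rewrite (_ : _ / _ = k) //.
    by have := D0; rewrite /det3 !mxE => D0'; field; exact: D0'.
  have [h1|h1] := eqVneq (det3 y (y + (a - y) + 1 *: (b - y)) z) 0; last first.
    by exists (y + (a - y) + 1 *: (b - y)) => //; exact: W.
  have [h2|h2] := eqVneq (det3 y (y + (a - y) + 2 *: (b - y)) z) 0; last first.
    by exists (y + (a - y) + 2 *: (b - y)) => //; exact: W.
  have k1 : det3 y b z = 0 by move: h1 h2; rewrite /det3 !mxE; lra.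
  have k2 : det3 y a z = 0 by move: h1 h2; rewrite /det3 !mxE; lra.
  have := barycentric z D0.
  rewrite (_ : det3 b y z = - det3 y b z); last by rewrite /det3; ring.
  rewrite k1 k2 oppr0 !mul0r !scale0r !addr0.
  have := barycentric_sum z D0.
  rewrite (_ : det3 b y z = - det3 y b z); last by rewrite /det3; ring.
  rewrite k1 k2 oppr0 !mul0r !addr0 => -> /eqP.
  by rewrite scale1r (negbTE zy).
pose Z (t : R) := (1 - t) *: z1 + t *: z.
have Zy t : Z t != y.
  apply/eqP => /rowP h.
  have h0 := h 0; have h1 := h 1; rewrite !mxE in h0 h1.
  case/eqP: nz1.
  rewrite (_ : det3 _ _ _ = det3 y z1 (Z t) - det3 y z (Z t)); last first.
    by rewrite /det3 !mxE; ring.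
  by rewrite /det3 !mxE h0 h1; ring.
have Zc : continuous Z.
  move=> t; apply: cvgD; apply: cvgZ; do ?[exact: cvg_cst | exact: cvg_id].
  by apply: cvgB; [exact: cvg_cst|exact: cvg_id].
have cl := fan_closed mesh fn.
have : exists2 T, T \in C & wedge y T (Z 1).
  apply: (@clopen_unit_interval R (fun t => exists2 T, T \in C & wedge y T (Z t)) 0).
  - by rewrite lexx ler01.
  - by exists T0 => //; rewrite /Z subr0 scale1r scale0r addr0.
  - rewrite (_ : [set t | _] = `[0, 1]%classic `&`
      Z @^-1` [set z | exists2 T, T \in C & wedge y T z]).
      apply: closedI; first exact: interval_closed.
      by apply: closed_comp => // t _; exact: Zc.
    by apply/seteqP; split => t /=; rewrite in_itv.
  - move=> t t01 [T TC WT]; have [TT yT] := CTh _ TC.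
    have [c [d [e' yc yd cd D0']]] := mesh_triangle mesh TT yT.
    move: WT; rewrite e' wedgeP // => -[s0 r0].
    have N : \forall z' \near Z t, exists2 T, T \in C & wedge y T z'.
      (* [Z t] differs from [y], so one of its two coordinates is positive; [c] and [d] are
         exchanged if it is only the one along [d]. *)
      move: (s0); rewrite le_eqVlt => /orP[/eqP es|s0']; last first.
        exact: (fan_near_edge mesh fn TC e').
      have dc : d != c by rewrite eq_sym.
      have ed : det3 y d c = - det3 y c d by rewrite /det3; ring.
      apply: (fan_near_edge mesh fn TC _ yd yc dc); first by rewrite e' fset3_swap.
      + rewrite ed (_ : det3 c y (Z t) = - det3 y c (Z t)); last by rewrite /det3; ring.
        rewrite invrN mulrNN lt_neqAle r0 andbT eq_sym; apply/negP => /eqP er.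
        case/eqP: (Zy t); rewrite [LHS](barycentric (Z t) D0').
        have := barycentric_sum (Z t) D0'.
        by rewrite -es er !addr0 => ->; rewrite !scale0r !addr0 scale1r.
      + by rewrite ed (_ : det3 y d (Z t) = - det3 d y (Z t)) ?invrN ?mulrNN //
          /det3; ring.
    have N' : \forall s \near t, exists2 T, T \in C & wedge y T (Z s) := Zc t _ N.
    by apply: filterS N' => s h _; exact: h.
  - by rewrite ler01 lexx.
by rewrite /Z subrr scale0r add0r scale1r.
Qed.

(** Some triangle of the fan covers a direction interior to [T]. It contains an interior point of
    [T], hence all the vertices of [T]. *)
Lemma fan_complete Th C y T : triangle_mesh Th -> fan Th C y ->
  T \in Th -> y \in T -> T \in C.
Proof.
move=> mesh fn TT yT; have [CTh _ _] := fn.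
have [a [b [e ya yb ab D0]]] := mesh_triangle mesh TT yT.
have zy : (y + (a - y) + (b - y)) != y.
  apply: contra D0 => /eqP/rowP h; have h0 := h 0; have h1 := h 1.
  rewrite !mxE in h0 h1; rewrite /det3; apply/eqP.
  have -> : b 0 0 - y 0 0 = - (a 0 0 - y 0 0) by lra.
  have -> : b 0 1 - y 0 1 = - (a 0 1 - y 0 1) by lra.
  by ring.
have [T' T'C [k k0 hT']] := fan_wedge mesh fn zy.
have [TT' yT'] := CTh _ T'C.
suff -> : T = T' by [].
apply: (mesh_sub mesh TT TT').
(* Shrinking the point found in [T'] towards [y] by the factor [1 / (1 + 2 k)] gives it positive
   weights at [y], [a] and [b]. *)
pose k' := k / (1 + 2 * k).
have p : 0 < 1 + 2 * k by lra.
have k'0 : 0 < k' by rewrite divr_gt0.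
have ek : k' * (1 + 2 * k) = k by rewrite /k' divfK // gt_eqF.
have k'2 : 0 < 1 - 2 * k'.
  by rewrite /k' (_ : 1 - _ = (1 + 2 * k)^-1) ?invr_gt0 //; field; exact: lt0r_neq0.
have hq : hull T' ((1 - 2 * k') *: y + k' *: a + k' *: b).
  have [a' [b' [e' ya' yb' ab' D0']]] := mesh_triangle mesh TT' yT'.
  move: hT'; rewrite e' => /(hull3P _ ya' yb' ab')[u [v [w [u0 v0 w0 s1 eq]]]].
  apply/(hull3P _ ya' yb' ab').
  pose m := (1 + 2 * k)^-1; have m0 : 0 < m by rewrite invr_gt0.
  have em : 1 - m = 2 * k' by rewrite /m /k'; field; exact: lt0r_neq0.
  have em' : m * k = k' by rewrite mulrC.
  exists (1 - m + m * u), (m * v), (m * w).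
  split; [|by rewrite mulr_ge0 // ltW|by rewrite mulr_ge0 // ltW| |].
  - rewrite em addr_ge0 //; first by lra.
    by rewrite mulr_ge0 // ltW.
  - by transitivity (1 - m + m * (u + v + w)); [ring|rewrite s1; ring].
  - transitivity ((1 - m) *: y + m *: (y + k *: (y + (a - y) + (b - y) - y))).
      by apply: planeP; rewrite !mxE -em'; ring.
    by rewrite eq; apply: planeP; rewrite !mxE; ring.
rewrite e in TT.
have s1 : 1 - 2 * k' + k' + k' = 1 by ring.
have [h1 h2 h3] := mesh_bary mesh ya yb ab TT TT' (ltW k'2) (ltW k'0) (ltW k'0) s1 hq.
rewrite e; apply/fsubsetP => p'; rewrite !inE -orbA => /or3P[]/eqP ->.
- by apply: h1; exact: lt0r_neq0.
- by apply: h2; exact: lt0r_neq0.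
- by apply: h3; exact: lt0r_neq0.
Qed.

End Cover.

(** * Links of vertices and boundary pairs *)

Section Links.
Variable R : realType.
Implicit Types (x y z v a b c d : plane R) (T : simplex R) (C TT Th : complex R).

(** Each triangle of [C] has two vertices besides [y], so the degrees in the link of [y] have an
    even sum and odd degrees do not come alone. *)
Lemma handshake C y a : (forall T, T \in C -> #|` T| = 3%N /\ y \in T) -> a != y ->
  odd (count (fun T : simplex R => a \in T) C) ->
  exists a', [/\ a' != a, a' != y & odd (count (fun T : simplex R => a' \in T) C)].
Proof.
move=> CT ay oa.
pose deg p := count (fun T : simplex R => p \in T) C.
have degE p : deg p = (\sum_(T <- C) (p \in T))%N by rewrite /deg -sum1_count big_mkcond.
pose V : simplex R := ((\bigcup_(T <- C) T) `\ y)%fset.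
have aV : a \in V.
  have : has (fun T : simplex R => a \in T) C by rewrite has_count; case: (count _ _) oa.
  move=> /hasP[T TC aT]; rewrite /V !inE ay /=.
  by apply/bigfcupP; exists T => //; rewrite TC.
have tot : (\sum_(p <- V) deg p = 2 * size (enum_fset C))%N.
  under eq_bigr do rewrite degE.
  rewrite exchange_big /= big_seq_cond (eq_bigr (fun=> 2%N)); last first.
    move=> T; rewrite andbT => TC; have [T3 yT] := CT _ TC.
    have -> : (\sum_(p <- V) (p \in T) = #|` (T `\ y)%fset|)%N.
      rewrite -sum1_size -[RHS]/(\sum_(p <- (T `\ y)%fset) 1)%N.
      have sTV : (T `\ y `<=` V)%fset.
        apply/fsubsetP => p; rewrite !inE => /andP[-> pT] /=.
        by apply/bigfcupP; exists T => //; rewrite TC.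
      rewrite (big_fset_sub (fun=> 1%N) sTV) big_seq_cond [RHS]big_seq_cond.
      apply: eq_bigr => p; rewrite andbT !inE => /andP[py _].
      by rewrite py; case: (p \in T).
    by move: T3; rewrite (cardfsD1 y) yT; case.
  rewrite -big_seq_cond.
  by rewrite -[in RHS](count_predT) -sum1_count big_distrr.
have oS : odd (\sum_(p <- (V `\ a)%fset) deg p).
  have := congr1 odd tot; rewrite (big_fsetD1 a) //= oddD mul2n odd_double.
  by rewrite -/(deg a) /deg oa; case: (odd _).
have [p pV op] : exists2 p, p \in (V `\ a)%fset & odd (deg p).
  apply: contrapT => np; move: oS; apply/negP; rewrite big_seq.
  elim/big_ind : _ => [//|m n|p pV].
    by rewrite oddD => /negbTE -> /negbTE ->.
  by apply/negP => op; apply: np; exists p.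
by move: pV; rewrite !inE => /and3P[pa py _]; exists p.
Qed.

Definition boundary_pair TT a b : Prop := a != b /\
  exists2 T, T \in TT & [/\ a \in T, b \in T &
    forall T', T' \in TT -> a \in T' -> b \in T' -> T' = T].

Lemma boundary_pairC TT a b : boundary_pair TT a b -> boundary_pair TT b a.
Proof.
move=> [ab [T TT' [aT bT u]]]; split; first by rewrite eq_sym.
by exists T => //; split => // T' ? ? ?; exact: u.
Qed.

Lemma count_unique (I : eqType) (s : seq I) (p : pred I) i : uniq s -> i \in s -> p i ->
  (forall j, j \in s -> p j -> j = i) -> count p s = 1%N.
Proof.
move=> us si pi h; rewrite -size_filter.
rewrite (perm_size (s2 := [:: i])) //; apply: uniq_perm => //; first exact: filter_uniq.
move=> j; rewrite mem_filter inE; apply/andP/eqP => [[pj js]|->]; last by [].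
exact: h.
Qed.

Lemma count_couple (I : eqType) (s : seq I) (p : pred I) i i' : uniq s -> i \in s ->
  i' \in s -> i != i' -> p i -> p i' ->
  (forall j, j \in s -> p j -> j = i \/ j = i') -> count p s = 2%N.
Proof.
move=> us si si' ni pi pi' h; rewrite -size_filter.
rewrite (perm_size (s2 := [:: i; i'])) //; apply: uniq_perm.
- exact: filter_uniq.
- by rewrite /= inE ni.
move=> j; rewrite mem_filter !inE; apply/andP/orP.
  by move=> [pj js]; case: (h j js pj) => ->; rewrite eqxx; [left|right].
by case=> /eqP ->.
Qed.

(** A union of connected components of the star of [y] in [TT], for adjacency across the edges
    through [y]. *)
Definition edge_class TT C y : Prop :=
  (forall T, T \in C -> T \in TT /\ y \in T) /\
  (forall T T' a, T \in C -> T' \in TT -> a != y -> y \in T' ->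
    a \in T -> a \in T' -> T' \in C).

(** In the link of [y] restricted to [C], a vertex has degree 1 if its edge to [y] is a boundary
    edge and 2 otherwise; [handshake] provides a second vertex of odd degree. *)
Lemma edge_class_boundary Th TT C y T a : triangle_mesh Th -> (TT `<=` Th)%fset ->
  edge_class TT C y -> T \in C -> a \in T -> boundary_pair TT y a ->
  exists a' T', [/\ a' != a, T' \in C, a' \in T' & boundary_pair TT y a'].
Proof.
move=> mesh /fsubsetP sub [Cy cl] TC aT [ya [T0 T0T [yT0 aT0 u]]].
have [TT' yT] := Cy _ TC.
have eT : T = T0 by apply: u.
subst T0.
have ay : a != y by rewrite eq_sym.
have odda : odd (count (fun T : simplex R => a \in T) C).
  rewrite (@count_unique _ _ _ T) //; first exact: fset_uniq.
  by move=> T' /Cy[T'T yT'] aT'; exact: u.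
have C3 T' : T' \in C -> #|` T'| = 3%N /\ y \in T'.
  by move=> /Cy[T'T yT']; split => //; apply: (mesh.1 _ _).1; exact: sub.
have [a' [na' ay' odda']] := handshake C3 ay odda.
have : has (fun T : simplex R => a' \in T) C by rewrite has_count; case: (count _ _) odda'.
move=> /hasP[T' T'C aT']; have [T'T yT'] := Cy _ T'C.
exists a', T'; split => //; split; first by rewrite eq_sym.
exists T' => //; split => // T'' T''T yT'' aT''.
apply/eqP/negPn/negP => n.
have T''C : T'' \in C by apply: (cl T') aT' aT''.
move: odda'; rewrite (@count_couple _ _ _ T' T'') //; first exact: fset_uniq.
  by rewrite eq_sym.
move=> T3 T3C aT3; have [T3T yT3] := Cy _ T3C.
have [->|n1] := eqVneq T3 T'; first by left.
have [->|n2] := eqVneq T3 T''; first by right.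
exfalso; apply: (@mesh_edge_le2 _ Th T3 T' T'' y a' mesh) => //; try exact: sub.
  by rewrite eq_sym.
by rewrite eq_sym.
Qed.

Lemma boundary_pair_other Th TT y a : triangle_mesh Th -> (TT `<=` Th)%fset ->
  boundary_pair TT y a -> exists2 a', a' != a & boundary_pair TT y a'.
Proof.
move=> mesh sub ba; have [ya [T T_TT [yT aT u]]] := ba.
pose C := [fset T in TT | y \in T]%fset.
have cl : edge_class TT C y.
  split; first by move=> T'; rewrite !inE => /andP.
  by move=> T' T'' c _ h _ h' _ _; rewrite !inE h.
have TC : T \in C by rewrite !inE /= T_TT.
by have [a' [_ [h _ _ h']]] := edge_class_boundary mesh sub cl TC aT ba; exists a'.
Qed.

(** Without boundary edges the class is a fan, and a fan contains the whole star. *)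
Lemma edge_class_complete Th C y T : triangle_mesh Th -> edge_class Th C y ->
  C != fset0 ->
  (forall T a, T \in C -> a \in T -> ~ boundary_pair Th y a) ->
  T \in Th -> y \in T -> T \in C.
Proof.
move=> mesh [Cy cl] C0 nb TT yT; apply: (fan_complete mesh _ TT yT); split => //.
move=> T0 a T0C aT0 ay; have [T0T yT0] := Cy _ T0C.
have ya : y != a by rewrite eq_sym.
have [[T' [T'T n yT' aT']]|h] := pselect (exists T', [/\ T' \in Th, T' != T0, y \in T' & a \in T']).
  by exists T' => //; apply: (cl T0) aT0 aT'.
exfalso; apply: (nb T0 a) => //; split => //; exists T0 => //; split => // T' T'T yT' aT'.
by apply/eqP/negPn/negP => n; apply: h; exists T'.
Qed.

Definition boundary_point TT v : Prop := exists a, boundary_pair TT v a.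

Definition inner_point TT v : Prop :=
  (exists2 T, T \in TT & v \in T) /\ ~ boundary_point TT v.

Lemma inner_pair_other TT v a T : ~ boundary_pair TT v a -> T \in TT -> v != a ->
  v \in T -> a \in T -> exists T', [/\ T' \in TT, T' != T, v \in T' & a \in T'].
Proof.
move=> nb TTT va vT aT; apply: contrapT => h; apply: nb; split => //.
exists T => //; split => // T' T'T vT' aT'.
by apply/eqP/negPn/negP => n; apply: h; exists T'.
Qed.

(** The triangles of [TT] at [v] already form a fan, which leaves no room around [v] for another
    triangle of [Th]. *)
Lemma inner_point_complete Th TT v T : triangle_mesh Th -> (TT `<=` Th)%fset ->
  inner_point TT v -> T \in Th -> v \in T -> T \in TT.
Proof.
move=> mesh /fsubsetP sub [[T0 T0T vT0] nb] TTh vT.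
suff : T \in [fset T in TT | v \in T]%fset by rewrite !inE => /andP[].
apply: (fan_complete mesh _ TTh vT); split.
- by move=> T'; rewrite !inE => /andP[/sub].
- by apply/fset0Pn; exists T0; rewrite !inE T0T.
- move=> T1 a; rewrite !inE => /andP[T1T vT1] aT1 av.
  have nba : ~ boundary_pair TT v a by move=> h; apply: nb; exists a.
  have va : v != a by rewrite eq_sym.
  have [T' [T'T n vT' aT']] := inner_pair_other nba T1T va vT1 aT1.
  by exists T' => //; rewrite !inE T'T.
Qed.

End Links.

(** * Simple closed polygons *)

Section Polygon.
Variable R : realType.
Implicit Types (x y z v w a b c d u : plane R).

Lemma side_point1 m (p : 'I_m -> plane R) i :
  side_point p i 1 = side_point p (ordS i) 0.
Proof. by rewrite /side_point subrr subr0 !scale0r !scale1r add0r addr0. Qed.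

Lemma side_pointP m (p : 'I_m -> plane R) z : polygon_trace p z ->
  exists i t, 0 <= t < 1 /\ z = side_point p i t.
Proof.
move=> [i [t [/andP[t0 t1] ->]]].
move: t1; rewrite le_eqVlt => /orP[/eqP ->|t1]; last by exists i, t; rewrite t0.
by exists (ordS i), 0; rewrite lexx ltr01 side_point1.
Qed.

Lemma side_pointE m (p : 'I_m -> plane R) i s t :
  side_point p i t = side_point p i s + (t - s) *: (p (ordS i) - p i).
Proof. by apply: planeP; rewrite !mxE; ring. Qed.

(** Sides not through [z] are closed, hence avoid a neighbourhood of it; by simplicity, [z] is
    inside a single side or is the common end of two consecutive ones. *)
Lemma polygon_trace_rays m (p : 'I_m -> plane R) z : simple_closed_polygon p ->
  polygon_trace p z -> exists d1 d2, \forall w \near z, polygon_trace p w ->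
    exists2 s, 0 <= s & w = z + s *: d1 \/ w = z + s *: d2.
Proof.
move=> [m3 simple] /side_pointP[i [t [t01 ez]]].
have h00 : 0 <= (0 : R) < 1 by rewrite lexx ltr01.
have N : \forall w \near z, forall j, j \in enum 'I_m ->
    (exists2 t', 0 <= t' <= 1 & w = side_point p j t') ->
    exists2 s, 0 <= s <= 1 & z = side_point p j s.
  apply: near_seq => j _.
  have := @near_closed _ _ z (@closed_segment R (p j) (p (ordS j))).
  apply: filterS => w h [t' t'01 e].
  have [|s s01 es] := h; first by exists t'; rewrite // e.
  by exists s; rewrite // -es.
have [t0|t0] := eqVneq t 0.
  exists (p (ordS i) - p i), (p (ord_pred i) - p i).
  apply: filterS N => w h [j [t' [t'01 e]]].
  have [|s /andP[s0 s1] es] := h j (mem_enum _ _); first by exists t'.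
  move: s1; rewrite le_eqVlt => /orP[/eqP s1|s1].
    have E : side_point p (ordS j) 0 = side_point p i t.
      by rewrite -side_point1 -ez es s1.
    have [ij _] := simple _ _ _ _ h00 t01 E.
    exists (1 - t'); first by move/andP: t'01 => [_]; rewrite subr_ge0.
    right; rewrite -ij ordSK e (side_pointE _ _ 1) -s1 -es s1.
    by apply: planeP; rewrite !mxE; ring.
  have s01 : 0 <= s < 1 by rewrite s0 s1.
  have [e1 e2] := simple j i s t s01 t01 (etrans (esym es) ez).
  exists t'; first by case/andP: t'01.
  by left; rewrite e (side_pointE _ _ s) -es e2 t0 subr0 e1.
exists (p (ordS i) - p i), (- (p (ordS i) - p i)).
apply: filterS N => w h [j [t' [t'01 e]]].
have [|s /andP[s0 s1] es] := h j (mem_enum _ _); first by exists t'.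
move: s1; rewrite le_eqVlt => /orP[/eqP s1|s1].
  have E : side_point p (ordS j) 0 = side_point p i t.
    by rewrite -side_point1 -ez es s1.
  have [_ /esym/eqP] := simple _ _ _ _ h00 t01 E.
  by rewrite (negbTE t0).
have s01 : 0 <= s < 1 by rewrite s0 s1.
have [e1 e2] := simple j i s t s01 t01 (etrans (esym es) ez).
exists `|t' - t| => //; rewrite e (side_pointE _ _ s) -es e1 e2.
have [h0|h0] := leP 0 (t' - t); [left; by rewrite ger0_norm|right].
by rewrite ltr0_norm // scaleNr scalerN opprK.
Qed.

Lemma ray_direction (P : set (plane R)) z d1 d2 u : u != 0 ->
  (\forall w \near z, P w -> exists2 s, 0 <= s & w = z + s *: d1 \/ w = z + s *: d2) ->
  (forall s : R, 0 <= s <= 1 -> P (z + s *: u)) ->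
  exists2 c, 0 < c & d1 = c *: u \/ d2 = c *: u.
Proof.
move=> u0 N h; have [e e0 He] := near_line u N.
pose s := Num.min e 1.
have s0 : 0 < s by rewrite lt_min e0 ltr01.
have s01 : 0 <= s <= 1 by rewrite (ltW s0) ge_min lexx orbT.
have se : `|s| <= e by rewrite (ger0_norm (ltW s0)) ge_min lexx.
have [s' s'0 es] := He s se (h s s01).
have key d : z + s *: u = z + s' *: d -> exists2 c, 0 < c & d = c *: u.
  move=> /addrI E; have s'n : s' != 0.
    apply: contra u0 => /eqP s'0'; move/eqP: E.
    by rewrite s'0' scale0r scaler_eq0 gt_eqF.
  exists (s / s'); first by rewrite divr_gt0 // lt_def s'n.
  by rewrite mulrC -scalerA E scalerA mulVf // scale1r.
by case: es => /key[c c0 ->]; exists c => //; [left|right].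
Qed.

Lemma clopen_sides m (p : 'I_m -> plane R) (A : set (plane R)) z :
  polygon_trace p z -> A z -> closed A ->
  (forall z, polygon_trace p z -> A z ->
     \forall w \near z, polygon_trace p w -> A w) ->
  polygon_trace p `<=` A.
Proof.
move=> Pz Az cA oA.
have sideP i t : 0 <= t <= 1 -> polygon_trace p (side_point p i t).
  by move=> t01; exists i, t.
have side i t0 : 0 <= t0 <= 1 -> A (side_point p i t0) ->
    forall t, 0 <= t <= 1 -> A (side_point p i t).
  move=> t01 At0.
  have sc : continuous (side_point p i).
    move=> t; apply: cvgD; apply: cvgZ; do ?[exact: cvg_cst | exact: cvg_id].
    by apply: cvgB; [exact: cvg_cst|exact: cvg_id].
  apply: (clopen_unit_interval t01 At0).
    rewrite (_ : [set t | _] = `[0, 1]%classic `&` side_point p i @^-1` A).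
      apply: closedI; first exact: interval_closed.
      by apply: closed_comp => // t _; exact: sc.
    by apply/seteqP; split => t /=; rewrite in_itv.
  move=> t ht At; have := sc t _ (oA _ (sideP i t ht) At).
  by rewrite nbhs_simpl /=; apply: filterS => s h hs; apply: h; exact: sideP.
have [i [t [t01 ez]]] := Pz; rewrite ez in Az.
have Ai : forall t, 0 <= t <= 1 -> A (side_point p i t) by exact: side t01 Az.
have iterA k : forall t, 0 <= t <= 1 -> A (side_point p (iter k (@ordS m) i) t).
  elim: k => // k IH; apply: (side _ 0); first by rewrite lexx ler01.
  by rewrite /= -side_point1; apply: IH; rewrite ler01 lexx.
move=> w [j [s [s01 ->]]].
(* Going from side [i] to side [j] takes [j - i] steps modulo [m]; adding [m] keeps the count a
   natural number. *)
suff -> : j = iter (j + (m - i)) (@ordS m) i by exact: iterA.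
apply: val_inj.
have valI k : val (iter k (@ordS m) i) = ((i + k) %% m)%N.
  elim: k => [|k IH] /=; first by rewrite addn0 modn_small.
  by rewrite IH addnS -addn1 modnDml addn1.
rewrite valI addnCA subnKC ?modnDr ?modn_small //; exact: ltnW.
Qed.

End Polygon.

(** * The boundary of a polygonal mesh *)

Section Domain.
Variable R : realType.
Implicit Types (x y z v w a b c d u : plane R) (T : simplex R) (Th : complex R).
Implicit Types (G : plane R -> plane R -> Prop) (Omega : set (plane R)).

Definition polygonal_mesh Omega Th : Prop :=
  [/\ triangle_mesh Th, open Omega,
      closure Omega = [set y | exists2 T, T \in Th & hull T y]
    & exists m (p : 'I_m -> plane R),
        simple_closed_polygon p /\ closure Omega `\` Omega = polygon_trace p].

Definition trace G : set (plane R) := [set z | exists a b,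
  G a b /\ exists2 t, 0 <= t <= 1 & z = (1 - t) *: a + t *: b].

Lemma domain_hull Omega Th y : polygonal_mesh Omega Th -> Omega y ->
  exists2 T, T \in Th & hull T y.
Proof.
move=> [_ _ e _] /subset_closure; rewrite e; exact.
Qed.

(** Otherwise a neighbourhood of the point is covered by triangles containing it. Having positive
    weights at [a] and [b], the point forces these triangles to contain the edge, so only [T] is
    left; but [T] lies on one side of its edge. *)
Lemma boundary_interior_notin Omega Th a b (t : R) : polygonal_mesh Omega Th ->
  boundary_pair Th a b -> 0 < t < 1 -> ~ Omega ((1 - t) *: a + t *: b).
Proof.
move=> pm; have [mesh oO _ _] := pm; move=> [ab [T TT [aT bT u]]] /andP[t0 t1].
set z := _ + _ => Oz.
have [c [e ac bc D0]] := mesh_triangle2 mesh TT aT bT ab.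
have N : \forall y \near z, hull T y.
  have h1 := mesh_near_star z mesh.
  have h2 : \forall y \near z, Omega y by exact: (open_nbhs_nbhs (conj oO Oz)).
  near=> y; have [T' TT' hT'] : exists2 T, T \in Th & hull T y.
    by apply: (domain_hull pm); near: y.
  have hz : hull T' z by move: T' TT' hT'; near: y.
  suff <- : T' = T by [].
  have e1 : z = (1 - t) *: a + t *: b + 0 *: c by rewrite scale0r addr0.
  rewrite e1 in hz; rewrite e in TT.
  have t1' : 0 <= 1 - t by rewrite subr_ge0 ltW.
  have s1 : 1 - t + t + 0 = 1 by ring.
  have [h3 h4 _] := mesh_bary mesh ab ac bc TT TT' t1' (ltW t0) (lexx 0) s1 hz.
  apply: u => //; [apply: h3|apply: h4]; last exact: lt0r_neq0.
  by rewrite subr_eq0 eq_sym lt_eqF.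
have [r r0 Hr] := near_line (c - a) N.
have : hull T (z + (- r) *: (c - a)) by apply: Hr; rewrite normrN ger0_norm // ltW.
rewrite e => /(hull3_det _ ab ac bc D0)[_ _].
rewrite (_ : det3 _ _ _ / _ = - r) ?oppr_ge0 ?leNgt ?r0 //.
by have := D0; rewrite /z /det3 !mxE => D0'; field; exact: D0'.
Unshelve. all: by end_near. Qed.

Lemma boundary_trace_notin Omega Th : polygonal_mesh Omega Th ->
  trace (boundary_pair Th) `<=` ~` Omega.
Proof.
move=> pm z [a [b [ba [t t01 ->]]]] /= Oz; have [mesh oO _ _] := pm.
have N : \forall y \near (1 - t) *: a + t *: b, Omega y
  by exact: (open_nbhs_nbhs (conj oO Oz)).
have [r r0 Hr] := near_line (b - a) N.
case/andP: t01 => t0 t1.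
(* Since [Omega] is open, an end of the edge can be replaced by a nearby point strictly inside; the
   bound [1/3] keeps the parameter between 0 and 1. *)
have [s s01 /andP[st1 st2]] : exists2 s : R, `|s| <= r & 0 < t + s < 1.
  have [th|th] := leP t (1 / 2).
    exists (Num.min r (1/3)).
      by rewrite ger0_norm ?ge_min ?lexx // le_min (ltW r0) divr_ge0.
    have : 0 < Num.min r (1/3) by rewrite lt_min r0 divr_gt0.
    have : Num.min r (1/3) <= 1/3 by rewrite ge_min lexx orbT.
    by lra.
  exists (- Num.min r (1/3)).
    by rewrite normrN ger0_norm ?ge_min ?lexx // le_min (ltW r0) divr_ge0.
  have : 0 < Num.min r (1/3) by rewrite lt_min r0 divr_gt0.
  have : Num.min r (1/3) <= 1/3 by rewrite ge_min lexx orbT.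
  by lra.
have := @boundary_interior_notin _ _ _ _ (t + s) pm ba; rewrite st1 st2 => /(_ isT).
apply; have := Hr _ s01.
by rewrite (_ : _ + s *: _ = (1 - (t + s)) *: a + (t + s) *: b) //; apply: planeP;
  rewrite !mxE; ring.
Qed.

Lemma boundary_trace_closure Omega Th : polygonal_mesh Omega Th ->
  trace (boundary_pair Th) `<=` closure Omega `\` Omega.
Proof.
move=> pm z tz; split; last exact: boundary_trace_notin tz.
have [mesh _ -> _] := pm; have [a [b [[ab [T TT [aT bT _]]] [t t01 ->]]]] := tz.
exists T => //; apply: (@hull_sub _ _ [fset a; b]%fset).
  by apply/fsubsetP => q; rewrite !inE => /orP[]/eqP ->.
by apply/(hull2P _ ab); exists t.
Qed.

Lemma trace_closed Th G : (forall a b, G a b -> boundary_pair Th a b) -> closed (trace G).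
Proof.
move=> GB.
pose V : simplex R := (\bigcup_(T <- Th) T)%fset.
have GV a b : G a b -> a \in V /\ b \in V.
  move=> /GB[_ [T TT [aT bT _]]].
  by split; apply/bigfcupP; exists T => //; rewrite TT.
have H z : \forall y \near z, forall a, a \in V -> forall b, b \in V ->
    (exists2 t, 0 <= t <= 1 & y = (1 - t) *: a + t *: b) ->
    exists2 t, 0 <= t <= 1 & z = (1 - t) *: a + t *: b.
  apply: near_seq => a _; apply: near_seq => b _.
  have := @near_closed _ _ z (@closed_segment R a b).
  apply: filterS => y h [t t01 e].
  have [|s s01 es] := h; first by exists t; rewrite // e.
  by exists s; rewrite // -es.
move=> z cz; have [y [[a [b [Gab yab]]] h]] := cz _ (H z).
have [aV bV] := GV _ _ Gab.
by exists a, b; split => //; apply: (h a aV b bV).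
Qed.

Lemma mesh_vertex Th T T' v : triangle_mesh Th -> T \in Th -> T' \in Th -> v \in T ->
  hull T' v -> v \in T'.
Proof.
move=> mesh TT TT' vT hv; have [a [b [e va vb ab _]]] := mesh_triangle mesh TT vT.
rewrite e in TT; have hv' : hull T' (1 *: v + 0 *: a + 0 *: b).
  by rewrite scale1r !scale0r !addr0.
have s1 : 1 + 0 + 0 = 1 :> R by rewrite !addr0.
have [h _ _] := mesh_bary mesh va vb ab TT TT' ler01 (lexx 0) (lexx 0) s1 hv'.
by apply: h; rewrite oner_eq0.
Qed.

Lemma mesh_vertex_edge Th T T' v a b (t : R) : triangle_mesh Th -> T \in Th ->
  T' \in Th -> v \in T -> a \in T' -> b \in T' -> a != b -> 0 <= t <= 1 ->
  v = (1 - t) *: a + t *: b -> v = a \/ v = b.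
Proof.
move=> mesh TT TT' vT aT bT ab t01 ev.
have [c [e ac bc D0]] := mesh_triangle2 mesh TT' aT bT ab.
have hv : hull T' v.
  apply: (@hull_sub _ _ [fset a; b]%fset).
    by apply/fsubsetP => q; rewrite !inE => /orP[]/eqP ->.
  by apply/(hull2P _ ab); exists t.
have := mesh_vertex mesh TT TT' vT hv; rewrite e !inE -orbA => /or3P[]/eqP h.
- by left.
- by right.
- case/eqP: D0; rewrite -h ev /det3 !mxE; ring.
Qed.

Definition same_ray u u' : Prop := exists2 c : R, 0 < c & u = c *: u'.

Lemma same_raySym u u' : same_ray u u' -> same_ray u' u.
Proof.
move=> [c c0 ->]; exists c^-1; first by rewrite invr_gt0.
by rewrite scalerA mulVf ?scale1r // gt_eqF.
Qed.

Lemma same_rayTrans u u' u'' : same_ray u u' -> same_ray u' u'' -> same_ray u u''.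
Proof.
move=> [c c0 ->] [d d0 ->]; exists (c * d); first exact: mulr_gt0.
by rewrite scalerA.
Qed.

Lemma mesh_edges_same_ray Th a b b' T T' : triangle_mesh Th -> T \in Th -> T' \in Th ->
  a != b -> a != b' -> a \in T -> b \in T -> a \in T' -> b' \in T' ->
  same_ray (b - a) (b' - a) -> b = b'.
Proof.
wlog : b b' T T' / exists c : R, [/\ 0 < c, c <= 1 & b - a = c *: (b' - a)].
  move=> H mesh TT TT' ab ab' aT bT aT' bT' [c c0 e].
  have [c1|c1] := leP c 1; first by apply: (H b b' T T') => //; [exists c|exists c].
  apply/esym; have ci : 0 < c^-1 by rewrite invr_gt0.
  have e' : b' - a = c^-1 *: (b - a) by rewrite e scalerA mulVf ?scale1r // gt_eqF.
  apply: (H b' b T' T) => //; exists c^-1 => //; split => //.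
  by rewrite invf_le1 // ltW.
move=> [c [c0 c1 e]] mesh TT TT' ab ab' aT bT aT' bT' _.
have eb : b = (1 - c) *: a + c *: b'.
  by rewrite -[LHS](subrK a) e; apply: planeP; rewrite !mxE; ring.
have c01 : 0 <= c <= 1 by rewrite (ltW c0) c1.
case: (mesh_vertex_edge mesh TT TT' bT aT' bT' ab' c01 eb) => // h.
by rewrite h eqxx in ab.
Qed.

(** At a vertex the two rays follow two different edges of [G]; inside an edge they are its two
    opposite halves. *)
Lemma trace_two_rays Th G z : triangle_mesh Th ->
  (forall a b, G a b -> boundary_pair Th a b) ->
  (forall a b, G a b -> G b a) ->
  (forall a b, G a b -> exists2 b', b' != b & G a b') ->
  trace G z -> exists u1 u2, [/\ u1 != 0, u2 != 0, ~ same_ray u1 u2 &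
    forall s : R, 0 <= s <= 1 -> trace G (z + s *: u1) /\ trace G (z + s *: u2)].
Proof.
move=> mesh GB Gs Go [a [b [Gab [t /andP[t0 t1] ez]]]].
have endpoint v c : G v c -> exists u1 u2, [/\ u1 != 0, u2 != 0, ~ same_ray u1 u2 &
    forall s : R, 0 <= s <= 1 -> trace G (v + s *: u1) /\ trace G (v + s *: u2)].
  move=> Gvc; have [d dc Gvd] := Go _ _ Gvc.
  have [vc [T TT [vT cT _]]] := GB _ _ Gvc.
  have [vd [T' TT' [vT' dT' _]]] := GB _ _ Gvd.
  exists (c - v), (d - v); split.
  - by rewrite subr_eq0 eq_sym.
  - by rewrite subr_eq0 eq_sym.
  - move=> /(mesh_edges_same_ray mesh TT TT' vc vd vT cT vT' dT') ecd.
    by rewrite ecd eqxx in dc.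
  - move=> s s01; split.
      exists v, c; split => //; exists s => //; apply: planeP; rewrite !mxE; ring.
    exists v, d; split => //; exists s => //; apply: planeP; rewrite !mxE; ring.
move: t0; rewrite le_eqVlt => /orP[/eqP t0|t0].
  have -> : z = a by rewrite ez -t0 subr0 scale1r scale0r addr0.
  exact: endpoint Gab.
move: t1; rewrite le_eqVlt => /orP[/eqP t1|t1].
  have -> : z = b by rewrite ez t1 subrr scale1r scale0r add0r.
  exact: endpoint (Gs _ _ Gab).
have [ab _] := GB _ _ Gab.
have ba : b - a != 0 by rewrite subr_eq0 eq_sym.
exists ((1 - t) *: (b - a)), ((- t) *: (b - a)); split.
- by rewrite scaler_eq0 negb_or ba subr_eq0 eq_sym lt_eqF.
- by rewrite scaler_eq0 negb_or ba oppr_eq0 gt_eqF.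
- move=> [c c0]; rewrite scalerA => /eqP; rewrite -subr_eq0 -scalerBl scaler_eq0.
  rewrite (negbTE ba) orbF mulrN opprK => /eqP h.
  have : 0 < c * t by rewrite mulr_gt0.
  by lra.
- move=> s /andP[s0 s1]; rewrite ez.
  have h1 : 0 <= s * (1 - t) by rewrite mulr_ge0 // subr_ge0 ltW.
  have h2 : 0 <= (1 - s) * (1 - t) by rewrite mulr_ge0 // subr_ge0 // ltW.
  have h3 : 0 <= s * t by rewrite mulr_ge0 // ltW.
  have h4 : 0 <= (1 - s) * t by rewrite mulr_ge0 ?subr_ge0 // ltW.
  split; exists a, b; split => //.
    exists (t + s * (1 - t)); first by apply/andP; split; lra.
    by apply: planeP; rewrite !mxE; ring.
  exists (t - s * t); first by apply/andP; split; lra.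
  by apply: planeP; rewrite !mxE; ring.
Qed.

(* [trace G] is closed, and it is open in the polygon because two distinct rays
   of it leave each of its points, while the polygon is locally two rays. *)
Lemma boundary_subtrace Omega Th G a b : polygonal_mesh Omega Th ->
  (forall a b, G a b -> boundary_pair Th a b) ->
  (forall a b, G a b -> G b a) ->
  (forall a b, G a b -> exists2 b', b' != b & G a b') ->
  G a b -> closure Omega `\` Omega `<=` trace G.
Proof.
move=> pm GB Gs Go Gab; have [mesh oO eO [m [p [simple ep]]]] := pm.
have GP : trace G `<=` polygon_trace p.
  rewrite -ep; apply: subset_trans (boundary_trace_closure pm).
  by move=> z [c [d [/GB Gcd h]]]; exists c, d.
have Ga : trace G a.
  exists a, b; split => //; exists 0; first by rewrite lexx ler01.
  by rewrite subr0 scale1r scale0r addr0.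
rewrite ep; apply: (clopen_sides (GP _ Ga) Ga (trace_closed GB)) => z Pz Gz.
have [d1 [d2 N]] := polygon_trace_rays simple Pz.
have [u1 [u2 [u10 u20 nu uG]]] := trace_two_rays mesh GB Gs Go Gz.
have [c1 c10 e1] : exists2 c, 0 < c & d1 = c *: u1 \/ d2 = c *: u1.
  by apply: (ray_direction u10 N) => s s01; apply: GP; have [] := uG s s01.
have [c2 c20 e2] : exists2 c, 0 < c & d1 = c *: u2 \/ d2 = c *: u2.
  by apply: (ray_direction u20 N) => s s01; apply: GP; have [] := uG s s01.
have ray (u : plane R) (s c : R) w : 0 < c -> 0 <= s ->
    `|w - z| <= `|u| -> u != 0 -> w = z + s *: (c *: u) ->
    exists2 r, 0 <= r <= 1 & w = z + r *: u.
  move=> c0 s0 le u0 ew; exists (s * c); last by rewrite ew scalerA.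
  have sc0 : 0 <= s * c by rewrite mulr_ge0 // ltW.
  rewrite sc0 /=; move: le; rewrite ew addrC addKr scalerA normrZ ger0_norm //.
  by move=> le; rewrite -(@ler_pM2r _ `|u|) ?normr_gt0 // mul1r.
have near_norm (u : plane R) : u != 0 -> \forall w \near z, `|w - z| <= `|u|.
  move=> u0; apply/nbhs_ballP; exists `|u|; first by rewrite /= normr_gt0.
  by move=> w; rewrite -ball_normE /= distrC => /ltW.
have N1 := near_norm _ u10; have N2 := near_norm _ u20.
have fin1 w (s c : R) : 0 < c -> 0 <= s -> `|w - z| <= `|u1| -> w = z + s *: (c *: u1) ->
    trace G w.
  by move=> c0 s0 h1 /(ray _ _ _ _ c0 s0 h1 u10)[r r01 ->]; have [] := uG r r01.
have fin2 w (s c : R) : 0 < c -> 0 <= s -> `|w - z| <= `|u2| -> w = z + s *: (c *: u2) ->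
    trace G w.
  by move=> c0 s0 h1 /(ray _ _ _ _ c0 s0 h1 u20)[r r01 ->]; have [] := uG r r01.
have contra d : d = c1 *: u1 -> d = c2 *: u2 -> False.
  move=> h1 h2; apply: nu; apply: (@same_rayTrans _ d); last by exists c2.
  by apply: same_raySym; exists c1.
near=> w => Pw.
have n1 : `|w - z| <= `|u1| by near: w.
have n2 : `|w - z| <= `|u2| by near: w.
have [s s0 [ew|ew]] : exists2 s, 0 <= s & w = z + s *: d1 \/ w = z + s *: d2.
- by move: Pw; near: w.
- case: e1 => e1; first by apply: (fin1 w s c1) => //; rewrite -e1.
  case: e2 => e2; first by apply: (fin2 w s c2) => //; rewrite -e2.
  by have := contra _ e1 e2.
- case: e1 => e1; last by apply: (fin1 w s c1) => //; rewrite -e1.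
  case: e2 => e2; last by apply: (fin2 w s c2) => //; rewrite -e2.
  by have := contra _ e1 e2.
Unshelve. all: by end_near. Qed.

Lemma boundary_trace Omega Th a b : polygonal_mesh Omega Th -> boundary_pair Th a b ->
  closure Omega `\` Omega = trace (boundary_pair Th).
Proof.
move=> pm ab; apply/seteqP; split; last exact: boundary_trace_closure.
have [mesh _ _ _] := pm.
apply: (boundary_subtrace pm _ _ _ ab) => // c d; first exact: boundary_pairC.
exact: (boundary_pair_other mesh (fsubset_refl _)).
Qed.

(** Each boundary edge at [y] leaves along one of the two local rays of the polygon, and two edges
    of a mesh never leave a vertex in the same direction. *)
Lemma boundary_degree Omega Th y a1 a2 a3 : polygonal_mesh Omega Th ->
  boundary_pair Th y a1 -> boundary_pair Th y a2 -> boundary_pair Th y a3 ->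
  a1 != a2 -> a1 != a3 -> a2 != a3 -> False.
Proof.
move=> pm b1 b2 b3 n12 n13 n23; have [mesh oO eO [m [p [simple ep]]]] := pm.
have GP := boundary_trace_closure pm; rewrite ep in GP.
have Py a (s : R) : boundary_pair Th y a -> 0 <= s <= 1 -> polygon_trace p (y + s *: (a - y)).
  move=> ba s01; apply: GP; exists y, a; split => //; exists s => //.
  by apply: planeP; rewrite !mxE; ring.
have Pyy : polygon_trace p y.
  by have := Py _ 0 b1; rewrite lexx ler01 scale0r addr0; apply.
have [d1 [d2 N]] := polygon_trace_rays simple Pyy.
have dir a : boundary_pair Th y a -> same_ray d1 (a - y) \/ same_ray d2 (a - y).
  move=> ba; have ay : a - y != 0 by rewrite subr_eq0 eq_sym; case: ba.
  have [|c c0 [h|h]] := ray_direction ay N; first by move=> s s01; exact: Py.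
    by left; exists c.
  by right; exists c.
have diff d a a' : boundary_pair Th y a -> boundary_pair Th y a' ->
    same_ray d (a - y) -> same_ray d (a' - y) -> a = a'.
  move=> [ya [T TT [yT aT _]]] [ya' [T' TT' [yT' aT' _]]] r r'.
  apply: (mesh_edges_same_ray mesh TT TT' ya ya' yT aT yT' aT').
  exact: same_rayTrans (same_raySym r) r'.
case: (dir _ b1) => r1; case: (dir _ b2) => r2; case: (dir _ b3) => r3;
  first [ by case/eqP: n12; apply: diff r1 r2 | by case/eqP: n13; apply: diff r1 r3
        | by case/eqP: n23; apply: diff r2 r3 ].
Qed.

Lemma connected_by_trans G a b c : connected_by G a b -> connected_by G b c ->
  connected_by G a c.
Proof. by move=> h; elim=> // d e _ IH Gde; apply: connected_by_step Gde. Qed.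

Lemma connected_by1 G a b : G a b -> connected_by G a b.
Proof. by move=> h; apply: connected_by_step h; exact: connected_by_refl. Qed.

Lemma connected_by_sym G a b : (forall c d, G c d -> G d c) ->
  connected_by G a b -> connected_by G b a.
Proof.
move=> s; elim; first exact: connected_by_refl.
move=> c d _ IH Gcd; apply: connected_by_trans IH.
by apply: connected_by1; exact: s.
Qed.

Lemma connected_by_sub G G' a b : (forall c d, G c d -> G' c d) ->
  connected_by G a b -> connected_by G' a b.
Proof.
move=> s; elim; first exact: connected_by_refl.
by move=> c d _ IH /s h; apply: connected_by_step h.
Qed.

Lemma boundary_connected Omega Th v v' : polygonal_mesh Omega Th ->
  boundary_point Th v -> boundary_point Th v' -> connected_by (boundary_pair Th) v v'.
Proof.
move=> pm [a ba] [a' ba']; have [mesh _ _ _] := pm.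
(* The boundary edges reachable from [v]. They cover the whole polygon by [boundary_subtrace], so
   one of them passes through [v']. *)
pose G c d := boundary_pair Th c d /\ connected_by (boundary_pair Th) v c.
have Gs c d : G c d -> G d c.
  move=> [h1 h2]; split; first exact: boundary_pairC.
  exact: connected_by_step h1.
have Gva : G v a by split => //; exact: connected_by_refl.
have Tv' : trace G v'.
  apply: (boundary_subtrace pm _ Gs _ Gva); first by move=> ? ? [].
    move=> c d [h1 h2].
    have [d' nd bd] := boundary_pair_other mesh (fsubset_refl _) h1.
    by exists d'.
  apply: (boundary_trace_closure pm); exists v', a'; split => //.
  exists 0; first by rewrite lexx ler01.
  by rewrite subr0 scale1r scale0r addr0.
have [va' [T' TT' [vT' _ _]]] := ba'.
have [c [d [Gcd [t t01 ev]]]] := Tv'.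
have [[cd [T TT [cT dT _]]] _] := Gcd.
have [->|->] := mesh_vertex_edge mesh TT' TT vT' cT dT cd t01 ev; first by case: Gcd.
by case: (Gs _ _ Gcd).
Qed.

End Domain.

(** * Dimensions and quadratic polynomials *)

Section Dimension.
Variable F : fieldType.

Definition linear_pred (V : lmodType F) (P : V -> Prop) : Prop :=
  P 0 /\ forall k u v, P u -> P v -> P (k *: u + v).

(** Stated for predicates, because spline spaces are given by conditions and not as [{vspace V}]. *)
Definition dim_of (V : vectType F) (P : V -> Prop) (d : nat) : Prop :=
  exists2 U : {vspace V}, forall v, v \in U <-> P v & \dim U = d.

(** A subspace of maximal dimension inside [P] is all of [P], since adding one more vector of [P] to
    it stays inside [P]. *)
Lemma dim_of_exists (V : vectType F) (P : V -> Prop) : linear_pred P ->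
  exists d, dim_of P d.
Proof.
move=> [P0 Pl].
pose Q n := `[< exists2 U : {vspace V}, (forall v, v \in U -> P v) & \dim U = n >].
have exQ : exists n, Q n.
  exists 0%N; apply/asboolP; exists 0%VS; last exact: dimv0.
  by move=> v; rewrite memv0 => /eqP ->.
have bQ n : Q n -> (n <= \dim {:V})%N.
  by move=> /asboolP[U _ <-]; apply: dimvS; exact: subvf.
case: (ex_maxnP exQ bQ) => d /asboolP[U UP Ud] mx.
exists d; exists U => // v; split; first exact: UP.
move=> Pv; have Q' : Q (\dim (<[v]> + U)%VS).
  apply/asboolP; exists (<[v]> + U)%VS => // w /memv_addP[_ /vlineP[k ->] [u uU ->]].
  by apply: Pl => //; exact: UP.
have := mx _ Q'; rewrite -Ud => le.
have /eqP e : (U == <[v]> + U)%VS by rewrite eqEdim addvSr le.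
by rewrite e; apply: (subvP (addvSl _ _)); exact: memv_line.
Qed.

Lemma dim_of_unique (V : vectType F) (P : V -> Prop) d d' :
  dim_of P d -> dim_of P d' -> d = d'.
Proof.
move=> [U h <-] [U' h' <-]; congr (\dim _); apply/vspaceP => v.
by apply/idP/idP => [/h/h'|/h'/h].
Qed.

Lemma dim_of_ext (V : vectType F) (P Q : V -> Prop) d : (forall v, P v <-> Q v) ->
  dim_of P d -> dim_of Q d.
Proof. by move=> e [U h <-]; exists U => // v; rewrite h. Qed.

Lemma dim_of_linear (V : vectType F) (P : V -> Prop) d : dim_of P d -> linear_pred P.
Proof.
move=> [U h _]; split; first by apply/h; exact: mem0v.
by move=> k u v /h uU /h vU; apply/h; rewrite memvD // memvZ.
Qed.

Lemma rank_nullity (V W : vectType F) (f : {linear V -> W}) (P : V -> Prop) d k :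
  dim_of P d -> dim_of (fun v => P v /\ f v = 0) k ->
  exists2 r, dim_of (fun w => exists2 v, P v & w = f v) r & d = (k + r)%N.
Proof.
move=> [U hU <-] [K hK <-].
exists (\dim (linfun f @: U)%VS).
  exists (linfun f @: U)%VS => // w; split.
    by move=> /memv_imgP[v /hU Pv ->]; exists v => //; rewrite lfunE.
  by move=> [v /hU vU ->]; rewrite -(lfunE f) memv_img.
rewrite -(limg_ker_dim (linfun f) U); congr (\dim _ + _)%N.
apply/vspaceP => v; rewrite memv_cap memv_ker lfunE; apply/andP/idP.
  by move=> [/hU vU /eqP fv]; apply/hK.
by move=> /hK[/hU vU ->].
Qed.

Lemma dim_of0 (V : vectType F) : dim_of (fun v : V => v = 0) 0.
Proof.
by exists 0%VS; [move=> v; rewrite memv0; split=> /eqP //|exact: dimv0].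
Qed.

Lemma dim_of_line (V : vectType F) (v : V) : v != 0 ->
  dim_of (fun w => exists k, w = k *: v) 1.
Proof.
move=> v0; exists <[v]>%VS; last by rewrite dim_vline v0.
by move=> w; split => [/vlineP //|h]; apply/vlineP.
Qed.

Lemma dim_of_full n : dim_of (fun _ : 'rV[F]_n => True) n.
Proof.
exists {:'rV[F]_n}%VS; first by move=> v; split=> // _; exact: memvf.
by rewrite dimvf /dim /= mul1n.
Qed.

Lemma dim_of_injective (V W : vectType F) (f : {linear V -> W}) (P : V -> Prop) d :
  (forall v, f v = 0 -> v = 0) -> dim_of P d ->
  dim_of (fun w => exists2 v, P v & w = f v) d.
Proof.
move=> inj Pd; have K : dim_of (fun v => P v /\ f v = 0) 0.
  apply: dim_of_ext (dim_of0 V) => v; split; last by case=> _; exact: inj.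
  move=> ->; split; first by case: (dim_of_linear Pd).
  exact: linear0.
by have [r hr ->] := rank_nullity Pd K.
Qed.

End Dimension.

(** * Quadratic polynomials, their 1-jets and squares of line equations *)

Section Quadratics.
Variable R : realType.
Implicit Types (x y z w a b c u v : plane R) (p q r : 'rV[R]_6).

Definition qcoef q (k : nat) : R := q 0 (inord k).

Definition ev q y : R :=
  qcoef q 0 + qcoef q 1 * y 0 0 + qcoef q 2 * y 0 1 + qcoef q 3 * y 0 0 ^+ 2
  + qcoef q 4 * (y 0 0 * y 0 1) + qcoef q 5 * y 0 1 ^+ 2.

Definition grad0 q y : R :=
  qcoef q 1 + 2 * qcoef q 3 * y 0 0 + qcoef q 4 * y 0 1.

Definition grad1 q y : R :=
  qcoef q 2 + qcoef q 4 * y 0 0 + 2 * qcoef q 5 * y 0 1.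

Definition hess q u v : R :=
  2 * qcoef q 3 * (u 0 0 * v 0 0) + qcoef q 4 * (u 0 0 * v 0 1 + u 0 1 * v 0 0)
  + 2 * qcoef q 5 * (u 0 1 * v 0 1).

Definition jet0 y q : Prop := [/\ ev q y = 0, grad0 q y = 0 & grad1 q y = 0].

(* The quadratic polynomial [e + f X + g Y + A X^2 + B X Y + C Y^2],
   where [(X, Y)] are the coordinates centered at [y]. *)
Definition centered y (e f g A B C : R) : 'rV[R]_6 :=
  \row_(i < 6) nth 0 [:: e - f * y 0 0 - g * y 0 1 + A * y 0 0 ^+ 2
     + B * (y 0 0 * y 0 1) + C * y 0 1 ^+ 2;
   f - 2 * A * y 0 0 - B * y 0 1; g - B * y 0 0 - 2 * C * y 0 1; A; B; C] i.

Lemma qcoef_centered y (e f g A B C : R) (q := centered y e f g A B C) :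
  (qcoef q 0 = e - f * y 0 0 - g * y 0 1 + A * y 0 0 ^+ 2
     + B * (y 0 0 * y 0 1) + C * y 0 1 ^+ 2) *
  (qcoef q 1 = f - 2 * A * y 0 0 - B * y 0 1) *
  (qcoef q 2 = g - B * y 0 0 - 2 * C * y 0 1) *
  (qcoef q 3 = A) * (qcoef q 4 = B) * (qcoef q 5 = C).
Proof. by do !split; rewrite /qcoef mxE inordK. Qed.

Lemma qcoefP p q : qcoef p 0 = qcoef q 0 -> qcoef p 1 = qcoef q 1 -> qcoef p 2 = qcoef q 2 ->
  qcoef p 3 = qcoef q 3 -> qcoef p 4 = qcoef q 4 -> qcoef p 5 = qcoef q 5 -> p = q.
Proof.
move=> e0 e1 e2 e3 e4 e5; apply/rowP => i.
have : qcoef p i = qcoef q i by case: i => [[|[|[|[|[|[|//]]]]]] hi].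
by rewrite /qcoef inord_val.
Qed.

Lemma qcoefD p q k : qcoef (p + q) k = qcoef p k + qcoef q k.
Proof. by rewrite /qcoef mxE. Qed.
Lemma qcoefB p q k : qcoef (p - q) k = qcoef p k - qcoef q k.
Proof. by rewrite /qcoef !mxE. Qed.
Lemma qcoefN p k : qcoef (- p) k = - qcoef p k.
Proof. by rewrite /qcoef !mxE. Qed.
Lemma qcoefZ l p k : qcoef (l *: p) k = l * qcoef p k.
Proof. by rewrite /qcoef mxE. Qed.
Lemma qcoef0 k : qcoef 0 k = 0.
Proof. by rewrite /qcoef mxE. Qed.
Definition qcoefE := (qcoefD, qcoefB, qcoefN, qcoefZ, qcoef0, qcoef_centered).

Lemma evP l p q y : ev (l *: p + q) y = l * ev p y + ev q y.
Proof. by rewrite /ev !qcoefE; ring. Qed.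
Lemma grad0P l p q y : grad0 (l *: p + q) y = l * grad0 p y + grad0 q y.
Proof. by rewrite /grad0 !qcoefE; ring. Qed.
Lemma grad1P l p q y : grad1 (l *: p + q) y = l * grad1 p y + grad1 q y.
Proof. by rewrite /grad1 !qcoefE; ring. Qed.
Lemma hessP l p q u v : hess (l *: p + q) u v = l * hess p u v + hess q u v.
Proof. by rewrite /hess !qcoefE; ring. Qed.
Lemma evB p q y : ev (p - q) y = ev p y - ev q y.
Proof. by rewrite /ev !qcoefE; ring. Qed.

Lemma grad0B p q y : grad0 (p - q) y = grad0 p y - grad0 q y.
Proof. by rewrite /grad0 !qcoefE; ring. Qed.
Lemma grad1B p q y : grad1 (p - q) y = grad1 p y - grad1 q y.
Proof. by rewrite /grad1 !qcoefE; ring. Qed.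

Lemma jet0P y l p q : jet0 y p -> jet0 y q -> jet0 y (l *: p + q).
Proof.
by move=> [h1 h2 h3] [h4 h5 h6]; split;
  rewrite ?(evP, grad0P, grad1P) ?(h1, h2, h3) ?(h4, h5, h6) mulr0 addr0.
Qed.

Lemma jet00 y : jet0 y 0.
Proof. by split; rewrite /ev /grad0 /grad1 !qcoef0 !(mulr0, mul0r, addr0). Qed.

Lemma jet0Z y l p : jet0 y p -> jet0 y (l *: p).
Proof. by move=> h; rewrite -[_ *: _]addr0; apply: jet0P => //; exact: jet00. Qed.

Lemma jet0N y p : jet0 y p -> jet0 y (- p).
Proof. by move=> h; rewrite -scaleN1r; exact: jet0Z. Qed.

Lemma jet0D y p q : jet0 y p -> jet0 y q -> jet0 y (p + q).
Proof. by move=> h1 h2; rewrite -[p]scale1r; exact: jet0P. Qed.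

Lemma jet0B y p q r : jet0 y (p - q) -> jet0 y (q - r) -> jet0 y (p - r).
Proof. by move=> h1 h2; rewrite -(subrK q p) -addrA; exact: jet0D. Qed.

Lemma jet0C y p q : jet0 y (p - q) -> jet0 y (q - p).
Proof. by move=> h; rewrite -opprB; exact: jet0N. Qed.

Lemma centeredE y q :
  q = centered y (ev q y) (grad0 q y) (grad1 q y) (qcoef q 3) (qcoef q 4) (qcoef q 5).
Proof. by apply: qcoefP; rewrite !qcoefE // /ev /grad0 /grad1; ring. Qed.

(** The square of the equation [det3 a b] of the line [ab], expanded at [a]. *)
Definition sqline a b : 'rV[R]_6 :=
  centered a 0 0 0 ((b 0 1 - a 0 1) ^+ 2)
    (- 2 * (b 0 0 - a 0 0) * (b 0 1 - a 0 1)) ((b 0 0 - a 0 0) ^+ 2).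

Lemma ev_sqline a b y : ev (sqline a b) y = det3 a b y ^+ 2.
Proof. by rewrite /ev /sqline !qcoefE /det3; ring. Qed.

Lemma hess_sqline a b y v w : hess (sqline a b) (v - y) (w - y) =
  2 * (det3 a b v - det3 a b y) * (det3 a b w - det3 a b y).
Proof. by rewrite /hess /sqline !qcoefE /det3 !mxE; ring. Qed.

Lemma jet0_sqline a b t : jet0 ((1 - t) *: a + t *: b) (sqline a b).
Proof.
by split; rewrite /ev /grad0 /grad1 /sqline !qcoefE !mxE; ring.
Qed.

Lemma jet0_sqlinel a b : jet0 a (sqline a b).
Proof. by have := @jet0_sqline a b 0; rewrite subr0 scale1r scale0r addr0. Qed.

Lemma jet0_sqliner a b : jet0 b (sqline a b).
Proof. by have := @jet0_sqline a b 1; rewrite subrr scale1r scale0r add0r. Qed.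

Lemma plane_neq a b : a != b -> 0 < (b 0 0 - a 0 0) ^+ 2 + (b 0 1 - a 0 1) ^+ 2.
Proof.
move=> ab; rewrite lt_def addr_ge0 ?sqr_ge0 // andbT paddr_eq0 ?sqr_ge0 //.
rewrite !sqrf_eq0; apply/negP => /andP[/eqP h0 /eqP h1]; case/eqP: ab.
by apply: planeP; lra.
Qed.

Lemma sqline_neq0 a b : a != b -> sqline a b != 0.
Proof.
move=> ab; apply/eqP => h; have := plane_neq ab.
have : qcoef (sqline a b) 5 = 0 by rewrite h qcoef0.
have : qcoef (sqline a b) 3 = 0 by rewrite h qcoef0.
by rewrite /sqline !qcoefE => -> ->; rewrite addr0 ltxx.
Qed.

(** The gradient is affine and vanishes at both points, so the Hessian kills [b - a]. Symmetric 2 by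
    2 matrices with a given nonzero kernel vector form a line, spanned here by the Hessian of
    [sqline a b]. *)
Lemma jet0_line a b q : a != b -> jet0 a q -> jet0 b q -> exists k, q = k *: sqline a b.
Proof.
move=> ab [e0 f0 g0] [_ f1 g1]; have P := plane_neq ab.
set s := _ + _ in P.
(* The multiplier is read on the trace: the two square coefficients of [sqline a b] add up to
   [s]. *)
exists ((qcoef q 3 + qcoef q 5) / s).
have sn : s != 0 by rewrite gt_eqF.
have hf : 2 * qcoef q 3 * (b 0 0 - a 0 0) + qcoef q 4 * (b 0 1 - a 0 1) = 0.
  by move: f0 f1; rewrite /grad0 => f0 f1; lra.
have hg : qcoef q 4 * (b 0 0 - a 0 0) + 2 * qcoef q 5 * (b 0 1 - a 0 1) = 0.
  by move: g0 g1; rewrite /grad1 => g0 g1; lra.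
rewrite [LHS](centeredE a) e0 f0 g0.
set A := qcoef q 3 in hf *; set B := qcoef q 4 in hf hg *; set C := qcoef q 5 in hg *.
set d0 := b 0 0 - a 0 0 in hf hg s P sn *; set d1 := b 0 1 - a 0 1 in hf hg s P sn *.
pose hf' := 2 * A * d0 + B * d1; pose hg' := B * d0 + 2 * C * d1.
have k3 : A = (A + C) / s * d1 ^+ 2.
  apply/eqP; rewrite -subr_eq0; apply/eqP.
  transitivity ((d0 * hf' - d1 * hg') / 2 / s); first by rewrite /hf' /hg' /s; field.
  by rewrite /hf' /hg' hf hg !mulr0 subrr !mul0r.
have k5 : C = (A + C) / s * d0 ^+ 2.
  apply/eqP; rewrite -subr_eq0; apply/eqP.
  transitivity ((d1 * hg' - d0 * hf') / 2 / s); first by rewrite /hf' /hg' /s; field.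
  by rewrite /hf' /hg' hf hg !mulr0 subrr !mul0r.
have k4 : B = (A + C) / s * (- 2 * d0 * d1).
  apply/eqP; rewrite -subr_eq0; apply/eqP.
  transitivity ((d1 * hf' + d0 * hg') / s); first by rewrite /hf' /hg' /s; field.
  by rewrite /hf' /hg' hf hg !mulr0 addr0 !mul0r.
apply: qcoefP; rewrite /sqline !qcoefE -/d0 -/d1.
- by rewrite {1}k5 {1}k4 {1}k3; ring.
- by rewrite {1}k4 {1}k3; ring.
- by rewrite {1}k5 {1}k4; ring.
- exact: k3.
- exact: k4.
- exact: k5.
Qed.

Lemma jet0_on_line a b q (t : R) : jet0 a q -> jet0 b q -> jet0 ((1 - t) *: a + t *: b) q.
Proof.
have [->|ab] := eqVneq a b; first by rewrite -scalerDl subrK scale1r.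
by move=> ja jb; have [k ->] := jet0_line ab ja jb; apply: jet0Z; exact: jet0_sqline.
Qed.

Lemma jet0_triangle a b c q : det3 a b c != 0 -> a != b ->
  jet0 a q -> jet0 b q -> jet0 c q -> q = 0.
Proof.
move=> D0 ab ja jb [e _ _]; have [k eq] := jet0_line ab ja jb.
move/eqP: e; rewrite eq -[_ *: _]addr0 evP ev_sqline /ev !qcoef0 !mul0r !addr0.
by rewrite mulf_eq0 sqrf_eq0 (negbTE D0) orbF => /eqP ->; rewrite scale0r.
Qed.

(** A polynomial with zero 1-jet at [y] is a quadratic form in the coordinates along [x - y] and
    [w - y]. The squares of these coordinates are, up to scaling, [sqline y w] and [sqline y x]; the
    mixed term is the Hessian entry assumed to vanish. *)
Lemma jet0_split y x w q : det3 y x w != 0 -> jet0 y q -> hess q (x - y) (w - y) = 0 ->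
  exists k l, q = k *: sqline y x + l *: sqline y w.
Proof.
move=> D0 [e0 f0 g0] h.
exists (hess q (w - y) (w - y) / 2 / det3 y x w ^+ 2),
  (hess q (x - y) (x - y) / 2 / det3 y x w ^+ 2).
rewrite [LHS](centeredE y) e0 f0 g0.
have u0 : (x - y) 0 0 = x 0 0 - y 0 0 by rewrite !mxE.
have u1 : (x - y) 0 1 = x 0 1 - y 0 1 by rewrite !mxE.
have v0 : (w - y) 0 0 = w 0 0 - y 0 0 by rewrite !mxE.
have v1 : (w - y) 0 1 = w 0 1 - y 0 1 by rewrite !mxE.
move: h; rewrite /hess u0 u1 v0 v1 /sqline.
set A := qcoef q 3; set B := qcoef q 4; set C := qcoef q 5.
have D0' := D0; rewrite /det3 in D0'; rewrite /det3.
set a := x 0 0 - y 0 0 in D0' *; set b := x 0 1 - y 0 1 in D0' *.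
set c := w 0 0 - y 0 0 in D0' *; set d := w 0 1 - y 0 1 in D0' *.
set D := a * d - b * c in D0' *.
move=> h.
have Dn : D ^+ 2 * 2 != 0 by rewrite mulf_neq0 ?expf_neq0 // pnatr_eq0.
have k3 : A = (2 * A * (c * c) + B * (c * d + d * c) + 2 * C * (d * d)) / 2 / D ^+ 2 * b ^+ 2
   + (2 * A * (a * a) + B * (a * b + b * a) + 2 * C * (b * b)) / 2 / D ^+ 2 * d ^+ 2.
  apply/eqP; rewrite -subr_eq0; apply/eqP.
  transitivity ((2 * A * (a * c) + B * (a * d + b * c) + 2 * C * (b * d)) * (-(b * d)) / D ^+ 2).
    by rewrite /D; field.
  by rewrite h !mul0r.
have k4 : B = (2 * A * (c * c) + B * (c * d + d * c) + 2 * C * (d * d)) / 2 / D ^+ 2 * (- 2 * a * b)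
   + (2 * A * (a * a) + B * (a * b + b * a) + 2 * C * (b * b)) / 2 / D ^+ 2 * (- 2 * c * d).
  apply/eqP; rewrite -subr_eq0; apply/eqP.
  transitivity ((2 * A * (a * c) + B * (a * d + b * c) + 2 * C * (b * d)) *
    (a * d + b * c) / D ^+ 2).
    by rewrite /D; field.
  by rewrite h !mul0r.
have k5 : C = (2 * A * (c * c) + B * (c * d + d * c) + 2 * C * (d * d)) / 2 / D ^+ 2 * a ^+ 2
   + (2 * A * (a * a) + B * (a * b + b * a) + 2 * C * (b * b)) / 2 / D ^+ 2 * c ^+ 2.
  apply/eqP; rewrite -subr_eq0; apply/eqP.
  transitivity ((2 * A * (a * c) + B * (a * d + b * c) + 2 * C * (b * d)) * (-(a * c)) / D ^+ 2).
    by rewrite /D; field.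
  by rewrite h !mul0r.
apply: qcoefP; rewrite !qcoefE -/a -/b -/c -/d.
- by rewrite {1}k5 {1}k4 {1}k3; ring.
- by rewrite {1}k4 {1}k3; ring.
- by rewrite {1}k5 {1}k4; ring.
- exact: k3.
- exact: k4.
- exact: k5.
Qed.

Lemma jet_interpolation y x w (e f g h : R) : det3 y x w != 0 -> exists q,
  [/\ ev q y = e, grad0 q y = f, grad1 q y = g & hess q (x - y) (w - y) = h].
Proof.
move=> D0.
pose a := x 0 0 - y 0 0; pose b := x 0 1 - y 0 1.
pose c := w 0 0 - y 0 0; pose d := w 0 1 - y 0 1.
pose D := det3 y x w.
(* The quadratic part is the product of the equations of the lines [yx] and [yw], scaled by
   [- h / D ^+ 2] so that the mixed second derivative is [h]. *)
exists (centered y e f g (- h * d * b / D ^+ 2) (h * (d * a + c * b) / D ^+ 2)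
  (- h * c * a / D ^+ 2)).
split; rewrite /ev /grad0 /grad1 /hess !qcoefE ?mxE; first [ring | idtac].
have D0' := D0; rewrite /D /a /b /c /d /det3 in D0' *; by field.
Qed.

End Quadratics.

(** * Attaching a triangle to a spline space *)

Section SplineCoefficients.
Variables (R : realType) (Th : complex R).
Implicit Types (x y z w a b c d : plane R) (T : simplex R) (TT : complex R).
Implicit Types (q : 'rV[R]_6).
Local Notation V := {ffun Th -> 'rV[R]_6}.
Implicit Types (p : V).

Definition piece p T : 'rV[R]_6 := oapp p 0 (insub T).

Definition of_pieces (f : simplex R -> 'rV[R]_6) : V := [ffun t => f (val t)].

Lemma pieceP k p p' T : piece (k *: p + p') T = k *: piece p T + piece p' T.
Proof.
by rewrite /piece; case: insub => [t|] /=; rewrite ?ffunE ?scaler0 ?addr0 // !ffunE.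
Qed.

Lemma piece0 T : piece 0 T = 0.
Proof. by rewrite /piece; case: insub => [t|] //=; rewrite ffunE. Qed.

Lemma piece_of_pieces f T : T \in Th -> piece (of_pieces f) T = f T.
Proof. by move=> TTh; rewrite /piece insubT /= ffunE. Qed.

Lemma piece_out p T : T \notin Th -> piece p T = 0.
Proof. by move=> h; rewrite /piece insubF //; exact: negbTE. Qed.

Lemma eq_piece p p' : (forall T, T \in Th -> piece p T = piece p' T) -> p = p'.
Proof.
move=> h; apply/ffunP => t; have := h (val t) (valP t).
by rewrite /piece valK.
Qed.

(** Pieces outside [TT] are required to be 0, so that the splines of all sets of triangles live in
    one ambient space. The condition at the end [b] is the instance with [a] and [b] exchanged. *)
Definition spline_coeffs TT p : Prop :=
  (forall T, T \notin TT -> piece p T = 0) /\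
  (forall T T' a b, T \in TT -> T' \in TT -> T != T' -> a != b ->
     a \in T -> b \in T -> a \in T' -> b \in T' -> jet0 a (piece p T - piece p T')).

Lemma spline_coeffs_linear TT : linear_pred (spline_coeffs TT).
Proof.
split.
  split=> [T _|T T' a b *]; first exact: piece0.
  by rewrite !piece0 subrr; exact: jet00.
move=> k p p' [h1 h2] [h3 h4]; split.
  by move=> T TTT; rewrite pieceP h1 // h3 // scaler0 addr0.
move=> T T' a b tT tT' n ab aT bT aT' bT'; rewrite !pieceP opprD addrACA -scalerBr.
by apply: jet0P; [apply: (h2 _ _ a b)|apply: (h4 _ _ a b)].
Qed.

(** * Dimension change when one triangle is attached *)

Section Attach.
Variables (TT : complex R) (T0 : simplex R).

Definition restrict p : V := of_pieces (fun T => if T == T0 then 0 else piece p T).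

Lemma restrict_linear : linear restrict.
Proof.
move=> k p p'; apply: eq_piece => T TTh; rewrite pieceP !piece_of_pieces // pieceP.
by case: ifP => //; rewrite scaler0 addr0.
Qed.
HB.instance Definition _ := GRing.isLinear.Build R V V _ restrict restrict_linear.

Definition single q : V := of_pieces (fun T => if T == T0 then q else 0).

Lemma single_linear : linear single.
Proof.
move=> k p p'; apply: eq_piece => T TTh; rewrite pieceP !piece_of_pieces //.
by case: ifP => //; rewrite scaler0 addr0.
Qed.
HB.instance Definition _ := GRing.isLinear.Build R 'rV[R]_6 V _ single single_linear.

Hypotheses (mesh : triangle_mesh Th) (sub : (TT `<=` Th)%fset) (T0Th : T0 \in Th)
  (T0TT : T0 \notin TT).

(** For a constant [f], this says that a piece on [T0] glues with 0. For [f T = q - piece p T], it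
    says that [q] extends the old spline [p] to [T0]. *)
Definition shared_jet (f : simplex R -> 'rV[R]_6) : Prop :=
  forall T a b, T \in TT -> a != b -> a \in T -> b \in T -> a \in T0 -> b \in T0 ->
    jet0 a (f T).

Lemma in_sub T : T \in TT -> T \in Th.
Proof. exact: fsubsetP. Qed.

Lemma notT0 T : T \in TT -> (T == T0) = false.
Proof. by move=> h; apply: contraNF T0TT => /eqP <-. Qed.

Lemma attach_kernel k : dim_of (fun q => shared_jet (fun=> q)) k ->
  dim_of (fun p => spline_coeffs (T0 |` TT)%fset p /\ restrict p = 0) k.
Proof.
move=> hk; have inj q : single q = 0 -> q = 0.
  by move=> /(congr1 (piece^~ T0)); rewrite piece_of_pieces // eqxx piece0.
apply: dim_of_ext (dim_of_injective inj hk) => p; split.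
  move=> [q hq ->]; split; last first.
    apply: eq_piece => T TTh; rewrite piece0 !piece_of_pieces //.
    by case: ifP => // ->.
  split.
    move=> T; rewrite !inE negb_or => /andP[n _].
    have [h|h] := boolP (T \in Th); last by rewrite piece_out.
    by rewrite piece_of_pieces // (negbTE n).
  move=> T T' a b; rewrite !inE => /orP[/eqP ->|tT] /orP[/eqP ->|tT'] n ab aT bT aT' bT'.
  - by rewrite eqxx in n.
  - rewrite (piece_of_pieces _ T0Th) (piece_of_pieces _ (in_sub tT')) eqxx notT0 // subr0.
    exact: (hq T' a b).
  - rewrite (piece_of_pieces _ T0Th) (piece_of_pieces _ (in_sub tT)) eqxx notT0 // sub0r.
    apply: jet0N.
    exact: (hq T a b).
  - by rewrite !piece_of_pieces ?in_sub // !notT0 // subrr; exact: jet00.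
move=> [[h1 h2] h3].
have h0 T : T != T0 -> piece p T = 0.
  move=> n; have [h|h] := boolP (T \in Th); last by rewrite piece_out.
  move: h3 => /(congr1 (piece^~ T)); rewrite piece_of_pieces // (negbTE n) => ->.
  exact: piece0.
exists (piece p T0).
  move=> T a b tT ab aT bT aT0 bT0.
  have n : T0 != T by rewrite eq_sym notT0.
  have := h2 T0 T a b; rewrite (h0 T) ?subr0; last by rewrite eq_sym.
  by apply; rewrite // !inE ?eqxx ?tT ?orbT.
apply: eq_piece => T TTh; rewrite piece_of_pieces //.
by case: eqP => [->//|/eqP]; exact: h0.
Qed.

Lemma attach_image p :
  (exists2 p', spline_coeffs (T0 |` TT)%fset p' & p = restrict p') <->
  spline_coeffs TT p /\ exists q, shared_jet (fun T => q - piece p T).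
Proof.
split.
  move=> [p' [h1 h2] ->]; split.
    split.
      move=> T tT; have [h|h] := boolP (T \in Th); last by rewrite piece_out.
      rewrite piece_of_pieces //; case: eqP => // /eqP n; apply: h1.
      by rewrite !inE negb_or n.
    move=> T T' a b tT tT' n ab aT bT aT' bT'.
    rewrite !piece_of_pieces ?in_sub // !notT0 //; apply: (h2 _ _ a b) => //.
      by rewrite !inE tT orbT.
    by rewrite !inE tT' orbT.
  exists (piece p' T0) => T a b tT ab aT bT aT0 bT0.
  rewrite piece_of_pieces ?in_sub // notT0 //; apply: (h2 _ _ a b) => //.
  - by rewrite !inE eqxx.
  - by rewrite !inE tT orbT.
  - by rewrite eq_sym notT0.
move=> [[h1 h2] [q hq]].
exists (of_pieces (fun T => if T == T0 then q else piece p T)).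
  split.
    move=> T; rewrite !inE negb_or => /andP[n tT].
    have [h|h] := boolP (T \in Th); last by rewrite piece_out.
    by rewrite piece_of_pieces // (negbTE n) h1.
  move=> T T' a b; rewrite !inE => /orP[/eqP ->|tT] /orP[/eqP ->|tT'] n ab aT bT aT' bT'.
  - by rewrite eqxx in n.
  - rewrite (piece_of_pieces _ T0Th) (piece_of_pieces _ (in_sub tT')) eqxx notT0 //.
    exact: (hq T' a b).
  - rewrite (piece_of_pieces _ T0Th) (piece_of_pieces _ (in_sub tT)) eqxx notT0 //.
    apply: jet0C.
    exact: (hq T a b).
  - by rewrite !piece_of_pieces ?in_sub // !notT0 //; exact: (h2 _ _ a b).
apply: eq_piece => T TTh; rewrite !piece_of_pieces //.
by case: eqP => // ->; exact: h1.
Qed.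

(** Rank-nullity for [restrict]: [k] counts the pieces on [T0] that glue with 0, [r] the old splines
    that extend to [T0]. *)
Lemma attach_dim k r : dim_of (fun q => shared_jet (fun=> q)) k ->
  dim_of (fun p => spline_coeffs TT p /\ exists q, shared_jet (fun T => q - piece p T)) r ->
  dim_of (spline_coeffs (T0 |` TT)%fset) (k + r)%N.
Proof.
move=> /attach_kernel hk hr.
have [d hd] := dim_of_exists (spline_coeffs_linear (T0 |` TT)%fset).
have [r' hr' e] := rank_nullity hd hk.
have hr'' := dim_of_ext attach_image hr'.
by rewrite (dim_of_unique hr hr'') -e.
Qed.

Lemma attach0 (d : nat) : dim_of (spline_coeffs TT) d ->
  (forall T a b, T \in TT -> a != b -> a \in T -> b \in T -> a \in T0 -> b \in T0 -> False) ->
  dim_of (spline_coeffs (T0 |` TT)%fset) (d + 6)%N.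
Proof.
move=> hd no; rewrite addnC; apply: attach_dim.
  apply: dim_of_ext (dim_of_full R 6) => q; split => // _ T a b tT ab h1 h2 h3 h4.
  by case: (no T a b).
apply: dim_of_ext hd => p; split; last by case.
move=> h; split => //; exists 0 => T a b tT ab h1 h2 h3 h4.
by case: (no T a b).
Qed.

Lemma mesh_share T T' a b c : T \in Th -> T' \in Th -> T != T' -> a != b ->
  a \in T -> b \in T -> a \in T' -> b \in T' -> c \in T -> c \in T' -> c = a \/ c = b.
Proof.
move=> tT tT' n ab aT bT aT' bT' cT cT'.
have [d [e ad bd _]] := mesh_triangle2 mesh tT aT bT ab.
move: cT; rewrite e !inE -orbA => /or3P[]/eqP h; [by left|by right|].
case/eqP: n; apply: (mesh_sub mesh tT tT'); rewrite e -h.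
by apply/fsubsetP => s; rewrite !inE -orbA => /or3P[]/eqP ->.
Qed.

(** The pieces gluing with 0 are the multiples of [sqline a b], and every old spline extends by
    prolonging its piece on [T1]. *)
Lemma attach1 (d : nat) T1 a b : dim_of (spline_coeffs TT) d -> T1 \in TT -> a != b ->
  a \in T1 -> b \in T1 -> a \in T0 -> b \in T0 ->
  (forall T c c', T \in TT -> c != c' -> c \in T -> c' \in T -> c \in T0 -> c' \in T0 ->
    T = T1) ->
  dim_of (spline_coeffs (T0 |` TT)%fset) d.+1.
Proof.
move=> hd tT1 ab aT1 bT1 aT0 bT0 only; rewrite -(add1n d); apply: attach_dim.
  apply: dim_of_ext (dim_of_line (sqline_neq0 ab)) => q; split.
    move=> [k ->] T c c' tT cc' cT c'T cT0 c'T0.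
    have e := only T c c' tT cc' cT c'T cT0 c'T0; rewrite e in cT.
    have n : T0 != T1 by rewrite eq_sym notT0.
    have [->|->] := mesh_share T0Th (in_sub tT1) n ab aT0 bT0 aT1 bT1 cT0 cT.
    - by apply: jet0Z; exact: jet0_sqlinel.
    - by apply: jet0Z; exact: jet0_sqliner.
  move=> h; apply: jet0_line => //; first exact: (h T1 a b).
  by apply: (h T1 b a) => //; rewrite eq_sym.
apply: dim_of_ext hd => p; split; last by case.
move=> h; split => //; exists (piece p T1) => T c c' tT cc' h1 h2 h3 h4.
by rewrite (only T c c') // subrr; exact: jet00.
Qed.

Section Attach2.
Variables (y x w : plane R) (T1 T2 : simplex R).
Hypotheses (eT0 : T0 = [fset y; x; w]%fset) (yx : y != x) (yw : y != w) (xw : x != w)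
  (tT1 : T1 \in TT) (tT2 : T2 \in TT) (yT1 : y \in T1) (xT1 : x \in T1)
  (yT2 : y \in T2) (wT2 : w \in T2)
  (only : forall T c c', T \in TT -> c != c' -> c \in T -> c' \in T -> c \in T0 ->
     c' \in T0 -> T = T1 \/ T = T2).

Definition jump p : 'rV[R]_6 := piece p T1 - piece p T2.

(** By [jet0_split], the vanishing of these four numbers says that the jump is a combination of the
    squares of the equations of [yx] and [yw], which is the condition for [p] to extend to [T0]. *)
Definition jump_jet p : 'rV[R]_4 :=
  \row_(i < 4) nth 0 [:: ev (jump p) y; grad0 (jump p) y; grad1 (jump p) y;
                         hess (jump p) (x - y) (w - y)] i.

Lemma jumpP k p p' : jump (k *: p + p') = k *: jump p + jump p'.
Proof. by rewrite /jump !pieceP opprD addrACA -scalerBr. Qed.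

Lemma jump_jet_linear : linear jump_jet.
Proof.
move=> k p p'; apply/rowP => i; rewrite !mxE jumpP.
by case: i => [[|[|[|[|//]]]] hi] /=; rewrite ?(evP, grad0P, grad1P, hessP).
Qed.
HB.instance Definition _ := GRing.isLinear.Build R V 'rV[R]_4 _ jump_jet jump_jet_linear.

Lemma jump_jetP p (v : 'rV[R]_4) : ev (jump p) y = v 0 0 -> grad0 (jump p) y = v 0 1 ->
  grad1 (jump p) y = v 0 (inord 2) -> hess (jump p) (x - y) (w - y) = v 0 (inord 3) ->
  jump_jet p = v.
Proof.
move=> h0 h1 h2 h3; apply/rowP => i; rewrite mxE.
case: i => [[|[|[|[|//]]]] hi] /=; rewrite ?h0 ?h1 ?h2 ?h3; congr (v 0 _);
  by apply: val_inj; rewrite //= inordK.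
Qed.

Lemma jump_jet0P p : jump_jet p = 0 <->
  jet0 y (jump p) /\ hess (jump p) (x - y) (w - y) = 0.
Proof.
split; last by move=> [[h1 h2 h3] h4]; apply: jump_jetP; rewrite ?h1 ?h2 ?h3 ?h4 mxE.
move=> /rowP h; split.
  split; first by have := h (@Ordinal 4 0 isT); rewrite !mxE.
    by have := h (@Ordinal 4 1 isT); rewrite !mxE.
  by have := h (@Ordinal 4 2 isT); rewrite !mxE.
by have := h (@Ordinal 4 3 isT); rewrite !mxE.
Qed.

Let D0 : det3 y x w != 0.
Proof. by apply: (mesh_det mesh) => //; rewrite -eT0. Qed.

Let yT0 : y \in T0. Proof. by rewrite eT0 !inE eqxx. Qed.
Let xT0 : x \in T0. Proof. by rewrite eT0 !inE eqxx orbT. Qed.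
Let wT0 : w \in T0. Proof. by rewrite eT0 !inE eqxx orbT. Qed.

Lemma attach2_shared (f : simplex R -> 'rV[R]_6) : shared_jet f <->
  [/\ jet0 y (f T1), jet0 x (f T1), jet0 y (f T2) & jet0 w (f T2)].
Proof.
have xy : x != y by rewrite eq_sym.
have wy : w != y by rewrite eq_sym.
split=> [h|[h1 h2 h3 h4] T c c' tT cc' cT c'T cT0 c'T0].
  split.
  - exact: (h T1 y x).
  - exact: (h T1 x y).
  - exact: (h T2 y w).
  - exact: (h T2 w y).
have n1 : T0 != T1 by rewrite eq_sym notT0.
have n2 : T0 != T2 by rewrite eq_sym notT0.
have [e|e] := only tT cc' cT c'T cT0 c'T0; rewrite e in tT cT *.
  by have [->|->] := mesh_share T0Th (in_sub tT1) n1 yx yT0 xT0 yT1 xT1 cT0 cT.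
by have [->|->] := mesh_share T0Th (in_sub tT2) n2 yw yT0 wT0 yT2 wT2 cT0 cT.
Qed.

(** Only 0 glues with 0 on [T0], so the new splines are the old ones in the kernel of [jump_jet],
    and the loss of dimension is the rank [r] of this map. *)
Lemma attach2_dim (d r : nat) : dim_of (spline_coeffs TT) d ->
  dim_of (fun v => exists2 p, spline_coeffs TT p & v = jump_jet p) r ->
  exists2 d', dim_of (spline_coeffs (T0 |` TT)%fset) d' & d = (d' + r)%N.
Proof.
move=> hd hr.
have lin : linear_pred (fun p => spline_coeffs TT p /\ jump_jet p = 0).
  have [l0 l1] := spline_coeffs_linear TT; split; first by rewrite linear0.
  by move=> k u v [hu ju] [hv jv]; split; [exact: l1|rewrite jump_jet_linear ju jv scaler0 addr0].
have [k hk] := dim_of_exists lin.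
have [r' hr' ->] := rank_nullity hd hk.
exists k; last by rewrite (dim_of_unique hr hr').
rewrite -(add0n k); apply: attach_dim.
  apply: dim_of_ext (dim_of0 _) => q; rewrite attach2_shared; split.
    by move=> ->; split; exact: jet00.
  by move=> [h1 h2 _ h3]; exact: (jet0_triangle D0 yx h1 h2 h3).
apply: dim_of_ext hk => p; split=> -[hp h]; split => //.
  move/jump_jet0P: h => [j0 h0].
  have [k1 [k2 e]] := jet0_split D0 j0 h0.
  exists (piece p T1 - k1 *: sqline y x); apply/attach2_shared.
  rewrite addrAC subrr sub0r addrAC -/(jump p) e addrAC subrr add0r.
  split; [apply: jet0N|apply: jet0N| |]; apply: jet0Z;
    solve [exact: jet0_sqlinel|exact: jet0_sqliner].
move: h => [q /attach2_shared[j1 j2 j3 j4]]; apply/jump_jet0P.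
have [k1 e1] := jet0_line yx j1 j2.
have [k2 e2] := jet0_line yw j3 j4.
have e : jump p = (- k1) *: sqline y x + k2 *: sqline y w.
  by rewrite scaleNr -e1 -e2 /jump opprB addrA subrK.
split; rewrite e.
  by apply: jet0P; [exact: jet0_sqlinel|apply: jet0Z; exact: jet0_sqlinel].
rewrite -[k2 *: _]addr0 !hessP !hess_sqline.
rewrite [hess 0 _ _](_ : _ = 0); last by rewrite /hess !qcoef0; ring.
by rewrite /det3; ring.
Qed.

(** Three coordinates of [jump_jet] vanish identically; [p0] shows that the fourth does not, so the
    rank is 1. *)
Lemma attach2_inner (d : nat) p0 : dim_of (spline_coeffs TT) d ->
  (forall p, spline_coeffs TT p -> jet0 y (jump p)) ->
  spline_coeffs TT p0 -> hess (jump p0) (x - y) (w - y) != 0 ->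
  exists2 d', dim_of (spline_coeffs (T0 |` TT)%fset) d' & d = d'.+1.
Proof.
move=> hd j0 hp0 h0.
have [|d' hd' ->] := @attach2_dim d 1%N hd; last by exists d'; rewrite // addn1.
have n0 : jump_jet p0 != 0 by apply: contra h0 => /eqP/jump_jet0P[_ ->].
apply: dim_of_ext (dim_of_line n0) => v; split.
  move=> [k ->]; exists (k *: p0); last by rewrite linearZ.
  have [l0 l1] := spline_coeffs_linear TT.
  by rewrite -[k *: p0]addr0; exact: l1.
move=> [p hp ->]; exists (hess (jump p) (x - y) (w - y) / hess (jump p0) (x - y) (w - y)).
have [h1 h2 h3] := j0 _ hp; have [h4 h5 h6] := j0 _ hp0.
apply: jump_jetP; rewrite !mxE ?inordK //= ?h1 ?h2 ?h3 ?h4 ?h5 ?h6 ?mulr0 //.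
by rewrite divfK.
Qed.

(** Any quadratic [q] times the function [z], normalized to be 1 on [T1] and 0 on [T2], is an old
    spline with jump [q]; hence [jump_jet] is onto. *)
Lemma attach2_boundary (d : nat) (z : simplex R -> R) : dim_of (spline_coeffs TT) d ->
  (forall T T' a b, T \in TT -> T' \in TT -> T != T' -> a != b ->
     a \in T -> b \in T -> a \in T' -> b \in T' -> z T = z T') ->
  z T1 != z T2 ->
  exists2 d', dim_of (spline_coeffs (T0 |` TT)%fset) d' & d = (d' + 4)%N.
Proof.
move=> hd hz nz; apply: attach2_dim => //.
apply: dim_of_ext (dim_of_full R 4) => v; split => // _.
have [q [e0 e1 e2 e3]] :=
  jet_interpolation (v 0 0) (v 0 1) (v 0 (inord 2)) (v 0 (inord 3)) D0.
exists (of_pieces (fun T => if T \in TT then ((z T - z T2) / (z T1 - z T2)) *: q else 0)).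
  split.
    move=> T tT; have [h|h] := boolP (T \in Th); last by rewrite piece_out.
    by rewrite piece_of_pieces // (negbTE tT).
  move=> T T' a b tT tT' n ab h1 h2 h3 h4.
  rewrite !piece_of_pieces ?in_sub // tT tT' (hz T T' a b) // subrr; exact: jet00.
apply/esym; apply: jump_jetP; rewrite /jump !piece_of_pieces ?in_sub // tT1 tT2 divff
  ?subr_eq0 // scale1r subrr mul0r scale0r subr0 //.
Qed.

End Attach2.
End Attach.
End SplineCoefficients.

(** * Potentials on triangles *)

Section Potential.
Variable R : realType.
Implicit Types (x y z v w a b c d q r : plane R) (T f : simplex R) (TT Th : complex R).

(** Here [f] is a face of [T'], not of [T]. The point lies in the common face of [T] and [T'], where
    its weights in the two triangles coincide, and those in [T'] are supported by [f]. *)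
Lemma mesh_face_weights Th T T' f (wt : plane R -> R) : triangle_mesh Th ->
  T \in Th -> T' \in Th -> (f `<=` T')%fset ->
  (forall p, p \in T -> 0 <= wt p) -> \sum_(p <- T) wt p = 1 ->
  hull f (\sum_(p <- T) wt p *: p) -> forall p, p \in T -> wt p != 0 -> p \in f.
Proof.
move=> [mT mM] TT TT' fT' w0 w1 hf p pT wp.
have [g [gT gT' e]] := mM _ _ TT TT'.
have [_ ai] := mT _ TT; have [_ ai'] := mT _ TT'.
set q := \sum_(p <- T) _ in hf.
have hg : hull g q.
  by rewrite -e; split; [exists wt|apply: hull_sub fT' _ hf].
have off s : s \in T -> s \notin g -> wt s = 0.
  exact: (hull_face_weights ai gT w1 hg).
have pg : p \in g by apply: contraNT wp => /(off _ pT) ->.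
pose wt' s := if s \in g then wt s else 0.
have sumg (V : lmodType R) (F : plane R -> V) :
    \sum_(s <- T') wt' s *: F s = \sum_(s <- T) wt s *: F s.
  transitivity (\sum_(s <- g) wt s *: F s).
    rewrite (big_fset_sub _ gT'); apply: eq_bigr => s _; rewrite /wt'.
    by case: ifP => //; rewrite scale0r.
  rewrite (big_fset_sub _ gT) big_seq_cond [RHS]big_seq_cond.
  apply: eq_bigr => s; rewrite andbT => sT; case: ifP => // /negbT h.
  by rewrite (off _ sT h) scale0r.
have s1 : \sum_(s <- T') wt' s = 1.
  have h := sumg R^o (fun=> 1).
  transitivity (\sum_(s <- T') wt' s *: (1 : R^o)).
    by apply: eq_bigr => s _; rewrite /GRing.scale /= mulr1.
  by rewrite h -[RHS]w1; apply: eq_bigr => s _; rewrite /GRing.scale /= mulr1.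
have hf' : hull f (\sum_(s <- T') wt' s *: s) by rewrite (sumg _ id).
apply: contraNT wp => pf; have := hull_face_weights ai' fT' s1 hf' (fsubsetP gT' _ pg) pf.
by rewrite /wt' pg => ->.
Qed.

Lemma mesh_bary_edge Th a b c T' d d' (u v w t : R) : triangle_mesh Th ->
  a != b -> a != c -> b != c -> [fset a; b; c]%fset \in Th -> T' \in Th ->
  d \in T' -> d' \in T' -> d != d' ->
  0 <= u -> 0 <= v -> 0 <= w -> u + v + w = 1 -> 0 <= t <= 1 ->
  u *: a + v *: b + w *: c = (1 - t) *: d + t *: d' ->
  [/\ u != 0 -> a \in [fset d; d']%fset, v != 0 -> b \in [fset d; d']%fset
    & w != 0 -> c \in [fset d; d']%fset].
Proof.
move=> mesh ab ac bc TT TT' dT' d'T' dd' u0 v0 w0 s1 t01 e.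
pose wt p : R := if p == a then u else if p == b then v else w.
have [ba ca cb] : [/\ b != a, c != a & c != b] by split; rewrite eq_sym.
have [ea eb ec] : [/\ wt a = u, wt b = v & wt c = w].
  by rewrite /wt !eqxx (negbTE ba) (negbTE ca) (negbTE cb).
have sub : ([fset d; d']%fset `<=` T')%fset.
  by apply/fsubsetP => s; rewrite !inE => /orP[]/eqP ->.
have H := @mesh_face_weights Th _ T' _ wt mesh TT TT' sub.
have {}H p : p \in [fset a; b; c]%fset -> wt p != 0 -> p \in [fset d; d']%fset.
  apply: H; rewrite ?big_fset3 ?ea ?eb ?ec //.
    by move=> s _; rewrite /wt; case: ifP => // _; case: ifP.
  by apply/(hull2P _ dd'); exists t.
by split; [rewrite -ea|rewrite -eb|rewrite -ec]; apply: H; rewrite !inE eqxx ?orbT.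
Qed.

Definition inner_pair TT a b : Prop := exists T T',
  [/\ T \in TT, T' \in TT & T != T'] /\ [/\ a \in T, b \in T, a \in T' & b \in T'].

Lemma inner_pairC TT a b : inner_pair TT a b -> inner_pair TT b a.
Proof. by move=> [T [T' [h [? ? ? ?]]]]; exists T, T'. Qed.

(* The edges of the mesh that may carry jumps of a potential on [TT]. *)
Definition free_pair Th TT a b : Prop :=
  [/\ a != b, exists2 T, T \in Th & a \in T /\ b \in T & ~ inner_pair TT a b].

Lemma free_pairC Th TT a b : free_pair Th TT a b -> free_pair Th TT b a.
Proof.
move=> [ab [T TTh [aT bT]] n]; split; first by rewrite eq_sym.
  by exists T.
by move=> /inner_pairC.
Qed.

Definition centroid T : plane R := 3^-1 *: \sum_(p <- T) p.

Lemma centroid3 a b c : a != b -> a != c -> b != c ->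
  centroid [fset a; b; c]%fset = 3^-1 *: a + 3^-1 *: b + 3^-1 *: c.
Proof. by move=> ab ac bc; rewrite /centroid big_fset3 // !scalerDr. Qed.

Lemma fset2_eq a b c d : a != b -> a \in [fset c; d]%fset -> b \in [fset c; d]%fset ->
  (a = c /\ b = d) \/ (a = d /\ b = c).
Proof.
move=> ab; rewrite !inE => /orP[]/eqP ea /orP[]/eqP eb; rewrite ea eb ?eqxx // in ab *.
- by left.
- by right.
Qed.

(** A point between the centroid and the midpoint of [ab] has positive weights at [a] and [b], so an
    edge containing it must be [ab]. *)
Lemma median_meet Th T a b c d : triangle_mesh Th -> T \in Th -> a \in T -> b \in T ->
  a != b -> c != d -> (exists2 T', T' \in Th & c \in T' /\ d \in T') ->
  segments_meet (centroid T) (2^-1 *: a + 2^-1 *: b) c d ->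
  (a = c /\ b = d) \/ (a = d /\ b = c).
Proof.
move=> mesh TT aT bT ab cd [T' TT' [cT' dT']] [s [t [/andP[s0 s1] t01 e]]].
have [k [eT ak bk _]] := mesh_triangle2 mesh TT aT bT ab.
pose u := (1 - s) * 3^-1 + s * 2^-1; pose v : R := (1 - s) * 3^-1.
have u0 : 0 < u by rewrite /u; lra.
have v0 : 0 <= v by rewrite /v; lra.
have e' : u *: a + u *: b + v *: k = (1 - t) *: c + t *: d.
  rewrite -e eT centroid3 // /u /v; apply: planeP; rewrite !mxE; ring.
have sum1 : u + u + v = 1 by rewrite /u /v; field.
rewrite eT in TT.
have [h1 h2 _] := mesh_bary_edge mesh ab ak bk TT TT' cT' dT' cd (ltW u0) (ltW u0) v0
  sum1 t01 e'.
by apply: fset2_eq => //; [apply: h1|apply: h2]; exact: lt0r_neq0.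
Qed.

(** The potential of a triangle is read at its centroid. Two triangles sharing an edge other than
    [xy] are compared through the midpoint of that edge, by segments that the closed walk does not
    meet; [T1] and [T2] are compared through a segment that crosses [xy] once. *)
Lemma potential_parity Th TT x y T1 T2 : triangle_mesh Th -> (TT `<=` Th)%fset ->
  T1 \in TT -> T2 \in TT -> T1 != T2 -> x != y ->
  x \in T1 -> y \in T1 -> x \in T2 -> y \in T2 ->
  connected_by (free_pair Th TT) y x ->
  exists z : simplex R -> bool,
    (forall T T' a b, T \in TT -> T' \in TT -> T != T' -> a != b ->
       a \in T -> b \in T -> a \in T' -> b \in T' ->
       ~ (x \in T /\ x \in T' /\ y \in T /\ y \in T') -> z T = z T')
    /\ z T1 != z T2.
Proof.
move=> mesh /fsubsetP sub tT1 tT2 n12 xy xT1 yT1 xT2 yT2 /walk_parity[th hth].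
(* Parity of the crossings with the walk from [y] to [x] closed by the step [xy]. *)
pose F q := th q (+) crossing q x y.
have FE q r : (forall c d, free_pair Th TT c d -> ~ segments_meet q r c d) ->
    F q (+) F r = defect q r x y.
  move=> h; rewrite /F addbACA (hth _ _ h) /defect.
  by congr (_ (+) _); exact: addbC.
have inxy : inner_pair TT x y by exists T1, T2.
have Fsame q r : (forall c d, c != d -> (exists2 T', T' \in Th & c \in T' /\ d \in T') ->
      segments_meet q r c d -> inner_pair TT c d /\
      ~ ((c = x /\ d = y) \/ (c = y /\ d = x))) -> F q = F r.
  move=> h; have [/defect_meet m|/negbTE d0] := boolP (defect q r x y).
    have ex : exists2 T', T' \in Th & x \in T' /\ y \in T' by exists T1; [exact: sub|].
    by have [_] := h x y xy ex m; case; left.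
  have hf c d : free_pair Th TT c d -> ~ segments_meet q r c d.
    by move=> [cd ex ni] /(h _ _ cd ex)[].
  by have := FE q r hf; rewrite d0; case: (F q); case: (F r).
exists (fun T => F (centroid T)); split.
  move=> T T' a b tT tT' n ab aT bT aT' bT' nxy.
  pose m := 2^-1 *: a + 2^-1 *: b.
  have key S : S \in TT -> a \in S -> b \in S -> F (centroid S) = F m.
    move=> tS aS bS; apply: Fsame => c d cd ex meet.
    have nx : ~ ((a = x /\ b = y) \/ (a = y /\ b = x)).
      by move=> [[ea eb]|[ea eb]]; apply: nxy; rewrite -ea -eb.
    have inab : inner_pair TT a b by exists T, T'.
    have [[<- <-]|[<- <-]] := median_meet mesh (sub _ tS) aS bS ab cd ex meet.
      by [].
    split; first exact: inner_pairC.
    by move=> [[? ?]|[? ?]]; apply: nx; [right|left].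
  by rewrite (key T) // (key T').
have [c1 [e1 xc1 yc1 D1]] := mesh_triangle2 mesh (sub _ tT1) xT1 yT1 xy.
have [c2 [e2 xc2 yc2 D2]] := mesh_triangle2 mesh (sub _ tT2) xT2 yT2 xy.
have opp := mesh_opposite2 mesh (sub _ tT1) (sub _ tT2) n12 xy e1 e2 xc1 yc1 xc2 yc2.
pose al := det3 y c2 c1 / det3 x y c2; pose be := det3 c2 x c1 / det3 x y c2.
pose g := det3 x y c1 / det3 x y c2.
have ec1 : c1 = al *: x + be *: y + g *: c2 by apply: barycentric.
have abg : al + be + g = 1 by apply: barycentric_sum.
have g0 : g < 0.
  rewrite /g (_ : _ / _ = (det3 x y c1 * det3 x y c2) * (det3 x y c2)^-1 ^+ 2).
    by rewrite nmulr_rlt0 // exprn_even_gt0 //= invr_neq0.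
  by field.
pose e := (1 + `|al| + `|be|)^-1.
have na0 := normr_ge0 al; have nb0 := normr_ge0 be.
have e0 : 0 < e by rewrite invr_gt0; lra.
have ee : e + e * `|al| + e * `|be| = 1.
  have : e * (1 + `|al| + `|be|) = 1 by rewrite mulVf //; lra.
  by move=> h; lra.
pose m := 2^-1 *: x + 2^-1 *: y.
(* [r] is beyond the midpoint [m] of [xy] as seen from [q]; the factor [e] is small enough to put it
   inside [T2]. *)
pose q := centroid T1; pose r := m - e *: (q - m).
have eq1 : q = 3^-1 *: x + 3^-1 *: y + 3^-1 *: c1 by rewrite /q e1 centroid3.
(* weights in [T2] of the points of the segment [mr] *)
have wT2 (s : R) : 0 <= s -> s <= e -> exists u v w : R,
    [/\ 0 < u, 0 < v, w = - (s * g) / 3, u + v + w = 1 &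
     m - s *: (q - m) = u *: x + v *: y + w *: c2].
  move=> s0 se; exists (1 / 2 + s / 6 - s * al / 3), (1 / 2 + s / 6 - s * be / 3),
    (- (s * g) / 3).
  have l1 : s * al <= e * `|al|.
    by apply: le_trans (ler_norm _) _; rewrite normrM ger0_norm // ler_wpM2r.
  have l2 : s * be <= e * `|be|.
    by apply: le_trans (ler_norm _) _; rewrite normrM ger0_norm // ler_wpM2r.
  have q1 : 0 <= e * `|al| by rewrite mulr_ge0 // ltW.
  have q2 : 0 <= e * `|be| by rewrite mulr_ge0 // ltW.
  split => //; [lra|lra| |].
    by rewrite (_ : g = 1 - al - be); [field|lra].
  by rewrite eq1 {1}ec1 /m; apply: planeP; rewrite !mxE; field.
have Fqr : F q (+) F r.
  rewrite FE.
    apply: defect_cross.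
      rewrite (_ : _ * _ = - ((1 + e) * det3 x y c1 / 6) ^+ 2).
        rewrite oppr_lt0 exprn_even_gt0 //= !mulf_neq0 //.
          by rewrite lt0r_neq0 //; lra.
      by rewrite /r eq1 /m /det3 !mxE; field.
    rewrite (_ : _ * _ = - (e * (det3 x y c1 / 3) ^+ 2)).
      rewrite oppr_lt0 mulr_gt0 // exprn_even_gt0 //= mulf_neq0 //.
    by rewrite /r eq1 /m /det3 !mxE; field.
  move=> c d [cd [T' tT' [cT' dT']] ni] [s [t [/andP[s0 s1] t01 es]]].
  (* Signed position on the line from [m] to [q]: the meeting point is in [T1] when [tau] is
     nonnegative and in [T2] otherwise. In both cases its weights at [x] and [y] are positive. *)
  pose tau := (1 - s) - s * e.
  have etau : m + tau *: (q - m) = (1 - t) *: c + t *: d.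
    by rewrite -es /r /tau; apply: planeP; rewrite !mxE; ring.
  suff [xin yin] : x \in [fset c; d]%fset /\ y \in [fset c; d]%fset.
    have [[ex ey]|[ex ey]] := fset2_eq xy xin yin; apply: ni; rewrite -ex -ey //.
    exact: inner_pairC.
  have tau1 : tau <= 1.
    have : 0 <= s * e by rewrite mulr_ge0 // ltW.
    by rewrite /tau; lra.
  have taue : - e <= tau.
    have : 0 <= (1 - s) * e by rewrite mulr_ge0 ?subr_ge0 // ltW.
    by rewrite /tau; lra.
  have [t0|t0] := leP 0 tau.
    have p1 : 0 < 2^-1 - tau / 6 by lra.
    have p2 : 0 <= tau / 3 by lra.
    have p3 : 2^-1 - tau / 6 + (2^-1 - tau / 6) + tau / 3 = 1 by field.
    have p4 : (2^-1 - tau / 6) *: x + (2^-1 - tau / 6) *: y + (tau / 3) *: c1 =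
        (1 - t) *: c + t *: d.
      by rewrite -etau eq1 /m; apply: planeP; rewrite !mxE; field.
    have TT1 := sub _ tT1; rewrite e1 in TT1.
    have [h1 h2 _] := mesh_bary_edge mesh xy xc1 yc1 TT1 tT' cT' dT' cd (ltW p1) (ltW p1)
      p2 p3 t01 p4.
    by split; [apply: h1|apply: h2]; exact: lt0r_neq0.
  have st0 : 0 <= - tau by rewrite oppr_ge0 ltW.
  have ste : - tau <= e by rewrite lerNl.
  have [u [v [w [u0 v0 ew s1' eqs]]]] := wT2 _ st0 ste.
  have w0 : 0 <= w.
    rewrite ew -mulrN -mulrA; apply: mulr_ge0 => //.
    by apply: divr_ge0 => //; rewrite oppr_ge0 ltW.
  rewrite scaleNr opprK etau in eqs.
  have TT2 := sub _ tT2; rewrite e2 in TT2.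
  have [h1 h2 _] := mesh_bary_edge mesh xy xc2 yc2 TT2 tT' cT' dT' cd (ltW u0) (ltW v0)
      w0 s1' t01 (esym eqs).
  by split; [apply: h1|apply: h2]; exact: lt0r_neq0.
(* This segment stays inside [T2]: all three weights are positive along it, so it meets no edge of
   the mesh. *)
have Frc : F r = F (centroid T2).
  apply: Fsame => c d cd [T' tT' [cT' dT']] [s [t [/andP[s0 s1] t01 es]]]; exfalso.
  have [u [v [w [u0 v0 ew sum1 er]]]] := wT2 _ (ltW e0) (lexx e).
  have w0 : 0 < w.
    rewrite ew -mulrN -mulrA; apply: mulr_gt0 => //.
    by apply: divr_gt0 => //; rewrite oppr_gt0.
  pose f (k : R) : R := (1 - s) * k + s * 3^-1.
  have f0 k : 0 < k -> 0 < f k.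
    move=> k0; rewrite /f; have [hs|hs] := leP s (1 / 2).
      have : 0 < (1 - s) * k by rewrite mulr_gt0 //; lra.
      by lra.
    have : 0 <= (1 - s) * k by rewrite mulr_ge0 ?subr_ge0 // ltW.
    by lra.
  have sf : f u + f v + f w = 1.
    transitivity ((1 - s) * (u + v + w) + s); first by rewrite /f; field.
    by rewrite sum1; ring.
  have ef : f u *: x + f v *: y + f w *: c2 = (1 - t) *: c + t *: d.
    rewrite -es /r er e2 centroid3 // /f; apply: planeP; rewrite !mxE; ring.
  have TT2 := sub _ tT2; rewrite e2 in TT2.
  have [h1 h2 h3] := mesh_bary_edge mesh xy xc2 yc2 TT2 tT' cT' dT' cd (ltW (f0 _ u0))
     (ltW (f0 _ v0)) (ltW (f0 _ w0)) sf t01 ef.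
  have {}h1 := h1 (lt0r_neq0 (f0 _ u0)).
  have {}h2 := h2 (lt0r_neq0 (f0 _ v0)).
  have {}h3 := h3 (lt0r_neq0 (f0 _ w0)).
  have [[ex ey]|[ex ey]] := fset2_eq xy h1 h2; move: h3;
    by rewrite -ex -ey !inE => /orP[]/eqP h; rewrite h eqxx in xc2 yc2.
by rewrite -Frc; case: (F q) Fqr; case: (F r).
Qed.

End Potential.

(** * Counting edges and vertices *)

Section Counting.
Variable R : realType.
Implicit Types (x y z v w a b c d : plane R) (s e T : simplex R) (K TT Th : complex R).

Lemma in_complex_of TT s : reflect (s != fset0 /\ exists2 T, T \in TT & (s `<=` T)%fset)
  (s \in complex_of TT).
Proof.
apply: (iffP idP).
  move=> /bigfcupP[T /andP[tT _]]; rewrite !inE fpowersetE => /andP[sT s0].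
  by split => //; exists T.
move=> [s0 [T tT sT]]; apply/bigfcupP; exists T; first by rewrite tT.
by rewrite !inE s0 andbT fpowersetE.
Qed.

Lemma in_simplices j K s : (s \in simplices j K) = (s \in K) && (#|` s| == j.+1).
Proof. by rewrite !inE. Qed.

Lemma in_triangles_around K s T :
  (T \in triangles_around K s) = (T \in simplices 2 K) && (s `<=` T)%fset.
Proof. by rewrite !inE. Qed.

Lemma triangles_complex_of TT : (forall T, T \in TT -> #|` T| = 3%N) ->
  simplices 2 (complex_of TT) = TT.
Proof.
move=> h3; apply/fsetP => T; rewrite in_simplices; apply/andP/idP.
  move=> [/in_complex_of[_ [T' tT' sT]] /eqP T3].
  suff -> : T = T' by [].
  by apply/eqP; rewrite eqEfcard sT T3 h3.
move=> tT; split; last by rewrite h3.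
apply/in_complex_of; split; last by exists T.
by apply/eqP => T0; have := h3 _ tT; rewrite T0 cardfs0.
Qed.

Lemma in_triangles_around_complex_of TT e T : (forall T, T \in TT -> #|` T| = 3%N) ->
  (T \in triangles_around (complex_of TT) e) = (T \in TT) && (e `<=` T)%fset.
Proof. by move=> h3; rewrite in_triangles_around triangles_complex_of. Qed.

Lemma fset_pairP e : #|` e| = 2%N -> exists a b, a != b /\ e = [fset a; b]%fset.
Proof.
have mT p : (p \in e) = (p \in enum_fset e) by [].
have uT := fset_uniq e; move: mT uT.
case: (enum_fset e) => [//|a [//|b []//]] mT /= uT _.
move: uT; rewrite !inE andbT => ab; exists a, b; split => //.
by apply/fsetP => p; rewrite mT !inE.
Qed.

Lemma cardfs_gt1P (I : choiceType) (A : {fset I}) :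
  reflect (exists i j, [/\ i \in A, j \in A & i != j]) (1 < #|` A|)%N.
Proof.
apply: (iffP idP) => [h|[i [j [iA jA n]]]].
  have /fset0Pn[i iA] : A != fset0 by rewrite -cardfs_gt0; case: (#|` A|)%N h.
  move: h; rewrite (cardfsD1 i) iA ltnS cardfs_gt0 => /fset0Pn[j].
  by rewrite !inE => /andP[n jA]; exists i, j; split => //; rewrite eq_sym.
by rewrite (cardfsD1 i) iA ltnS cardfs_gt0; apply/fset0Pn; exists j; rewrite !inE eq_sym n.
Qed.

Lemma fset_pair_sub a b T : ([fset a; b]%fset `<=` T)%fset = (a \in T) && (b \in T).
Proof.
apply/fsubsetP/andP => [h|[aT bT] p]; first by split; apply: h; rewrite !inE eqxx ?orbT.
by rewrite !inE => /orP[]/eqP ->.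
Qed.

Lemma interior_edgesP TT e : (forall T, T \in TT -> #|` T| = 3%N) ->
  (e \in interior_edges (complex_of TT)) <->
  exists a b, [/\ a != b, e = [fset a; b]%fset & inner_pair TT a b].
Proof.
move=> h3; rewrite /interior_edges in_fsetD !in_simplices /boundary_edges.
have around T s := in_triangles_around_complex_of s T h3.
split.
  move=> /andP[nb /andP[eK /eqP e2]].
  have [a [b [ab ee]]] := fset_pairP e2; exists a, b; split => //.
  have : (1 < #|` triangles_around (complex_of TT) e|)%N.
    by move: nb; rewrite !inE eK e2 /= -ltnNge.
  move=> /cardfs_gt1P[T [T' [tT tT' n]]]; exists T, T'.
  move: tT tT'; rewrite !around ee !fset_pair_sub => /andP[-> /andP[-> ->]].
  by move=> /andP[-> /andP[-> ->]].
move=> [a [b [ab -> [T [T' [[tT tT' n] [aT bT aT' bT']]]]]]].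
have eK : [fset a; b]%fset \in complex_of TT.
  apply/in_complex_of; split; first by apply/fset0Pn; exists a; rewrite !inE eqxx.
  by exists T => //; rewrite fset_pair_sub aT.
rewrite !inE eK cardfs2 ?ab ?va // eqxx /= andbT -ltnNge; apply/cardfs_gt1P.
by exists T, T'; rewrite !around !fset_pair_sub tT tT' aT bT aT' bT'.
Qed.

Lemma boundary_vertex_point K v : forms_triangulation K -> boundary_vertex K v ->
  boundary_point (simplices 2 K) v.
Proof.
move=> ft /hasP[e eB ve].
have [eK c1] : e \in simplices 1 K /\ (#|` triangles_around K e| <= 1)%N.
  by move: eB; rewrite !inE => /andP[/andP[-> ->] ->].
have [T tT eT] := ft _ (or_intror eK).
have e2 : #|` e| = 2%N by move: eK; rewrite in_simplices => /andP[_ /eqP].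
have [a [av ee]] : exists a, v != a /\ e = [fset v; a]%fset.
  have [a [b [ab eq]]] := fset_pairP e2; move: ve; rewrite eq !inE => /orP[]/eqP ->.
    by exists b.
  by exists a; rewrite eq_sym; split => //; apply/fsetP => p; rewrite !inE orbC.
exists a; split => //; exists T => //.
move: eT; rewrite ee fset_pair_sub => /andP[vT aT]; split => // T' tT' vT' aT'.
apply/eqP/negPn/negP => n.
suff : (1 < #|` triangles_around K e|)%N by rewrite ltnNge c1.
apply/cardfs_gt1P; exists T, T'; split; last by rewrite eq_sym.
  by rewrite in_triangles_around tT ee fset_pair_sub vT.
by rewrite in_triangles_around tT' ee fset_pair_sub vT'.
Qed.

Lemma complex_of_triangulation TT : (forall T, T \in TT -> #|` T| = 3%N) ->
  forms_triangulation (complex_of TT).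
Proof.
move=> h3 s h; rewrite triangles_complex_of //.
have : s \in complex_of TT by case: h; rewrite in_simplices => /andP[].
by move=> /in_complex_of[_].
Qed.

Lemma boundary_vertexP TT v : (forall T, T \in TT -> #|` T| = 3%N) ->
  boundary_vertex (complex_of TT) v <-> boundary_point TT v.
Proof.
move=> h3; split.
  move=> /(boundary_vertex_point (complex_of_triangulation h3)).
  by rewrite triangles_complex_of.
move=> [a [va [T tT [vT aT u]]]]; apply/hasP; exists [fset v; a]%fset; last first.
  by rewrite !inE eqxx.
have eK : [fset v; a]%fset \in complex_of TT.
  apply/in_complex_of; split; first by apply/fset0Pn; exists v; rewrite !inE eqxx.
  by exists T => //; rewrite fset_pair_sub vT.
rewrite !inE eK cardfs2 ?ab ?va // eqxx /= leqNgt; apply/negP => /cardfs_gt1P[T1 [T2 [h1 h2 n]]].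
move: h1 h2; rewrite !(in_triangles_around_complex_of _ _ h3) !fset_pair_sub.
move=> /andP[t1 /andP[v1 a1]] /andP[t2 /andP[v2 a2]].
by case/eqP: n; rewrite (u T1) // (u T2).
Qed.

Lemma interior_verticesP TT s : (forall T, T \in TT -> #|` T| = 3%N) ->
  (s \in interior_vertices (complex_of TT)) <->
  exists2 v, s = [fset v]%fset & inner_point TT v.
Proof.
move=> h3; rewrite /interior_vertices !inE; split.
  move=> /andP[/andP[/in_complex_of[_ [T tT sT]] /eqP s1] nb].
  have /cardfs1P[v es] : #|` s| == 1%N by rewrite s1.
  exists v => //; split.
    by exists T => //; apply: (fsubsetP sT); rewrite es !inE.
  move=> /(boundary_vertexP _ h3) b; move/hasPn: nb => /(_ v).
  by rewrite es !inE eqxx b => /(_ isT).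
move=> [v -> [[T tT vT] nb]].
apply/andP; split.
  rewrite cardfs1 eqxx andbT; apply/in_complex_of; split.
    by apply/fset0Pn; exists v; rewrite !inE.
  by exists T => //; rewrite fsub1set.
apply/hasPn => a; rewrite !inE => /eqP ->; apply/negP => /(boundary_vertexP _ h3).
exact: nb.
Qed.

Definition nedges TT := #|` interior_edges (complex_of TT)|.
Definition nverts TT := #|` interior_vertices (complex_of TT)|.

Lemma strang_numberE TT : strang_number 2 TT =
  (6 * #|` TT| + 3 * nverts TT)%N%:Z - (5 * nedges TT)%N%:Z.
Proof.
have -> : strang_number 2 TT =
  6 * (#|` TT|)%:Z - 5 * (nedges TT)%:Z + 3 * (nverts TT)%:Z by [].
by lia.
Qed.

(** The star of [v] in [TT'] is already the whole star in the mesh, so adding triangles does not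
    change it. *)
Lemma inner_point_mono Th TT TT' v : triangle_mesh Th -> (TT `<=` Th)%fset ->
  (TT' `<=` TT)%fset -> inner_point TT' v -> inner_point TT v.
Proof.
move=> mesh sub sub' iv; have [[T tT vT] nb] := iv.
split; first by exists T => //; exact: (fsubsetP sub').
move=> [a [va [T' tT' [vT' aT' u]]]]; apply: nb; exists a; split => //.
exists T'; last by split => // T1 /(fsubsetP sub'); exact: u.
apply: (inner_point_complete mesh (fsubset_trans sub' sub) iv) => //.
exact: (fsubsetP sub).
Qed.

Lemma sub_card3 Th TT : triangle_mesh Th -> (TT `<=` Th)%fset ->
  forall T, T \in TT -> #|` T| = 3%N.
Proof. by move=> mesh sub T /(fsubsetP sub)/(mesh.1 _)[]. Qed.

Lemma nverts_eq Th TT TT' : triangle_mesh Th -> (TT `<=` Th)%fset -> (TT' `<=` TT)%fset ->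
  (forall v, inner_point TT v -> inner_point TT' v) -> nverts TT = nverts TT'.
Proof.
move=> mesh sub sub' h.
suff e : interior_vertices (complex_of TT) = interior_vertices (complex_of TT').
  by rewrite /nverts e.
apply/fsetP => s.
have h3 := sub_card3 mesh sub.
have h3' := sub_card3 mesh (fsubset_trans sub' sub).
apply/idP/idP.
  by move=> /(interior_verticesP _ h3)[v e /h iv]; apply/(interior_verticesP _ h3'); exists v.
move=> /(interior_verticesP _ h3')[v e iv]; apply/(interior_verticesP _ h3); exists v => //.
exact: (inner_point_mono mesh sub sub' iv).
Qed.

Lemma nverts_add Th TT TT' y : triangle_mesh Th -> (TT `<=` Th)%fset ->
  (TT' `<=` TT)%fset -> inner_point TT y -> ~ inner_point TT' y ->
  (forall v, inner_point TT v -> v = y \/ inner_point TT' v) ->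
  nverts TT = (nverts TT').+1.
Proof.
move=> mesh sub sub' iy niy h.
have h3 := sub_card3 mesh sub.
have h3' := sub_card3 mesh (fsubset_trans sub' sub).
have eV : interior_vertices (complex_of TT) =
    ([fset y]%fset |` interior_vertices (complex_of TT'))%fset.
  apply/fsetP => s; rewrite in_fset1U; apply/idP/orP.
    move=> /(interior_verticesP _ h3)[v e /h[ev|iv]]; first by left; rewrite e ev.
    by right; apply/(interior_verticesP _ h3'); exists v.
  move=> [/eqP ->|/(interior_verticesP _ h3')[v e iv]]; apply/(interior_verticesP _ h3).
    by exists y.
  by exists v => //; exact: (inner_point_mono mesh sub sub' iv).
rewrite /nverts eV cardfsU1; suff -> : [fset y]%fset \notin interior_vertices (complex_of TT').
  by [].
apply/negP => /(interior_verticesP _ h3')[v /fsetP/(_ y)].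
by rewrite !inE eqxx => /esym/eqP <-.
Qed.

(** [E] collects the edges that [T0] shares with [TT]. They were not interior before, because an
    edge lies in at most two triangles. *)
Lemma nedges_attach Th TT T0 (E : complex R) : triangle_mesh Th -> (TT `<=` Th)%fset ->
  T0 \in Th -> T0 \notin TT ->
  (forall e, e \in E <-> exists a b, [/\ a != b, e = [fset a; b]%fset,
     a \in T0 /\ b \in T0 & exists2 T, T \in TT & a \in T /\ b \in T]) ->
  nedges (T0 |` TT)%fset = (nedges TT + #|` E|)%N.
Proof.
move=> mesh sub T0Th T0TT hE.
have sub0 : ((T0 |` TT)%fset `<=` Th)%fset.
  by apply/fsubsetP => T; rewrite !inE => /orP[/eqP ->|/(fsubsetP sub)].
have h3 := sub_card3 mesh sub; have h30 := sub_card3 mesh sub0.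
have eI : interior_edges (complex_of (T0 |` TT)%fset) =
    (interior_edges (complex_of TT) `|` E)%fset.
  apply/fsetP => e; rewrite in_fsetU; apply/idP/orP.
    move=> /(interior_edgesP _ h30)[a [b [ab ee [T [T' [[tT tT' n] [aT bT aT' bT']]]]]]].
    move: tT tT'; rewrite !in_fset1U => /orP[/eqP eT|tT] /orP[/eqP eT'|tT'].
    - by rewrite eT eT' eqxx in n.
    - right; apply/hE; exists a, b; rewrite -eT; split => //; by exists T'.
    - right; apply/hE; exists a, b; rewrite -eT'; split => //; by exists T.
    - left; apply/(interior_edgesP _ h3); exists a, b; split => //.
      by exists T, T'.
  move=> [/(interior_edgesP _ h3)[a [b [ab ee [T [T' [[tT tT' n] h]]]]]]|
          /hE[a [b [ab ee [a0 b0] [T tT [aT bT]]]]]]; apply/(interior_edgesP _ h30);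
    exists a, b; split => //.
    by exists T, T'; rewrite !inE tT tT' !orbT.
  exists T0, T; rewrite !inE eqxx tT orbT; split => //; split => //.
  by apply: contraNneq T0TT => ->.
rewrite /nedges eI -cardfsUI.
suff -> : (interior_edges (complex_of TT) `&` E)%fset = fset0 by rewrite cardfs0 addn0.
apply/eqP/fset0Pn => -[e]; rewrite in_fsetI => /andP[].
move=> /(interior_edgesP _ h3)[a [b [ab ee [T [T' [[tT tT' n] [aT bT aT' bT']]]]]]].
move=> /hE[c [d [cd ee' [c0 d0] _]]].
have [a0 b0] : a \in T0 /\ b \in T0.
  apply/andP; rewrite -fset_pair_sub -ee ee' fset_pair_sub; exact/andP.
apply: (@mesh_edge_le2 R Th T0 T T' a b mesh) => //; try exact: (fsubsetP sub).
  by apply: contraNneq T0TT => ->.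
by apply: contraNneq T0TT => ->.
Qed.

(* [k] stands for the number of interior vertices. *)
Definition counted Th TT (k : nat) : Prop := exists2 d,
  dim_of (@spline_coeffs R Th TT) d & (d + 5 * nedges TT = 6 * #|` TT| + 3 * k)%N.

Lemma counted_attach0 Th TT T0 k : triangle_mesh Th -> (TT `<=` Th)%fset ->
  T0 \in Th -> T0 \notin TT -> counted Th TT k ->
  (forall T a b, T \in TT -> a != b -> a \in T -> b \in T -> a \in T0 -> b \in T0 -> False) ->
  counted Th (T0 |` TT)%fset k.
Proof.
move=> mesh sub h0 n0 [d hd e] no; exists (d + 6)%N; first exact: attach0.
rewrite (@nedges_attach Th TT T0 fset0) // ?cardfs0 ?cardfsU1 ?n0; first by lia.
move=> s; rewrite inE; split=> // -[a [b [ab _ [a0 b0] [T tT [aT bT]]]]].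
by case: (no T a b).
Qed.

Lemma counted_attach1 Th TT T0 T1 a b k : triangle_mesh Th -> (TT `<=` Th)%fset ->
  T0 \in Th -> T0 \notin TT -> counted Th TT k -> T1 \in TT -> a != b ->
  a \in T1 -> b \in T1 -> a \in T0 -> b \in T0 ->
  (forall T c c', T \in TT -> c != c' -> c \in T -> c' \in T -> c \in T0 -> c' \in T0 ->
    T = T1) ->
  counted Th (T0 |` TT)%fset k.
Proof.
move=> mesh sub h0 n0 [d hd e] tT1 ab aT1 bT1 aT0 bT0 only; exists d.+1.
  exact: (attach1 mesh sub h0 n0 hd tT1 ab).
rewrite (@nedges_attach Th TT T0 [fset [fset a; b]]%fset) // ?cardfs1 ?cardfsU1 ?n0.
  by lia.
have n : T0 != T1 by apply: contraNneq n0 => ->.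
move=> s; rewrite inE; split=> [/eqP ->|[c [c' [cc' -> [c0 c'0] [T tT [cT c'T]]]]]].
  by exists a, b; split => //; exists T1.
have eT := only T c c' tT cc' cT c'T c0 c'0; rewrite eT in cT c'T.
have t1 := fsubsetP sub _ tT1.
have [ec|ec] := mesh_share mesh h0 t1 n ab aT0 bT0 aT1 bT1 c0 cT;
have [ec'|ec'] := mesh_share mesh h0 t1 n ab aT0 bT0 aT1 bT1 c'0 c'T;
  rewrite ec ec' ?eqxx // in cc' *.
by apply/eqP/fsetP => p; rewrite !inE orbC.
Qed.

Section Two.
Variables (Th TT : complex R) (y x w : plane R) (T0 T1 T2 : simplex R) (k : nat).
Hypotheses (mesh : triangle_mesh Th) (sub : (TT `<=` Th)%fset)
  (h0 : T0 \in Th) (n0 : T0 \notin TT)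
  (eT0 : T0 = [fset y; x; w]%fset) (yx : y != x) (yw : y != w) (xw : x != w)
  (tT1 : T1 \in TT) (tT2 : T2 \in TT) (yT1 : y \in T1) (xT1 : x \in T1)
  (yT2 : y \in T2) (wT2 : w \in T2)
  (only : forall T c c', T \in TT -> c != c' -> c \in T -> c' \in T -> c \in T0 ->
     c' \in T0 -> T = T1 \/ T = T2).

Lemma nedges_attach2 : nedges (T0 |` TT)%fset = (nedges TT + 2)%N.
Proof.
have n1 : T0 != T1 by apply: contraNneq n0 => ->.
have n2 : T0 != T2 by apply: contraNneq n0 => ->.
have t1 := fsubsetP sub _ tT1; have t2 := fsubsetP sub _ tT2.
have [yT0 xT0 wT0] : [/\ y \in T0, x \in T0 & w \in T0].
  by rewrite eT0 !inE !eqxx !orbT.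
rewrite (@nedges_attach Th TT T0 [fset [fset y; x]; [fset y; w]]%fset) //.
  rewrite cardfs2; suff -> : [fset y; x]%fset != [fset y; w]%fset by [].
  apply/eqP => /fsetP/(_ x); rewrite !inE eqxx orbT => /esym/orP[]/eqP h.
    by move: yx; rewrite h eqxx.
  by move: xw; rewrite h eqxx.
move=> s; rewrite !inE; split.
  move=> /orP[]/eqP ->; first by exists y, x; split => //; exists T1.
  by exists y, w; split => //; exists T2.
move=> [c [c' [cc' -> [c0 c'0] [T tT [cT c'T]]]]].
have [eT|eT] := only tT cc' cT c'T c0 c'0; rewrite eT in cT c'T.
  have [ec|ec] := mesh_share mesh h0 t1 n1 yx yT0 xT0 yT1 xT1 c0 cT;
  have [ec'|ec'] := mesh_share mesh h0 t1 n1 yx yT0 xT0 yT1 xT1 c'0 c'T;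
    rewrite ec ec' ?eqxx // in cc' *.
  by apply/orP; left; apply/eqP/fsetP => p; rewrite !inE orbC.
have [ec|ec] := mesh_share mesh h0 t2 n2 yw yT0 wT0 yT2 wT2 c0 cT;
have [ec'|ec'] := mesh_share mesh h0 t2 n2 yw yT0 wT0 yT2 wT2 c'0 c'T;
  rewrite ec ec' ?eqxx ?orbT // in cc' *.
by apply/orP; right; apply/eqP/fsetP => p; rewrite !inE orbC.
Qed.

(** The balance is [- 1 + 5 * 2 = 6 + 3]: one dimension lost, two interior edges, one triangle and
    one interior vertex gained. *)
Lemma counted_attach2_inner p0 : counted Th TT k ->
  (forall p, @spline_coeffs R Th TT p -> jet0 y (jump T1 T2 p)) ->
  @spline_coeffs R Th TT p0 -> hess (jump T1 T2 p0) (x - y) (w - y) != 0 ->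
  counted Th (T0 |` TT)%fset k.+1.
Proof.
move=> [d hd e] j0 hp0 hn.
have [d' hd' ed] := attach2_inner mesh sub h0 n0 eT0 yx yw xw tT1 tT2 yT1 xT1 yT2 wT2
  only hd j0 hp0 hn.
exists d' => //; rewrite nedges_attach2 cardfsU1 n0; move: e ed; clear; lia.
Qed.

(** The balance is [- 4 + 5 * 2 = 6], with no new interior vertex. *)
Lemma counted_attach2_boundary (z : simplex R -> R) : counted Th TT k ->
  (forall T T' a b, T \in TT -> T' \in TT -> T != T' -> a != b ->
     a \in T -> b \in T -> a \in T' -> b \in T' -> z T = z T') ->
  z T1 != z T2 -> counted Th (T0 |` TT)%fset k.
Proof.
move=> [d hd e] hz nz.
have [d' hd' ed] := attach2_boundary mesh sub h0 n0 eT0 yx yw xw tT1 tT2 yT1 xT1 yT2 wT2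
  only hd hz nz.
exists d' => //; rewrite nedges_attach2 cardfsU1 n0; move: e ed; clear; lia.
Qed.

End Two.

End Counting.

(** * One collapse step *)

Section Collapse.
Variable R : realType.
Implicit Types (x y z v w a b c d : plane R) (s e T : simplex R) (K TT Th : complex R).

Definition away x TT : complex R := [fset T in TT | x \notin T]%fset.

Lemma in_away x TT T : (T \in away x TT) = (T \in TT) && (x \notin T).
Proof. by rewrite !inE. Qed.

Lemma away_sub x TT : (away x TT `<=` TT)%fset.
Proof. by apply/fsubsetP => T; rewrite in_away => /andP[]. Qed.

Lemma inner_point_away x TT v : inner_point TT v ->
  (forall T, T \in TT -> v \in T -> x \notin T) -> inner_point (away x TT) v.
Proof.
move=> [[T tT vT] nb] h; split; first by exists T => //; rewrite in_away tT h.
move=> [a [va [T' tT' [vT' aT' u]]]]; apply: nb; exists a; split => //.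
move: tT'; rewrite in_away => /andP[tT' _]; exists T' => //; split => // T1 t1 v1 a1.
by apply: u; rewrite // in_away t1 h.
Qed.

Lemma boundary_pair_points TT a b : boundary_pair TT a b ->
  boundary_point TT a /\ boundary_point TT b.
Proof. by move=> h; split; [exists b|exists a; exact: boundary_pairC]. Qed.

Lemma pair_unique Th a b T0 T1 T : triangle_mesh Th -> T0 \in Th -> T1 \in Th -> T \in Th ->
  a != b -> a \in T0 -> b \in T0 -> a \in T1 -> b \in T1 -> a \in T -> b \in T ->
  T0 != T1 -> T0 != T -> T = T1.
Proof.
move=> mesh t0 t1 t ab a0 b0 a1 b1 aT bT n n'; apply/eqP/negPn/negP => n1.
apply: (@mesh_edge_le2 R Th T0 T1 T a b mesh) => //; by rewrite eq_sym.
Qed.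

Lemma opposite_pair x y z T0 T c c' : T0 = [fset x; y; z]%fset -> x \notin T ->
  c != c' -> c \in T0 -> c' \in T0 -> c \in T -> c' \in T -> y \in T /\ z \in T.
Proof.
move=> -> xT cc'; rewrite !inE -!orbA => /or3P[]/eqP ec /or3P[]/eqP ec' cT c'T;
  rewrite ec ec' in cc' cT c'T;
  first [ by rewrite eqxx in cc' | by rewrite cT in xT | by rewrite c'T in xT | by split ].
Qed.

(** The three vertices of [T0] are boundary vertices of [TT], so no interior vertex appears, and
    [T0] can be glued only along the edge opposite to [x]. *)
Lemma collapse_one Th TT x T0 : triangle_mesh Th -> (TT `<=` Th)%fset ->
  T0 \in TT -> x \in T0 -> (forall T, T \in TT -> x \in T -> T = T0) ->
  counted Th (away x TT) (nverts (away x TT)) -> counted Th TT (nverts TT).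
Proof.
move=> mesh sub t0 x0 uniq0.
have inA := in_away x TT; have sub' := away_sub x TT.
have inner_away := @inner_point_away x TT.
move: (away x TT) inA sub' inner_away => TT' inA sub' inner_away cnt.
have subA := fsubset_trans sub' sub.
have t0h := fsubsetP sub _ t0.
have [y [z [e0 xy xz yz _]]] := mesh_triangle mesh t0h x0.
have n0 : T0 \notin TT' by rewrite inA x0 andbF.
have eTT : TT = (T0 |` TT')%fset.
  apply/fsetP => T; rewrite in_fset1U inA; apply/idP/orP.
    move=> tT; have [xT|xT] := boolP (x \in T); last by right; rewrite tT.
    by left; rewrite (uniq0 T).
  by move=> [/eqP ->|/andP[]].
have [y0 z0] : y \in T0 /\ z \in T0 by rewrite e0 !inE !eqxx !orbT.
have bxy : boundary_pair TT x y.
  by split => //; exists T0 => //; split => // T tT xT _; exact: uniq0.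
have bxz : boundary_pair TT x z.
  by split => //; exists T0 => //; split => // T tT xT _; exact: uniq0.
have eV : nverts TT = nverts TT'.
  apply: (nverts_eq mesh sub sub') => v iv.
  apply: inner_away => // T tT vT; apply/negP => xT; case: (iv) => _; apply.
  have [bx b_y] := boundary_pair_points bxy; have [_ bz] := boundary_pair_points bxz.
  by move: vT; rewrite (uniq0 T) // e0 !inE -orbA => /or3P[]/eqP ->.
rewrite eV [X in counted _ X]eTT.
have [[T1 [t1 y1 z1]]|no] := pselect (exists T1, [/\ T1 \in TT', y \in T1 & z \in T1]).
  apply: (counted_attach1 mesh subA t0h n0 cnt t1 yz y1 z1 y0 z0) => T c c' tT cc' cT c'T c0 c'0.
  have xT : x \notin T by move: tT; rewrite inA => /andP[].
  have [yT zT] := opposite_pair e0 xT cc' c0 c'0 cT c'T.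
  have n1 : T0 != T1 by apply: contraNneq n0 => ->.
  have nT : T0 != T by apply: contraNneq n0 => ->.
  exact: (pair_unique mesh t0h (fsubsetP subA _ t1) (fsubsetP subA _ tT) yz y0 z0 y1 z1 yT zT).
apply: (counted_attach0 mesh subA t0h n0 cnt) => T c c' tT cc' cT c'T c0 c'0.
have xT : x \notin T by move: tT; rewrite inA => /andP[].
have [yT zT] := opposite_pair e0 xT cc' c0 c'0 cT c'T.
by apply: no; exists T; split; [exact: tT|exact: yT|exact: zT].
Qed.

(** Consider the triangles of [TT'] at [y] whose 1-jet at [y] agrees with that of [T1']. The edge
    [yz] is a boundary edge of this class, so there is another one. Since [y] is interior to [TT],
    that other edge was opened by the removal, and it can only be [yw], whose one remaining triangle
    is [T2']. *)
Lemma inner_jets Th TT TT' x y z w T1 T1' T2' (p : {ffun Th -> 'rV[R]_6}) :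
  triangle_mesh Th -> (TT `<=` Th)%fset -> (TT' `<=` TT)%fset ->
  (forall T, T \in TT -> y \in T -> T \notin TT' ->
    forall a, a \in T -> [\/ a = y, a = x, a = z | a = w]) ->
  (forall T, T \in TT' -> x \notin T) ->
  inner_point TT y -> T1 \in TT -> y \in T1 -> z \in T1 -> T1 \notin TT' ->
  y != z -> T1' \in TT' -> y \in T1' -> z \in T1' ->
  y != w -> T2' \in TT' -> y \in T2' -> w \in T2' ->
  (forall T, T \in TT' -> y \in T -> w \in T -> T = T2') ->
  spline_coeffs TT' p -> jet0 y (piece p T1' - piece p T2').
Proof.
move=> mesh sub sub' out nx iy t1 y1 z1 n1 yz t1' y1' z1' yw t2' y2' w2' u2 hp.
have subh := fsubset_trans sub' sub.
pose C := [fset T in TT' | (y \in T) && `[< jet0 y (piece p T1' - piece p T) >]]%fset.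
have inC T : (T \in C) = [&& T \in TT', y \in T & `[< jet0 y (piece p T1' - piece p T) >]].
  by rewrite !inE.
have cl : edge_class TT' C y.
  split; first by move=> T; rewrite inC => /and3P[].
  move=> T T' a; rewrite !inC => /and3P[tT yT /asboolP j] tT' ay yT' aT aT'.
  rewrite tT' yT' /=; apply/asboolP; apply: jet0B j _.
  have [->|n] := eqVneq T T'; first by rewrite subrr; exact: jet00.
  by apply: (hp.2 T T' y a) => //; rewrite eq_sym.
have T1'C : T1' \in C by rewrite inC t1' y1' subrr; apply/asboolP; exact: jet00.
have th T : T \in TT' -> T \in Th by exact: fsubsetP.
have byz : boundary_pair TT' y z.
  split => //; exists T1' => //; split => // T tT yT zT.
  have n1' : T1 != T1' by apply: contraNneq n1 => ->.
  have nT : T1 != T by apply: contraNneq n1 => ->.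
  exact: (pair_unique mesh (fsubsetP sub _ t1) (th _ t1') (th _ tT) yz y1 z1 y1' z1' yT zT).
have [a' [T' [na T'C a'T' b']]] := edge_class_boundary mesh subh cl T1'C z1' byz.
move: (T'C); rewrite inC => /and3P[tT' yT' /asboolP j].
have ya' : y != a' by case: b'.
suff ea : a' = w by rewrite -(u2 T') // -ea.
have [|T'' [tT'' n'' yT'' aT'']] :=
  @inner_pair_other R TT y a' T' _ (fsubsetP sub' _ tT') ya' yT' a'T'.
  by move=> h; case: iy => _; apply; exists a'.
have nT'' : T'' \notin TT'.
  apply: contra n'' => t; have [_ [T3 _ [_ _ u3]]] := b'.
  by rewrite (u3 T'') // (u3 T').
have [e|e|e|//] := out T'' tT'' yT'' nT'' a' aT''.
- by rewrite e eqxx in ya'.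
- by have := nx _ tT'; rewrite -e a'T'.
- by rewrite e eqxx in na.
Qed.

(** With [z] and [w] the remaining vertices of the two triangles, [T1] is attached first, along at
    most the edge [yz]. Then [T2] is attached along [yx], and also along [yw] if a triangle of
    [away x TT] has this edge; the count then depends on whether [y] is interior to [TT]. *)
Lemma collapse_two Th TT x y T1 T2 : triangle_mesh Th -> (TT `<=` Th)%fset ->
  T1 \in TT -> T2 \in TT -> T1 != T2 -> x != y ->
  x \in T1 -> y \in T1 -> x \in T2 -> y \in T2 ->
  (forall T, T \in TT -> x \in T -> T = T1 \/ T = T2) ->
  (forall z w, z != w -> T1 = [fset y; x; z]%fset -> T2 = [fset y; x; w]%fset ->
     det3 y z w != 0) ->
  (forall v v', boundary_point TT v -> boundary_point TT v' ->
     connected_by (free_pair Th TT) v v') ->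
  counted Th (away x TT) (nverts (away x TT)) -> counted Th TT (nverts TT).
Proof.
move=> mesh sub t1 t2 n12 xy x1 y1 x2 y2 only12 noncol conn.
have inA := in_away x TT; have sub' := away_sub x TT.
have inner_away := @inner_point_away x TT.
move: (away x TT) inA sub' inner_away => TT' inA sub' inner_away cnt.
have subA := fsubset_trans sub' sub.
have nx T : T \in TT' -> x \notin T by rewrite inA => /andP[].
have t1h := fsubsetP sub _ t1; have t2h := fsubsetP sub _ t2.
have yx : y != x by rewrite eq_sym.
have [z [e1 yz xz D1]] := mesh_triangle2 mesh t1h y1 x1 yx.
have [w [e2 yw xw D2]] := mesh_triangle2 mesh t2h y2 x2 yx.
have z1 : z \in T1 by rewrite e1 !inE eqxx orbT.
have zT2 : z \notin T2.
  apply/negP => z2; have [h|h] := mesh_share mesh t1h t2h n12 yx y1 x1 y2 x2 z1 z2.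
    by rewrite h eqxx in yz.
  by rewrite h eqxx in xz.
have w2 : w \in T2 by rewrite e2 !inE eqxx orbT.
have zw : z != w by apply: contraNneq zT2 => ->.
have wT1 : w \notin T1.
  rewrite e1 !inE !negb_or !(eq_sym w) yw xw zw //.
have n1 : T1 \notin TT' by rewrite inA x1 andbF.
have n2 : T2 \notin TT' by rewrite inA x2 andbF.
have inTT' T : T \in TT -> T != T1 -> T != T2 -> T \in TT'.
  move=> tT h1 h2; rewrite inA tT; apply/negP => xT.
  by case: (only12 T tT xT) => e; [rewrite e eqxx in h1|rewrite e eqxx in h2].
have eTT : TT = (T2 |` (T1 |` TT'))%fset.
  apply/fsetP => T; rewrite !in_fset1U; apply/idP/or3P.
    move=> tT; have [->|h2] := eqVneq T T2; first exact: Or31.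
    have [->|h1] := eqVneq T T1; first exact: Or32.
    by apply: Or33; exact: inTT'.
  by move=> [/eqP ->|/eqP ->|/(fsubsetP sub')].
have bxz : boundary_pair TT x z.
  split => //; exists T1 => //; split => // T tT xT zT.
  by case: (only12 T tT xT) => // e; rewrite e (negbTE zT2) in zT.
have bxw : boundary_pair TT x w.
  split => //; exists T2 => //; split => // T tT xT wT.
  by case: (only12 T tT xT) => // e; rewrite e (negbTE wT1) in wT.
have [bx bz] := boundary_pair_points bxz; have [_ bw] := boundary_pair_points bxw.
(* [x], [z] and [w] are ends of boundary edges, so only [y] can become an interior vertex. *)
have inner_or v : inner_point TT v -> v = y \/ inner_point TT' v.
  move=> iv; have [->|nvy] := eqVneq v y; first by left.
  right; apply: inner_away => // T tT vT; apply/negP => xT; case: (iv) => _; apply.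
  move: vT; case: (only12 T tT xT) => ->; rewrite ?e1 ?e2 !inE (negbTE nvy) /=;
    by move=> /orP[]/eqP ->.
have cnt1 : counted Th (T1 |` TT')%fset (nverts TT').
  have e1' : T1 = [fset x; y; z]%fset.
    by rewrite e1; apply/fsetP => p; rewrite !inE; congr (_ || _); rewrite orbC.
  have [[T1' [t1' y1' z1']]|no] := pselect (exists T, [/\ T \in TT', y \in T & z \in T]).
    apply: (counted_attach1 mesh subA t1h n1 cnt t1' yz y1' z1' y1 z1)
      => T c c' tT cc' cT c'T c0 c'0.
    have [yT zT] := opposite_pair e1' (nx _ tT) cc' c0 c'0 cT c'T.
    have n1' : T1 != T1' by apply: contraNneq n1 => ->.
    have nT : T1 != T by apply: contraNneq n1 => ->.
    exact: (pair_unique mesh t1h (fsubsetP subA _ t1') (fsubsetP subA _ tT) yz y1 z1 y1' z1' yT zT).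
  apply: (counted_attach0 mesh subA t1h n1 cnt) => T c c' tT cc' cT c'T c0 c'0.
  have [yT zT] := opposite_pair e1' (nx _ tT) cc' c0 c'0 cT c'T.
  by apply: no; exists T; split; [exact: tT|exact: yT|exact: zT].
have sub1 : ((T1 |` TT')%fset `<=` Th)%fset.
  by apply/fsubsetP => T; rewrite in_fset1U => /orP[/eqP ->|/(fsubsetP subA)].
have n2' : T2 \notin (T1 |` TT')%fset by rewrite in_fset1U negb_or n2 eq_sym n12.
have t1' : T1 \in (T1 |` TT')%fset by rewrite in_fset1U eqxx.
have e2' : T2 = [fset x; y; w]%fset.
  by rewrite e2; apply/fsetP => p; rewrite !inE; congr (_ || _); rewrite orbC.
have [[T2' [t2' y2' w2']]|no] := pselect (exists T, [/\ T \in TT', y \in T & w \in T]); last first.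
  have byw : boundary_pair TT y w.
    split => //; exists T2 => //; split => // T tT yT wT.
    apply/eqP/negPn/negP => h; apply: no; exists T; split => //; apply: inTT' => //.
    by apply: contraNneq wT1 => <-.
  have eV : nverts TT = nverts TT'.
    apply: (nverts_eq mesh sub sub') => v iv; case: (inner_or v iv) => // ev.
    by have [b_y _] := boundary_pair_points byw; case: iv => _; rewrite ev.
  rewrite eV [X in counted _ X]eTT.
  apply: (counted_attach1 mesh sub1 t2h n2' cnt1 t1' yx y1 x1 y2 x2) => T c c'.
  rewrite in_fset1U => /orP[/eqP //|tT] cc' cT c'T c0 c'0.
  have [yT wT] := opposite_pair e2' (nx _ tT) cc' c0 c'0 cT c'T.
  by case: no; exists T; split; [exact: tT|exact: yT|exact: wT].
have t2'' : T2' \in (T1 |` TT')%fset by rewrite in_fset1U t2' orbT.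
have only2 T : T \in TT' -> y \in T -> w \in T -> T = T2'.
  move=> tT yT wT.
  have n2'' : T2 != T2' by apply: contraNneq n2 => ->.
  have nT : T2 != T by apply: contraNneq n2 => ->.
  exact: (pair_unique mesh t2h (fsubsetP subA _ t2') (fsubsetP subA _ tT) yw y2 w2 y2' w2' yT wT).
have only : forall T c c', T \in (T1 |` TT')%fset -> c != c' -> c \in T -> c' \in T ->
    c \in T2 -> c' \in T2 -> T = T1 \/ T = T2'.
  move=> T c c'; rewrite in_fset1U => /orP[/eqP ->|tT] cc' cT c'T c0 c'0; first by left.
  have [yT wT] := opposite_pair e2' (nx _ tT) cc' c0 c'0 cT c'T.
  by right; exact: only2.
have [iy|niy] := pselect (inner_point TT y).
  have -> : nverts TT = (nverts TT').+1.
    apply: (nverts_add mesh sub sub' iy _ inner_or) => iy'.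
    by move: n1; rewrite (inner_point_complete mesh subA iy' t1h y1).
  rewrite [X in counted _ X]eTT.
  have [|T1' [tT1' n1' yT1' zT1']] := @inner_pair_other R TT y z T1 _ t1 yz y1 z1.
    by move=> h; case: iy => _; apply; exists z.
  have {tT1'} t1'' : T1' \in TT' by apply: inTT' => //; apply: contraNneq zT2 => <-.
  (* The squared equation of [yz] on [T1] and 0 elsewhere is an old spline. The mixed derivative of
     its jump is twice the product of the values of that equation at [x] and [w], and the value at
     [w] is nonzero by the non-collinear condition. *)
  pose p0 : {ffun Th -> 'rV[R]_6} := single Th T1 (sqline y z).
  have pp T : T \in Th -> piece p0 T = if T == T1 then sqline y z else 0.
    by move=> h; rewrite /p0 piece_of_pieces.
  have T2T1 : (T2' == T1) = false by apply: contraNF n1 => /eqP <-.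
  apply: (counted_attach2_inner mesh sub1 t2h n2' e2 yx yw xw t1' t2'' y1 x1 y2' w2' only
    cnt1 (p0 := p0)).
  - move=> p [hp1 hp2].
    pose p' : {ffun Th -> 'rV[R]_6} := of_pieces Th (fun T => if T \in TT' then piece p T else 0).
    have pp' T : T \in TT' -> piece p' T = piece p T.
      by move=> h; rewrite piece_of_pieces ?h //; exact: (fsubsetP subA).
    have hp' : spline_coeffs TT' p'.
      split.
        move=> T h; have [hT|hT] := boolP (T \in Th); last by rewrite piece_out.
        by rewrite piece_of_pieces // (negbTE h).
      move=> T T' a b tT tT' n ab aT bT aT' bT'; rewrite !pp' //.
      by apply: (hp2 T T' a b); rewrite // in_fset1U ?tT ?tT' orbT.
    have j1 : jet0 y (piece p T1 - piece p T1').
      apply: (hp2 T1 T1' y z) => //; first by rewrite in_fset1U t1'' orbT.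
      by rewrite eq_sym.
    apply: jet0B j1 _; rewrite -(pp' T1') // -(pp' T2') //.
    apply: (inner_jets (x := x) (z := z) (w := w) mesh sub sub' _ nx iy t1 y1 z1 n1 yz
      t1'' yT1' zT1' yw t2' y2' w2' only2 hp').
    move=> T tT yT nT a aT.
    have : T = T1 \/ T = T2.
      by apply: only12 => //; apply: contraNT nT => h; rewrite inA tT.
    move: aT => /[swap] -[]->; rewrite ?e1 ?e2 !inE -orbA => /or3P[]/eqP ->;
      by [apply: Or41|apply: Or42|apply: Or43|apply: Or44].
  - split.
      move=> T; rewrite in_fset1U negb_or => /andP[h _].
      have [hT|hT] := boolP (T \in Th); last by rewrite piece_out.
      by rewrite pp // (negbTE h).
    have key T a b : T \in TT' -> a != b -> a \in T -> b \in T -> a \in T1 -> b \in T1 ->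
        jet0 a (sqline y z).
      move=> tT ab aT bT a1 b1.
      move: a1; rewrite e1 !inE -orbA => /or3P[]/eqP ea.
      + by rewrite ea; exact: jet0_sqlinel.
      + by move: (nx _ tT); rewrite -ea aT.
      + by rewrite ea; exact: jet0_sqliner.
    move=> T T' a b; rewrite !in_fset1U => hT hT' n ab aT bT aT' bT'.
    have th S : (S == T1) || (S \in TT') -> S \in Th.
      by move=> /orP[/eqP ->//|]; exact: (fsubsetP subA).
    rewrite !pp ?th //.
    have [eT|nT] := eqVneq T T1; have [eT'|nT'] := eqVneq T' T1.
    + by rewrite eT eT' eqxx in n.
    + rewrite subr0; rewrite (negbTE nT') in hT'; rewrite eT in aT bT.
      exact: (key T' a b).
    + rewrite sub0r; apply: jet0N; rewrite (negbTE nT) in hT; rewrite eT' in aT' bT'.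
      exact: (key T a b).
    + by rewrite subrr; exact: jet00.
  - rewrite /jump !pp //; last exact: (fsubsetP subA).
    rewrite eqxx T2T1 subr0 hess_sqline.
    have d0 : det3 y z y = 0 by rewrite /det3; ring.
    rewrite d0 !subr0 !mulf_neq0 ?pnatr_eq0 //.
      by rewrite (_ : det3 y z x = - det3 y x z) ?oppr_eq0 // /det3; ring.
    exact: noncol.
have b_y : boundary_point TT y.
  by apply: contrapT => nb; apply: niy; split => //; exists T1.
have eV : nverts TT = nverts TT'.
  apply: (nverts_eq mesh sub sub') => v iv; case: (inner_or v iv) => // ev.
  by case: niy; rewrite -ev.
rewrite eV [X in counted _ X]eTT.
(* [T1] and [T2] are the only triangles of [TT] sharing [xy], and [T2] is not attached yet, so the
   potential does not jump at interior edges of the current set. Through [yw] it takes the same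
   value on [T2'] as on [T2]. *)
have [zb [zsame zdiff]] := potential_parity mesh sub t1 t2 n12 xy x1 y1 x2 y2 (conn _ _ b_y bx).
have nT2 T : T \in TT' -> x \notin T := nx T.
apply: (counted_attach2_boundary mesh sub1 t2h n2' e2 yx yw xw t1' t2'' y1 x1 y2' w2' only
    (z := fun T => (zb T)%:R) cnt1).
  move=> T T' a b hT hT' n ab aT bT aT' bT'; congr (_ %:R).
  have inT S : S \in (T1 |` TT')%fset -> S \in TT.
    by rewrite in_fset1U => /orP[/eqP ->//|/(fsubsetP sub')].
  have nxy : ~ (x \in T /\ x \in T' /\ y \in T /\ y \in T').
    move=> [xT [xT' _]].
    move: hT hT'; rewrite !in_fset1U => /orP[/eqP eT|/nx]; last by rewrite xT.
    move=> /orP[/eqP eT'|/nx]; last by rewrite xT'.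
    by rewrite eT eT' eqxx in n.
  by rewrite (zsame T T' a b (inT _ hT) (inT _ hT') n ab aT bT aT' bT' nxy).
have -> : zb T2' = zb T2.
  have n2'' : T2' != T2 by apply: contraNneq n2 => <-.
  apply: (zsame T2' T2 y w (fsubsetP sub' _ t2') t2 n2'' yw y2' w2' y2 w2) => -[xT _].
  by move: (nx _ t2'); rewrite xT.
by rewrite eqr_nat; case: (zb T1) zdiff; case: (zb T2).
Qed.

End Collapse.

(** * Induction along the collapse *)

Section Induction.
Variable R : realType.
Implicit Types (y z v w a b c d : plane R) (s e T : simplex R) (K TT Th : complex R).

Lemma simplices_next K (u : plane R) :
  simplices 2 [fset s in K | s \notin beta u K]%fset = away u (simplices 2 K).
Proof.
apply/fsetP => T; rewrite in_away !in_simplices; apply/andP/andP.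
  move=> [/[!inE] /andP[TK nb] T3]; rewrite TK T3; split => //.
  by apply: contra nb => uT; rewrite TK uT.
move=> [/andP[TK T3] uT]; split => //; rewrite !inE TK /=.
have nst : T \notin star u K by rewrite !inE TK.
(* A triangle avoiding [u] is contained in a triangle avoiding [u], namely itself, so the second
   part of [beta] does not remove it. *)
rewrite (negbTE uT) /= negb_and; apply/orP; right.
apply/allPn; exists T; last by rewrite negbK fsubset_refl.
by rewrite in_simplices in_fsetD nst TK T3.
Qed.

Lemma counted_triangle Th T : triangle_mesh Th -> T \in Th ->
  counted Th [fset T]%fset (nverts [fset T]%fset).
Proof.
move=> mesh tT; have T3 := (mesh.1 _ tT).1.
have h3 T' : T' \in [fset T]%fset -> #|` T'| = 3%N by rewrite inE => /eqP ->.
have -> : nverts [fset T]%fset = 0%N.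
  apply/eqP; rewrite cardfs_eq0; apply/eqP/fsetP => s; rewrite in_fset0.
  apply/negP => /(interior_verticesP _ h3)[v _ [[T' t' vT] nb]].
  move: t'; rewrite inE => /eqP eT; rewrite eT in vT.
  have [a [b [e va vb ab]]] := fset3_mem1 T3 vT.
  apply: nb; exists a; split => //; exists T; first by rewrite inE.
  split => //; first by rewrite e !inE eqxx orbT.
  by move=> T1; rewrite inE => /eqP.
have -> : [fset T]%fset = (T |` fset0)%fset by rewrite fsetU0.
have n0 : T \notin (fset0 : complex R) by rewrite inE.
apply: (counted_attach0 mesh (fsub0set _) tT n0); last by move=> T' a b; rewrite inE.
exists 0%N.
  apply: dim_of_ext (dim_of0 _) => p; split.
    by move=> ->; have [h _] := @spline_coeffs_linear R Th fset0.
  by move=> [h _]; apply: eq_piece => T' _; rewrite piece0 h // inE.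
have h0 T' : T' \in (fset0 : complex R) -> #|` T'| = 3%N by rewrite inE.
rewrite (_ : nedges fset0 = 0%N) ?cardfs0 //.
apply/eqP; rewrite cardfs_eq0; apply/eqP/fsetP => s; rewrite in_fset0.
by apply/negP => /(interior_edgesP _ h0)[a [b [_ _ [T1 [T2 [[t1 _ _] _]]]]]]; move: t1; rewrite inE.
Qed.

Lemma line_det y z w : y != z -> det3 y z w = 0 ->
  exists L, [/\ is_line L, hull [fset y; z]%fset `<=` L & hull [fset y; w]%fset `<=` L].
Proof.
move=> yz d0; have P := plane_neq yz; set n := _ + _ in P.
exists [set y + t *: (z - y) | t in [set: R]]; split.
- by exists y, (z - y); split => //; rewrite subr_eq0 eq_sym.
- move=> p /(hull2P _ yz)[t _ ->]; exists t => //.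
  by apply: planeP; rewrite !mxE; ring.
- have [k ew] : exists k, w = y + k *: (z - y).
    (* The coefficient of the orthogonal projection of [w - y] on [z - y]. *)
    exists (((w 0 0 - y 0 0) * (z 0 0 - y 0 0) + (w 0 1 - y 0 1) * (z 0 1 - y 0 1)) / n).
    have n0 : n != 0 by rewrite gt_eqF.
    apply: planeP; rewrite !mxE; apply/eqP; rewrite -subr_eq0; apply/eqP.
      transitivity (- (z 0 1 - y 0 1) * det3 y z w / n); last by rewrite d0 mulr0 mul0r.
      by rewrite /det3 /n; field.
    transitivity ((z 0 0 - y 0 0) * det3 y z w / n); last by rewrite d0 mulr0 mul0r.
    by rewrite /det3 /n; field.
  have [yw|yw] := eqVneq y w.
    move=> p; rewrite -yw (_ : [fset y; y]%fset = [fset y]%fset); last first.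
      by apply/fsetP => q; rewrite !inE orbb.
    by rewrite hull1E => ->; exists 0 => //; rewrite scale0r addr0.
  move=> p /(hull2P _ yw)[t _ ->]; exists (t * k) => //.
  by rewrite ew; apply: planeP; rewrite !mxE; ring.
Qed.

Lemma fset3D1 y x z : y != x -> z != x -> ([fset y; x; z] `\ x)%fset = [fset y; z]%fset.
Proof.
move=> yx zx; apply/fsetP => p; rewrite !inE.
have [->|] := eqVneq p x; first by rewrite !(eq_sym x) (negbTE yx) (negbTE zx).
by move=> n; rewrite orbF.
Qed.

Lemma collapse_counted Th N (x : nat -> plane R) (Ks : nat -> complex R) :
  triangle_mesh Th -> strong_collapse (complex_of Th) N x Ks ->
  noncollinear_condition N x Ks ->
  (forall v v', boundary_point Th v -> boundary_point Th v' ->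
     connected_by (boundary_pair Th) v v') ->
  counted Th Th (nverts Th).
Proof.
move=> mesh [K0 Ktri Kx Kn [TN TN3 KN]] noncol conn0.
have h3 := sub_card3 mesh (fsubset_refl Th).
pose TT i := simplices 2 (Ks i).
have T0 : TT 0%N = Th by rewrite /TT K0 triangles_complex_of.
have Tn i : (i < N)%N -> TT i.+1 = away (x i) (TT i).
  by move=> iN; have [_ e] := Kn i iN; rewrite /TT e simplices_next.
have Tsub i : (i <= N)%N -> (TT i `<=` Th)%fset.
  elim: i => [_|i IH iN]; first by rewrite T0.
  by rewrite (Tn i iN); apply: fsubset_trans (away_sub _ _) (IH _); exact: ltnW.
have xb i : (i <= N)%N -> boundary_point (TT i) (x i).
  move=> iN; have [bv _ _] := Kx i iN; have [_ ft _] := Ktri i iN.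
  exact: boundary_vertex_point.
have around i T : (T \in triangles_around (Ks i) [fset x i]%fset) =
    (T \in TT i) && (x i \in T).
  by rewrite in_triangles_around fsub1set.
have conn i : (i <= N)%N -> forall v v', boundary_point (TT i) v ->
    boundary_point (TT i) v' -> connected_by (free_pair Th (TT i)) v v'.
  elim: i => [_ v v'|i IH iN].
    rewrite T0 => bv bv'; apply: connected_by_sub (conn0 v v' bv bv') => c d.
    move=> [cd [T tT [cT dT u]]]; split => //; first by exists T.
    move=> [T1 [T2 [[t1 t2 n] [c1 d1 c2 d2]]]].
    by case/eqP: n; rewrite (u T1) // (u T2).
  have iN' := ltnW iN; rewrite (Tn i iN).
  have weak c d : free_pair Th (TT i) c d -> free_pair Th (away (x i) (TT i)) c d.
    move=> [cd ex ni]; split => // -[T1 [T2 [[t1 t2 n] h]]]; apply: ni; exists T1, T2.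
    by split => //; split => //; apply: (fsubsetP (away_sub (x i) (TT i))).
  have sym c d : free_pair Th (away (x i) (TT i)) c d ->
    free_pair Th (away (x i) (TT i)) d c by exact: free_pairC.
  have to_x v : boundary_point (away (x i) (TT i)) v ->
      connected_by (free_pair Th (away (x i) (TT i))) v (x i).
    move=> bv; have [bi|nbi] := pselect (boundary_point (TT i) v).
      by apply: connected_by_sub (IH iN' _ _ bi (xb i iN')) => c d; exact: weak.
    have [a [va [T tT [vT aT u]]]] := bv.
    have iv : inner_point (TT i) v.
      split => //; exists T => //.
      exact: (fsubsetP (away_sub (x i) (TT i))).
    (* Otherwise the star of [v] is untouched by the removal and [v] stays an inner point. *)
    have [T' [t' vT' xT']] : exists T', [/\ T' \in TT i, v \in T' & x i \in T'].
      apply: contrapT => no.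
      have hn T1 : T1 \in TT i -> v \in T1 -> x i \notin T1.
        by move=> t1 v1; apply/negP => x1; apply: no; exists T1.
      have [_ nb] := inner_point_away iv hn.
      exact: nb.
    (* No remaining triangle contains [x i], so this edge is free. It may have disappeared from the
       remaining complex, which is why [free_pair] takes its edges in [Th]. *)
    apply: connected_by1; split.
    - apply/eqP => e; move: nbi; rewrite e => nbi; exact: nbi (xb i iN').
    - by exists T' => //; exact: (fsubsetP (Tsub i iN')).
    - move=> [T1 [_ [[t1 _ _] [_ xT1 _ _]]]].
      by move: t1; rewrite in_away xT1 andbF.
  move=> v v' bv bv'; apply: connected_by_trans (to_x v bv) _.
  by apply: connected_by_sym => //; exact: to_x.
have step i : (i < N)%N -> counted Th (TT i.+1) (nverts (TT i.+1)) ->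
    counted Th (TT i) (nverts (TT i)).
  move=> iN; have iN' := ltnW iN; rewrite (Tn i iN) => cnt.
  have [_ card2 common] := Kx i iN'.
  have [a [_ [T1 t1 [x1 _ _]]]] := xb i iN'.
  have [[T2 [t2 x2 n]]|no] :=
    pselect (exists T, [/\ T \in TT i, x i \in T & T1 != T]); last first.
    apply: (collapse_one mesh (Tsub i iN') t1 x1) cnt => T tT xT.
    by apply/eqP/negPn/negP => n; apply: no; exists T; rewrite eq_sym.
  have a1 : T1 \in triangles_around (Ks i) [fset x i]%fset by rewrite around t1.
  have a2 : T2 \in triangles_around (Ks i) [fset x i]%fset by rewrite around t2.
  have only T : T \in TT i -> x i \in T -> T = T1 \/ T = T2.
    move=> tT xT; have aT : T \in triangles_around (Ks i) [fset x i]%fset by rewrite around tT.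
    apply: contrapT => h.
    have n1 : T1 != T by apply/eqP => e; apply: h; left.
    have n2 : T2 != T by apply/eqP => e; apply: h; right.
    have : ([fset T1; T2; T] `<=` triangles_around (Ks i) [fset x i])%fset.
      by apply/fsubsetP => S; rewrite !in_fsetU !in_fset1 -orbA => /or3P[]/eqP ->.
    move=> /fsubset_leq_card; rewrite leqNgt => /negP; apply.
    apply: leq_ltn_trans card2 _.
    rewrite -fsetUA !cardfsU1 cardfs1 !inE negb_or n n1 n2 //.
  have [e eK /andP[e1 e2]] := common T1 T2 a1 a2 n.
  have t1h := fsubsetP (Tsub i iN') _ t1; have t2h := fsubsetP (Tsub i iN') _ t2.
  have [c [d [cd ee]]] : exists c d, c != d /\ e = [fset c; d]%fset.
    by apply: fset_pairP; move: eK; rewrite in_simplices => /andP[_ /eqP].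
  rewrite ee !fset_pair_sub in e1 e2; move: e1 e2 => /andP[c1 d1] /andP[c2 d2].
  have [y [xy y1 y2]] : exists y, [/\ x i != y, y \in T1 & y \in T2].
    have [ex|ex] := mesh_share mesh t1h t2h n cd c1 d1 c2 d2 x1 x2.
      by exists d; split => //; rewrite ex.
    by exists c; split => //; rewrite ex eq_sym.
  apply: (collapse_two mesh (Tsub i iN') t1 t2 n xy x1 y1 x2 y2 only _ (conn i iN')) cnt.
  move=> z w zw ez ew; apply/eqP => det0.
  have yx : y != x i by rewrite eq_sym.
  have c3 S p : S \in Th -> S = [fset y; x i; p]%fset -> (y != p) /\ (p != x i).
    move=> /h3 + eS; rewrite eS -fsetUA !cardfsU1 cardfs1 !inE negb_or yx /=.
    rewrite (eq_sym p); case: (y == p); case: (x i == p) => //=.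
  have [yz zx] := c3 _ _ t1h ez; have [yw wx] := c3 _ _ t2h ew.
  apply: (noncol i T1 T2 iN' a1 a2 n).
  have [L [hL hz hw]] := line_det yz det0; exists L; split => //.
    by rewrite ez fset3D1.
  by rewrite ew fset3D1.
pose S0 : simplex R := TN.
have TNe : TT N = [fset S0]%fset.
  apply/fsetP => T; rewrite in_simplices in_fset1; apply/andP/eqP.
    by move=> [/KN[sT _] /eqP T3]; apply/eqP; rewrite eqEfcard /S0 sT T3 TN3.
  move=> ->; rewrite /S0; split; last by rewrite TN3.
  by apply/KN; split; [exact: fsubset_refl|rewrite -cardfs_gt0 TN3].
have cN : counted Th (TT N) (nverts (TT N)).
  rewrite TNe; apply: counted_triangle => //.
  by apply: (fsubsetP (Tsub N (leqnn N))); rewrite TNe inE.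
have down j : (j <= N)%N -> counted Th (TT (N - j)%N) (nverts (TT (N - j)%N)).
  elim: j => [_|j IH jN]; first by rewrite subn0.
  apply: step; first by rewrite ltn_subrL (leq_ltn_trans _ jN).
  have e : (N - j.+1).+1 = (N - j)%N by rewrite -subSn.
  by rewrite e; exact: IH (ltnW jN).
by have := down N (leqnn N); rewrite subnn T0.
Qed.

End Induction.

(** * Differentiability *)

Section Differential.
Variable R : realType.
Implicit Types (x y z w a b c u h : plane R) (T : simplex R) (Th : complex R).
Implicit Types (q : 'rV[R]_6) (f v : plane R -> R).

Definition linear_form (g0 g1 : R) u : R := g0 * u 0 0 + g1 * u 0 1.

Lemma linear_form_linear g0 g1 : linear (linear_form g0 g1 : plane R -> R^o).
Proof. by move=> k u w; rewrite /linear_form !mxE /GRing.scale /=; ring. Qed.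
HB.instance Definition _ g0 g1 :=
  GRing.isLinear.Build R (plane R) R^o _ (linear_form g0 g1) (linear_form_linear g0 g1).

Lemma linear_form_continuous g0 g1 : continuous (linear_form g0 g1).
Proof.
move=> u; rewrite /linear_form; apply: (@cvgD _ _ _ (nbhs u));
  (apply: cvgM; first exact: cvg_cst); exact: continuous_coord.
Qed.

Definition dev q y u : R := linear_form (grad0 q y) (grad1 q y) u.

Definition quad q u : R :=
  qcoef q 3 * u 0 0 ^+ 2 + qcoef q 4 * (u 0 0 * u 0 1) + qcoef q 5 * u 0 1 ^+ 2.

Lemma ev_expand q y u : ev q (y + u) = ev q y + dev q y u + quad q u.
Proof. by rewrite /ev /dev /quad /linear_form /grad0 /grad1 !mxE; ring. Qed.

Lemma devZ q y (s : R) u : dev q y (s *: u) = s * dev q y u.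
Proof. by rewrite /dev /linear_form !mxE; ring. Qed.

Lemma quadZ q (s : R) u : quad q (s *: u) = s ^+ 2 * quad q u.
Proof. by rewrite /quad !mxE; ring. Qed.

Lemma dev_continuous q u : continuous (fun z => dev q z u).
Proof.
rewrite (_ : (fun z => _) = fun z => dev q 0 u +
  linear_form (2 * qcoef q 3 * u 0 0 + qcoef q 4 * u 0 1)
    (qcoef q 4 * u 0 0 + 2 * qcoef q 5 * u 0 1) z); last first.
  by apply/funext => z; rewrite /dev /linear_form /grad0 /grad1 !mxE; ring.
by move=> z; apply: (@cvgD _ _ _ (nbhs z)); [exact: cvg_cst|exact: linear_form_continuous].
Qed.

Lemma norm_coord u (i : 'I_2) : `|u 0 i| <= `|u|.
Proof.
have -> : `|u| = mx_norm u by [].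
rewrite mx_normrE.
exact: (le_bigmax _ (fun ij : 'I_1 * 'I_2 => `|u ij.1 ij.2|) (0, i)).
Qed.

Lemma quad_bound q u : `|quad q u| <=
  (`|qcoef q 3| + `|qcoef q 4| + `|qcoef q 5|) * `|u| * `|u|.
Proof.
have h0 := norm_coord u 0; have h1 := norm_coord u 1.
have n0 := normr_ge0 (u 0 0); have n1 := normr_ge0 (u 0 1).
have m (s t : R) : 0 <= s -> 0 <= t -> s <= `|u| -> t <= `|u| -> s * t <= `|u| * `|u|.
  by move=> *; apply: ler_pM.
rewrite /quad !mulrDl; apply: le_trans (ler_normD _ _) _; apply: lerD.
  apply: le_trans (ler_normD _ _) _; apply: lerD; rewrite !normrM -mulrA ler_wpM2l //.
    exact: m.
  exact: m.
by rewrite !normrM -mulrA ler_wpM2l //; exact: m.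
Qed.

Lemma near0_norm (e : R) : 0 < e -> \forall u \near (0 : plane R), `|u| <= e.
Proof.
move=> e0; apply/nbhs_ballP; exists e => // u.
by rewrite -ball_normE /= sub0r normrN => /ltW.
Qed.

Lemma quad_littleo q (e : R) : 0 < e -> \forall u \near (0 : plane R), `|quad q u| <= e * `|u|.
Proof.
move=> e0; set C := `|qcoef q 3| + `|qcoef q 4| + `|qcoef q 5|.
have C0 : 0 <= C by rewrite !addr_ge0.
have d0 : 0 < e / (C + 1) by rewrite divr_gt0 //; lra.
have := near0_norm d0; apply: filterS => u hu.
apply: le_trans (quad_bound q u) _; apply: ler_wpM2r => //.
rewrite -/C; apply: (@le_trans _ _ (C * (e / (C + 1)))); first exact: ler_wpM2l.
rewrite mulrCA ger_pMr // ler_pdivrMr; lra.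
Qed.

Lemma differentiable_from f x g0 g1 :
  (forall e : R, 0 < e -> \forall u \near (0 : plane R),
     `|f (x + u) - f x - linear_form g0 g1 u| <= e * `|u|) ->
  differentiable f x /\ 'd f x = linear_form g0 g1 :> (plane R -> R).
Proof.
move=> H.
have L : f \o shift x = cst (f x) + linear_form g0 g1 +o_ (0 : plane R) id.
  apply/eqaddoP => e e0; have := H e e0; apply: filterS => u.
  rewrite -[(_ - _) u]/(f (u + x) - (f x + linear_form g0 g1 u)).
  move=> hu; rewrite [u + x]addrC.
  by rewrite [X in `|X|](_ : _ = f (x + u) - f x - linear_form g0 g1 u) //; ring.
have c : continuous (linear_form g0 g1) by exact: linear_form_continuous.
have D := diff_unique c L.
by split => //; apply/diff_locallyP; rewrite D; split.
Qed.

(** The first-order expansions of [v] and of the polynomial are compared at [y + s *: u] and divided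
    by a small positive [s]. *)
Lemma diff_direction v y u q (e : R) : 0 < e -> differentiable v y ->
  (forall s, 0 <= s <= e -> v (y + s *: u) = ev q (y + s *: u)) -> 'd v y u = dev q y u.
Proof.
move=> e0 dv h; apply/eqP; rewrite -subr_eq0 -normr_eq0; apply/eqP.
have [_ /eqaddoP L] := (diff_locallyP y v).1 dv.
have B (r : R) : 0 < r -> `|'d v y u - dev q y u| <= r * (`|u| + `|quad q u|).
  move=> r0.
  have [d d0 Hd] := near_line u (L r r0).
  pose s := Num.min (Num.min d e) r.
  have s0 : 0 < s by rewrite !lt_min d0 e0 r0.
  have sd : s <= d by rewrite /s !ge_min lexx.
  have se : s <= e by rewrite /s !ge_min lexx orbT.
  have sr : s <= r by rewrite /s !ge_min lexx orbT.
  have ns : `|s| <= d by rewrite ger0_norm // ltW.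
  have := Hd s ns; rewrite add0r /=.
  rewrite -[(_ - _) (s *: u)]/(v (s *: u + y) - (v y + 'd v y (s *: u))).
  rewrite [s *: u + y]addrC h ?(ltW s0) // ev_expand devZ quadZ.
  have -> : v y = ev q y by have := h 0; rewrite lexx (ltW e0) scale0r addr0; exact.
  rewrite linearZ /= -[s *: 'd v y u]/(s * 'd v y u).
  rewrite [X in `|X| <= _](_ : _ = s * (dev q y u - 'd v y u + s * quad q u)); last by ring.
  rewrite normrM normrZ (ger0_norm (ltW s0)) mulrCA ler_pM2l // => H.
  rewrite distrC -[dev q y u - _](addrK (s * quad q u)).
  apply: le_trans (ler_normB _ _) _; rewrite [leRHS]mulrDr; apply: lerD => //.
  by rewrite normrM (ger0_norm (ltW s0)) ler_wpM2r.
set D := `|_| in B *; set K := _ + _ in B.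
have K0 : 0 <= K by rewrite addr_ge0.
apply/eqP; rewrite eq_le normr_ge0 andbT leNgt; apply/negP => D0.
(* For this [r] the bound [B] is at most [D / 2]. *)
have r0 : 0 < D / (K + 1) / 2 by rewrite !divr_gt0 //; lra.
have := B _ r0; rewrite leNgt => /negP; apply.
have : D / (K + 1) * K <= D.
  rewrite mulrAC ler_pdivrMr; last by lra.
  by rewrite ler_pM2l //; lra.
by move=> h1; rewrite mulrAC; lra.
Qed.

End Differential.

(** * Splines and their pieces *)

Section Correspondence.
Variable R : realType.
Implicit Types (x y z w a b c u h : plane R) (T : simplex R).
Implicit Types (q : 'rV[R]_6) (f v : plane R -> R).
Variables (Omega : set (plane R)) (Th : complex R).
Hypotheses (pm : polygonal_mesh Omega Th) (bd : exists a, boundary_point Th a).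
Local Notation V := {ffun Th -> 'rV[R]_6}.
Implicit Types (p : V).

Let mesh : triangle_mesh Th. Proof. by have [] := pm. Qed.
Let oO : open Omega. Proof. by have [] := pm. Qed.

(** As soon as there is one boundary edge, the boundary edges cover all of [closure Omega] outside
    [Omega], by [boundary_trace]. *)
Lemma hull_notin_trace T y : T \in Th -> hull T y -> ~ trace (boundary_pair Th) y -> Omega y.
Proof.
move=> tT hy nt; apply: contrapT => nO; apply: nt.
have [a [b ab]] := bd; rewrite -(boundary_trace pm ab); split => //.
by have [_ _ -> _] := pm; exists T.
Qed.

Lemma shared_edge_in T T' a b (t : R) : T \in Th -> T' \in Th -> T != T' -> a != b ->
  a \in T -> b \in T -> a \in T' -> b \in T' -> 0 < t < 1 -> Omega ((1 - t) *: a + t *: b).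
Proof.
move=> tT tT' n ab aT bT aT' bT' /andP[t0 t1].
have [k [eT ak bk _]] := mesh_triangle2 mesh tT aT bT ab.
apply: (hull_notin_trace tT).
  apply: (@hull_sub _ _ [fset a; b]%fset); first by rewrite fset_pair_sub aT.
  by apply/(hull2P _ ab); exists t; rewrite // !ltW.
move=> [c [d [bcd [s s01 e]]]]; have [cd [T1 tT1 [cT1 dT1 uniq1]]] := bcd.
have e' : (1 - t) *: a + t *: b + 0 *: k = (1 - s) *: c + s *: d by rewrite scale0r addr0.
have s1 : 1 - t + t + 0 = 1 :> R by ring.
have t1' : 0 < 1 - t by rewrite subr_gt0.
move: (tT); rewrite eT => tT0.
have [h1 h2 _] := mesh_bary_edge mesh ab ak bk tT0 tT1 cT1 dT1 cd (ltW t1') (ltW t0)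
  (lexx 0) s1 s01 e'.
have key S : S \in Th -> a \in S -> b \in S -> S = T1.
  move=> tS aS bS; have [[ea eb]|[ea eb]] := fset2_eq ab (h1 (lt0r_neq0 t1')) (h2 (lt0r_neq0 t0));
  by apply: uniq1; rewrite // -?ea -?eb.
by case/eqP: n; rewrite (key T) // (key T').
Qed.

Lemma hull_face_cases T T' y : T \in Th -> T' \in Th -> T != T' -> hull T y -> hull T' y ->
  (exists a b, [/\ a != b, a \in T, b \in T, a \in T' & b \in T'] /\
     exists2 t : R, 0 <= t <= 1 & y = (1 - t) *: a + t *: b) \/ (y \in T /\ y \in T').
Proof.
move=> tT tT' n hT hT'.
have [a [b [c [eT ab ac bc]]]] := fset3P (mesh.1 _ tT).1.
move: hT; rewrite eT => /(hull3P _ ab ac bc)[k [l [m [k0 l0 m0 s1 ey]]]].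
have tT0 := tT; rewrite eT in tT0; rewrite ey in hT'.
have [h1 h2 h3] := mesh_bary mesh ab ac bc tT0 tT' k0 l0 m0 s1 hT'.
have [ka|ka] := eqVneq k 0; have [la|la] := eqVneq l 0; have [ma|ma] := eqVneq m 0.
- by move: s1; rewrite ka la ma !addr0 => /esym/eqP; rewrite oner_eq0.
- right; have -> : y = c.
    by move: s1; rewrite ey ka la !add0r => ->; rewrite !scale0r !add0r scale1r.
  by split; [rewrite !inE eqxx orbT|exact: h3].
- right; have -> : y = b.
    by move: s1; rewrite ey ka ma !add0r addr0 => ->; rewrite !scale0r add0r addr0 scale1r.
  by split; [rewrite !inE eqxx orbT|exact: h2].
- left; exists b, c; split.
    by rewrite h2 // h3 // !inE !eqxx !orbT.
  exists m; first by apply/andP; split => //; lra.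
  by rewrite ey ka scale0r add0r; congr (_ *: _ + _); lra.
- right; have -> : y = a.
    by move: s1; rewrite ey la ma !addr0 => ->; rewrite !scale0r !addr0 scale1r.
  by split; [rewrite !inE eqxx|exact: h1].
- left; exists a, c; split.
    by rewrite h1 // h3 // !inE !eqxx !orbT.
  exists m; first by apply/andP; split => //; lra.
  by rewrite ey la scale0r addr0; congr (_ *: _ + _); lra.
- left; exists a, b; split.
    by rewrite h1 // h2 // !inE !eqxx !orbT.
  exists l; first by apply/andP; split => //; lra.
  by rewrite ey ma scale0r addr0; congr (_ *: _ + _); lra.
- case/eqP: n; apply: (mesh_sub mesh tT tT'); rewrite eT.
  by apply/fsubsetP => s; rewrite !inE -orbA => /or3P[]/eqP ->; [exact: h1|exact: h2|exact: h3].
Qed.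

Lemma boundary_pair_notin a b : boundary_pair Th a b -> ~ Omega a.
Proof.
move=> ab; apply: (boundary_trace_notin pm); exists a, b; split => //.
by exists 0; rewrite ?lexx ?ler01 // subr0 scale1r scale0r addr0.
Qed.

(** Along a shared edge this is [jet0_on_line]. No boundary edge starts at a vertex lying in
    [Omega], so there a class for adjacency across edges is the whole star. *)
Lemma jets_agree p T T' y : spline_coeffs Th p -> T \in Th -> T' \in Th -> Omega y ->
  hull T y -> hull T' y -> jet0 y (piece p T - piece p T').
Proof.
move=> hp tT tT' Oy hT hT'.
have [->|n] := eqVneq T T'; first by rewrite subrr; exact: jet00.
have [[a [b [[ab aT bT aT' bT'] [t t01 ->]]]]|[yT yT']] := hull_face_cases tT tT' n hT hT'.
  apply: jet0_on_line; first exact: (hp.2 T T' a b).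
  by apply: (hp.2 T T' b a); rewrite // eq_sym.
pose C := [fset S in Th | (y \in S) && `[< jet0 y (piece p T - piece p S) >]]%fset.
have inC S : (S \in C) = [&& S \in Th, y \in S & `[< jet0 y (piece p T - piece p S) >]].
  by rewrite !inE.
have cl : edge_class Th C y.
  split; first by move=> S; rewrite inC => /and3P[].
  move=> S S' a; rewrite !inC => /and3P[tS yS /asboolP j] tS' ay yS' aS aS'.
  rewrite tS' yS' /=; apply/asboolP; apply: jet0B j _.
  have [->|nS] := eqVneq S S'; first by rewrite subrr; exact: jet00.
  by apply: (hp.2 S S' y a) => //; rewrite eq_sym.
have C0 : C != fset0.
  apply/fset0Pn; exists T; rewrite inC tT yT subrr; apply/asboolP; exact: jet00.
have nb S a : S \in C -> a \in S -> ~ boundary_pair Th y a.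
  by move=> _ _ /boundary_pair_notin.
have := edge_class_complete mesh cl C0 nb tT' yT'.
by rewrite inC => /and3P[_ _ /asboolP].
Qed.

(** The points outside [Omega] matter too, because pieces are prescribed on closed triangles. If two
    values occurred at a vertex [y], the class of triangles with the value of [T] would have two
    boundary edges at [y] and the class of [T'] yet another one, against [boundary_degree]. *)
Lemma values_agree p T T' y : spline_coeffs Th p -> T \in Th -> T' \in Th ->
  hull T y -> hull T' y -> ev (piece p T) y = ev (piece p T') y.
Proof.
move=> hp tT tT' hT hT'.
have [->//|n] := eqVneq T T'.
have [[a [b [[ab aT bT aT' bT'] [t t01 ->]]]]|[yT yT']] := hull_face_cases tT tT' n hT hT'.
  apply/eqP; rewrite -subr_eq0 -evB; apply/eqP.
  have ja : jet0 a (piece p T - piece p T') by exact: (hp.2 T T' a b).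
  have jb : jet0 b (piece p T - piece p T').
    by apply: (hp.2 T T' b a); rewrite // eq_sym.
  by have [h _ _] := jet0_on_line t ja jb.
apply: contrapT => ne.
have share S S' a : S \in Th -> S' \in Th -> a != y -> y \in S -> y \in S' -> a \in S ->
    a \in S' -> ev (piece p S) y = ev (piece p S') y.
  move=> tS tS' ay yS yS' aS aS'; have [->//|nS] := eqVneq S S'.
  apply/eqP; rewrite -subr_eq0 -evB; apply/eqP.
  have ya : y != a by rewrite eq_sym.
  by have [h _ _] := hp.2 S S' y a tS tS' nS ya yS aS yS' aS'.
pose C S0 := [fset S in Th | (y \in S) && (ev (piece p S0) y == ev (piece p S) y)]%fset.
have inC S0 S : (S \in C S0) = [&& S \in Th, y \in S & ev (piece p S0) y == ev (piece p S) y].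
  by rewrite !inE.
have inC0 S0 : S0 \in Th -> y \in S0 -> S0 \in C S0 by move=> h1 h2; rewrite inC h1 h2 eqxx.
have cl S0 : edge_class Th (C S0) y.
  split; first by move=> S; rewrite inC => /and3P[].
  move=> S S' a; rewrite !inC => /and3P[tS yS /eqP e] tS' ay yS' aS aS'.
  by rewrite tS' yS' e; apply/eqP; exact: (share S S' a).
have ex S0 S1 : S0 \in Th -> y \in S0 -> S1 \in Th -> y \in S1 ->
    ev (piece p S0) y <> ev (piece p S1) y ->
    exists a S, [/\ S \in C S0, a \in S & boundary_pair Th y a].
  move=> t0 y0 t1 y1 n01; apply: contrapT => no.
  have C0 : C S0 != fset0 by apply/fset0Pn; exists S0; exact: inC0.
  have H := edge_class_complete mesh (cl S0) C0 _ t1 y1.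
  have : S1 \in C S0 by apply: H => S a tS aS ba; apply: no; exists a, S.
  by rewrite inC => /and3P[_ _ /eqP].
have [a1 [S1 [tS1 aS1 b1]]] := ex _ _ tT yT tT' yT' ne.
have [a3 [S3 [tS3 aS3 b3]]] := ex _ _ tT' yT' tT yT (fun e => ne (esym e)).
have [a2 [S2 [n21 tS2 aS2 b2]]] := edge_class_boundary mesh (fsubset_refl _) (cl T) tS1 aS1 b1.
have diff a S b S' : S \in C T -> S' \in C T' -> a \in S -> b \in S' ->
    boundary_pair Th y a -> a != b.
  rewrite !inC => /and3P[tS yS /eqP eS] /and3P[tS' yS' /eqP eS'] aS bS' [_ [S0 _ [_ _ u]]].
  apply/eqP => e; rewrite -e in bS'.
  by apply: ne; rewrite eS eS' (u S) // (u S').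
apply: (boundary_degree pm b1 b2 b3); first by rewrite eq_sym.
  exact: diff tS1 tS3 aS1 aS3 b1.
exact: diff tS2 tS3 aS2 aS3 b2.
Qed.

(** If several triangles contain [y], the choice is immaterial by [values_agree]. If none does, the
    default [fset0] is not in [Th] and its piece is 0. *)
Definition triangle_at y : simplex R := xget fset0 [set T | T \in Th /\ hull T y].

Definition glue p y : R := ev (piece p (triangle_at y)) y.

Lemma glueE p T y : spline_coeffs Th p -> T \in Th -> hull T y -> glue p y = ev (piece p T) y.
Proof.
move=> hp tT hT.
have [t0 h0] : triangle_at y \in Th /\ hull (triangle_at y) y.
  by rewrite /triangle_at; case: xgetP => [S -> //|/(_ T)]; case.
exact: values_agree hp t0 tT h0 hT.
Qed.

Lemma near_shift y (P : plane R -> Prop) : (\forall z \near y, P z) ->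
  \forall h \near (0 : plane R), P (y + h).
Proof.
move=> h; have c : (fun u : plane R => y + u) @ (0 : plane R) --> y.
  have := @cvgD _ _ _ (nbhs (0 : plane R)) _ (fun=> y) id y 0 (cvg_cst y) cvg_id.
  by rewrite addr0; exact.
exact: c h.
Qed.

Lemma near_triangle y : Omega y ->
  \forall z \near y, Omega z /\ exists T, [/\ T \in Th, hull T y & hull T z].
Proof.
move=> Oy; have N1 := mesh_near_star y mesh.
have N2 : \forall z \near y, Omega z := open_nbhs_nbhs (conj oO Oy).
near=> z; have Oz : Omega z by near: z.
have [T tT hT] := domain_hull pm Oz.
have hy : hull T y by move: T tT hT; near: z.
by split => //; exists T.
Unshelve. all: by end_near. Qed.

(** A triangle containing a point close to [y] also contains [y], and its piece has at [y] the same
    1-jet as that of [T]; only its quadratic part is left in the error. *)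
Lemma glue_diff p T y : spline_coeffs Th p -> Omega y -> T \in Th -> hull T y ->
  differentiable (glue p) y /\ 'd (glue p) y = dev (piece p T) y :> (plane R -> R).
Proof.
move=> hp Oy tT hT; apply: differentiable_from => e e0.
have N := near_shift (near_triangle Oy).
have Q : \forall h \near (0 : plane R), forall S, S \in Th ->
    `|quad (piece p S) h| <= e * `|h|.
  by apply: near_seq => S _; exact: quad_littleo.
near=> h.
have [_ [S [tS hS hS']]] : Omega (y + h) /\ exists T, [/\ T \in Th, hull T y & hull T (y + h)].
  by near: h.
have [j0 j1 j2] := jets_agree hp tS tT Oy hS hT.
rewrite (glueE hp tS hS') (glueE hp tS hS) ev_expand.
have -> : linear_form (grad0 (piece p T) y) (grad1 (piece p T) y) h = dev (piece p S) y h.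
  rewrite /dev; congr (linear_form _ _ _).
    by apply/esym/eqP; rewrite -subr_eq0 -grad0B j1.
  by apply/esym/eqP; rewrite -subr_eq0 -grad1B j2.
rewrite (_ : _ - _ - _ = quad (piece p S) h); last by ring.
by move: S tS {hS hS' j0 j1 j2}; near: h.
Unshelve. all: by end_near. Qed.

Lemma glue_C1 p : spline_coeffs Th p -> C1_on Omega (glue p).
Proof.
move=> hp y Oy; have [T tT hT] := domain_hull pm Oy.
have [dy ey] := glue_diff hp Oy tT hT; split => // u.
move=> A /nbhs_ballP[e /= e0 eA].
have N := near_triangle Oy.
have Q : \forall z \near y, forall S, S \in Th ->
    ball (dev (piece p S) y u) e (dev (piece p S) z u).
  apply: near_seq => S _.
  exact: (@dev_continuous R (piece p S) u y _ (nbhsx_ballx _ _ e0)).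
have eA' r : ball (dev (piece p T) y u) e r -> A r by rewrite -ey; exact: eA.
suff D : \forall z \near y, exists2 S, 'd (glue p) z u = dev (piece p S) z u &
    ball (dev (piece p T) y u) e (dev (piece p S) z u).
  by apply: filterS D => z [S eS bS]; apply: eA'; rewrite eS.
near=> z.
have [Oz [S [tS hS hS']]] : Omega z /\ exists T, [/\ T \in Th, hull T y & hull T z].
  by near: z.
have [_ ez] := glue_diff hp Oz tS hS'.
have [_ ey'] := glue_diff hp Oy tS hS.
exists S; first by rewrite ez.
have -> : dev (piece p T) y u = dev (piece p S) y u by rewrite -ey -ey'.
by move: S tS {hS hS' ez ey'}; near: z.
Unshelve. all: by end_near. Qed.

Lemma polynomial_onP (A : set (plane R)) v : polynomial_on 2 A v <->
  exists q, forall y, A y -> v y = ev q y.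
Proof.
have E (c : nat -> nat -> R) y :
    \sum_(i < 3) \sum_(j < 3 | (i + j <= 2)%N) c i j * y 0 0 ^+ i * y 0 1 ^+ j =
    c 0%N 0%N + c 1%N 0%N * y 0 0 + c 0%N 1%N * y 0 1 + c 2%N 0%N * y 0 0 ^+ 2
    + c 1%N 1%N * (y 0 0 * y 0 1) + c 0%N 2%N * y 0 1 ^+ 2.
  under eq_bigr do rewrite big_mkcond.
  rewrite !big_ord_recl !big_ord0 /= /bump /=.
  by rewrite !expr0 !expr1 /=; ring.
split.
  move=> [c hc]; exists (centered 0 (c 0%N 0%N) (c 1%N 0%N) (c 0%N 1%N) (c 2%N 0%N)
    (c 1%N 1%N) (c 0%N 2%N)) => y Ay.
  by rewrite (hc y Ay); refine (etrans (E c y) _); rewrite /ev !qcoefE !mxE; ring.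
move=> [q hq].
pose c (i j : nat) : R := match i, j with
  | 0%N, 0%N => qcoef q 0 | 1%N, 0%N => qcoef q 1 | 0%N, 1%N => qcoef q 2
  | 2%N, 0%N => qcoef q 3 | 1%N, 1%N => qcoef q 4 | 0%N, 2%N => qcoef q 5
  | _, _ => 0 end.
exists c => y Ay; rewrite (hq y Ay); exact: (esym (E c y)).
Qed.

Lemma glue_spline p : spline_coeffs Th p -> spline_space 2 Omega Th (glue p).
Proof.
move=> hp; split; first exact: glue_C1.
move=> T tT; apply/polynomial_onP; exists (piece p T) => y hT; exact: glueE.
Qed.

(* At an interior point [m] of the edge [ab], two sides of the triangle span the
   directions along which the spline coincides with its piece. *)
Lemma spline_gradient v T a b q (t : R) : T \in Th -> a \in T -> b \in T -> a != b ->
  0 < t < 1 -> (forall y, hull T y -> v y = ev q y) ->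
  differentiable v ((1 - t) *: a + t *: b) ->
  forall u, 'd v ((1 - t) *: a + t *: b) u = dev q ((1 - t) *: a + t *: b) u.
Proof.
move=> tT aT bT ab /andP[t0 t1] hv; set m := _ + _ => dv u.
have [c [e ac bc D0]] := mesh_triangle2 mesh tT aT bT ab.
have inT k l : 0 <= l -> 0 <= t + k -> t + k + l <= 1 ->
    hull T (m + (k *: (b - a) + l *: (c - a))).
  move=> l0 k0 kl; rewrite e; apply/(hull3P _ ab ac bc).
  exists (1 - t - k - l), (t + k), l; split => //; first by lra.
    by ring.
  by rewrite /m; apply: planeP; rewrite !mxE; ring.
have d1 : 'd v m (b - a) = dev q m (b - a).
  apply: (@diff_direction R v m (b - a) q (1 - t)) => //; first by rewrite subr_gt0.
  move=> s /andP[s0 s1]; apply: hv.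
  have := inT s 0; rewrite scale0r !addr0; apply => //; first by lra.
  by lra.
have d2 : 'd v m (c - a) = dev q m (c - a).
  apply: (@diff_direction R v m (c - a) q (1 - t)) => //; first by rewrite subr_gt0.
  move=> s /andP[s0 s1]; apply: hv.
  have := inT 0 s; rewrite scale0r !(add0r, addr0); apply => //; first exact: ltW.
  by lra.
have -> : u = (det3 a (a + u) c / det3 a b c) *: (b - a) +
    (det3 a b (a + u) / det3 a b c) *: (c - a).
  by have := D0; rewrite /det3 => D0'; apply: planeP; rewrite !mxE; field.
rewrite linearD !linearZ /= d1 d2 /dev.
by rewrite /linear_form /GRing.scale /= !mxE; ring.
Qed.

Lemma spline_pieces v : spline_space 2 Omega Th v -> exists p, spline_coeffs Th p /\
  forall T y, T \in Th -> hull T y -> v y = ev (piece p T) y.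
Proof.
move=> [C1 poly].
have ex T : exists q, T \in Th -> forall y, hull T y -> v y = ev q y.
  have [tT|tT] := boolP (T \in Th); last by exists 0.
  by have /polynomial_onP[q hq] := poly T tT; exists q.
have [f hf] := choice ex.
have pf T : T \in Th -> piece (of_pieces Th f) T = f T by exact: piece_of_pieces.
exists (of_pieces Th f); split; last first.
  by move=> T y tT hT; rewrite pf //; exact: hf.
split; first by move=> T h; exact: piece_out.
move=> T T' a b tT tT' n ab aT bT aT' bT'; rewrite !pf //.
have zero (t : R) : 0 < t < 1 -> jet0 ((1 - t) *: a + t *: b) (f T - f T').
  move=> t01; have Om := shared_edge_in tT tT' n ab aT bT aT' bT' t01.
  set m := _ + _ in Om *; have [dv _] := C1 m Om.
  have g := spline_gradient tT aT bT ab t01 (hf T tT) dv.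
  have g' := spline_gradient tT' aT' bT' ab t01 (hf T' tT') dv.
  have gg u : dev (f T) m u = dev (f T') m u by rewrite -g -g'.
  have sub S : a \in S -> b \in S -> hull S m.
    move=> aS bS; apply: (@hull_sub _ _ [fset a; b]%fset); first by rewrite fset_pair_sub aS.
    by apply/(hull2P _ ab); exists t => //; case/andP: t01 => h1 h2; rewrite !ltW.
  split.
  - rewrite evB -(hf T) //; last exact: sub.
    by rewrite -(hf T') ?subrr //; exact: sub.
  - have := gg (\row_(i < 2) (if i == 0 then 1 else 0)).
    rewrite /dev /linear_form !mxE /= !mulr0 !mulr1 !addr0 => e.
    by rewrite grad0B e subrr.
  - have := gg (\row_(i < 2) (if i == 0 then 0 else 1)).
    rewrite /dev /linear_form !mxE /= !mulr0 !mulr1 !add0r => e.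
    by rewrite grad1B e subrr.
have h1 : 0 < (3^-1 : R) < 1 by apply/andP; split; lra.
have h2 : 0 < (2 / 3 : R) < 1 by apply/andP; split; lra.
(* The ends of the edge may lie outside [Omega], where smoothness says nothing. The jets vanish at
   the points one third and two thirds along the edge, hence on its whole line. *)
have -> : a = (1 - (- 1)) *: ((1 - 3^-1) *: a + 3^-1 *: b) +
    (- 1) *: ((1 - 2 / 3) *: a + (2 / 3) *: b).
  by apply: planeP; rewrite !mxE; field.
by apply: jet0_on_line; exact: zero.
Qed.

(** Provides an open set on which a spline is given by its piece on [T], so that a spline vanishing
    on [Omega] has zero pieces. *)
Lemma near_centroid T : T \in Th ->
  Omega (centroid T) /\ \forall z \near centroid T, Omega z /\ hull T z.
Proof.
move=> tT; have [a [b [c [e ab ac bc]]]] := fset3P (mesh.1 _ tT).1.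
have t3 : 0 < 3^-1 :> R by rewrite invr_gt0.
have s1 : 3^-1 + 3^-1 + 3^-1 = 1 :> R by field.
have tT0 := tT; rewrite e in tT0.
have ec : centroid T = 3^-1 *: a + 3^-1 *: b + 3^-1 *: c by rewrite e centroid3.
have hc : hull T (centroid T).
  by rewrite ec e; apply/(hull3P _ ab ac bc); exists 3^-1, 3^-1, 3^-1; rewrite !(ltW t3).
have Oc : Omega (centroid T).
  apply: (hull_notin_trace tT hc) => -[d [d' [[dd' [T1 tT1 [dT1 d'T1 _]]] [s s01 es]]]].
  rewrite ec in es.
  have [h1 h2 h3] := mesh_bary_edge mesh ab ac bc tT0 tT1 dT1 d'T1 dd' (ltW t3) (ltW t3)
    (ltW t3) s1 s01 es.
  have {}h1 := h1 (lt0r_neq0 t3); have {}h2 := h2 (lt0r_neq0 t3).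
  have {}h3 := h3 (lt0r_neq0 t3).
  have [[ea eb]|[ea eb]] := fset2_eq ab h1 h2; move: h3;
    by rewrite -ea -eb !inE => /orP[]/eqP h; rewrite h eqxx in ac bc.
split => //; have := near_triangle Oc; apply: filterS => z [Oz [S [tS hS hz]]].
split => //; suff -> : T = S by [].
apply: (mesh_sub mesh tT tS); rewrite ec in hS.
have [h1 h2 h3] := mesh_bary mesh ab ac bc tT0 tS (ltW t3) (ltW t3) (ltW t3) s1 hS.
rewrite e; apply/fsubsetP => s; rewrite !inE -orbA => /or3P[]/eqP ->;
  [apply: h1|apply: h2|apply: h3]; exact: lt0r_neq0.
Qed.

Lemma ev_near0 q y : (\forall z \near y, ev q z = 0) -> q = 0.
Proof.
move=> N.
have key u : [/\ ev q y = 0, dev q y u = 0 & quad q u = 0].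
  have [r r0 H] := near_line u N.
  have e0 : ev q y = 0.
    by have := H 0; rewrite normr0 scale0r addr0; apply; exact: ltW.
  have h1 := H r; have h2 := H (- r).
  rewrite normrN ger0_norm ?lexx ?(ltW r0) // !ev_expand !devZ !quadZ e0 in h1 h2.
  have {}h1 := h1 isT; have {}h2 := h2 isT.
  have rn : r != 0 by rewrite gt_eqF.
  have h3 : r * dev q y u = 0 by lra.
  have h4 : r ^+ 2 * quad q u = 0 by lra.
  split => //.
    by move/eqP: h3; rewrite mulf_eq0 (negbTE rn) => /eqP.
  by move/eqP: h4; rewrite mulf_eq0 sqrf_eq0 (negbTE rn) => /eqP.
pose e1 : plane R := \row_(i < 2) (if i == 0 then 1 else 0).
pose e2 : plane R := \row_(i < 2) (if i == 0 then 0 else 1).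
have [e0 g1 q1] := key e1; have [_ g2 q2] := key e2; have [_ _ q3] := key (e1 + e2).
move: g1 q1 g2 q2 q3; rewrite /dev /linear_form /quad !mxE /= => g1 q1 g2 q2 q3.
rewrite [LHS](centeredE y) e0.
have -> : grad0 q y = 0 by lra.
have -> : grad1 q y = 0 by lra.
have -> : qcoef q 3 = 0 by lra.
have -> : qcoef q 5 = 0 by lra.
have -> : qcoef q 4 = 0 by lra.
by apply: qcoefP; rewrite !qcoefE; ring.
Qed.

Lemma spline_dimension d : dim_of (@spline_coeffs R Th Th) d ->
  has_dimension Omega (spline_space 2 Omega Th) d.
Proof.
move=> [U hU eU].
pose B := vbasis U.
have inB (i : 'I_(\dim U)) : spline_coeffs Th (B`_i).
  by apply/hU; apply: vbasis_mem; apply: mem_nth; rewrite size_tuple.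
have glue_sum (c : 'I_(\dim U) -> R) y T : T \in Th -> hull T y ->
    \sum_i c i * glue (B`_i) y = ev (piece (\sum_i c i *: B`_i) T) y.
  move=> tT hT; under eq_bigr do rewrite (glueE (inB _) tT hT).
  elim/big_rec2 : _ => [|i s s' _ ->].
    by rewrite piece0 /ev !qcoefE; ring.
  by rewrite pieceP evP.
rewrite -eU; exists (fun i => glue (B`_i)); split.
- by move=> i; apply: glue_spline; exact: inB.
- move=> c hc.
  have z : \sum_i c i *: B`_i = 0.
    apply: eq_piece => T tT; rewrite piece0.
    have [_ N] := near_centroid tT; apply: (@ev_near0 _ (centroid T)).
    by apply: filterS N => z [Oz hz]; rewrite -glue_sum //; exact: hc.
  have fB : free B := basis_free (vbasisP U).
  by move/freeP: fB => /(_ c z).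
- move=> v Sv; have [p [hp hv]] := spline_pieces Sv.
  have pU : p \in U by apply/hU.
  exists (fun i => coord B i p) => y Oy.
  have [T tT hT] := domain_hull pm Oy.
  by rewrite (glue_sum _ y T) // -(coord_vbasis pU) -(hv T y).
Qed.

End Correspondence.

Lemma simplicial_complex_mesh (R : realType) (Th : complex R) :
  (forall T, T \in Th -> #|` T| = 3%N /\ affinely_independent T) ->
  simplicial_complex (complex_of Th) -> triangle_mesh Th.
Proof.
move=> h [_ _ meet]; split => // T T' tT tT'.
have inK S : S \in Th -> S \in complex_of Th.
  move=> tS; apply/in_complex_of; split; last by exists S.
  by rewrite -cardfs_gt0 (h S tS).1.
by apply: meet; exact: inK.
Qed.

Theorem theorem5p7 (R : realType) (Omega : set (plane R)) (Th : complex R)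
  (N : nat) (x : nat -> plane R) (Ks : nat -> complex R)
  (hOmega : polygonal_domain_no_holes Omega)
  (hTh : triangulation_of Omega Th)
  (hcollapse : strong_collapse (complex_of Th) N x Ks)
  (hnoncollinear : noncollinear_condition N x Ks) :
  exists d : nat,
    [/\ has_dimension Omega (spline_space 2 Omega Th) d,
        d%:Z = strang_number 2 Th
      & strang_number 2 Th =
          6 * (#|` Th|)%:Z
          - 5 * (#|` interior_edges (complex_of Th)|)%:Z
          + 3 * (#|` interior_vertices (complex_of Th)|)%:Z].
Proof.
have [K0 Ktri Kx _ _] := hcollapse.
have [T3 _ eOmega] := hTh.
have [oO _ _ polygon] := hOmega.
have [sc0 ft0 _] := Ktri 0%N (leq0n N); rewrite K0 in sc0 ft0.
have mesh := simplicial_complex_mesh T3 sc0.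
have pm : polygonal_mesh Omega Th by split.
have bd : exists a, boundary_point Th a.
  have [bv _ _] := Kx 0%N (leq0n N); rewrite K0 in bv.
  exists (x 0%N); have := boundary_vertex_point ft0 bv.
  by rewrite triangles_complex_of // => T /T3[].
have [d hd e] := collapse_counted mesh hcollapse hnoncollinear
  (fun v v' => boundary_connected pm).
exists d; split => //; first exact: spline_dimension.
by rewrite strang_numberE; lia.
Qed.
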